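(* Let $m\ge 2$ be an integer and write $m-1=2^{i_1}+2^{i_2}+\cdots+2^{i_k}$ with $i_1<i_2<\cdots<i_k$ (so $k$ is the number of ones in the binary expansion of $m-1$); set $\alpha(m-1)=(k-1)^2$. Then $\mathcal{N}(G_m,2)$ is homotopy equivalent to a wedge of $2$-dimensional spheres. More precisely, \[\mathcal{N}(G_m,2)\simeq \mathcal{N}(G_{m-1},2)\vee\bigvee_{\alpha(m-1)}\mathbb{S}^2.\]
   Context: For an integer $m\ge 1$, $G_m$ is the graph whose vertices are the integers $0,1,\ldots,m-1$, viewed as binary strings, two vertices being adjacent if and only if their binary representations differ in exactly one position (equivalently, $G_m$ is the induced subgraph of a sufficiently large hypercube graph on these $m$ binary strings). For a finite simple connected graph $G$ and a real number $r\ge 0$, the Čech complex $\mathcal{N}(G,r)$ is the simplicial complex with vertex set $V(G)$ in which a finite nonempty set $\sigma\subseteq V(G)$ is a simplex if and only if the closed balls of radius $\frac r2$ centered at the vertices of $\sigma$ have a common point, the balls being taken in the geometric realization of $G$ equipped with the shortest path metric in which each edge is isometric to $[0,1]$. An empty wedge of spheres means a contractible space. *)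

(* Defs.v *)
From HB Require Import structures.
From mathcomp Require Import all_boot all_order all_algebra.
From mathcomp Require Import all_classical all_reals all_analysis.
From mathcomp Require Import homotopy.

Set Implicit Arguments.
Unset Strict Implicit.
Unset Printing Implicit Defensive.

Import Order.TTheory GRing.Theory Num.Theory.
Import numFieldNormedType.Exports.

Local Open Scope classical_set_scope.
Local Open Scope ring_scope.

(** * The graphs [G_m] *)

Definition bit (n p : nat) : bool := odd (n %/ 2 ^ p).

(* Bits at positions [p >= m] of numbers below [m] all vanish, since
   [m < 2 ^ m], so ranging over the positions [p < m] loses nothing. *)
Definition bingraph (m : nat) : rel 'I_m :=
  fun u v => #|[pred p : 'I_m | bit u p != bit v p]| == 1%N.
Arguments bingraph m u v : clear implicits.

Lemma bingraph_sym m : symmetric (bingraph m).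
Proof.
move=> u v; rewrite /bingraph; congr (_ == _).
by apply: eq_card => p; rewrite !inE eq_sym.
Qed.

Lemma bingraph_irrefl m : irreflexive (bingraph m).
Proof.
move=> u; rewrite /bingraph (_ : #|_| = 0%N) //.
by apply: eq_card0 => p; rewrite !inE eqxx.
Qed.

(** * Geometric realizations

    A simplicial complex on the vertices [0, ..., n-1] is given by the set of
    its simplices; vertex [v] is realized as the [v]-th basis vector of
    [R^n]. *)

Definition geom_simplex (R : realType) (n : nat) (s : {set 'I_n}) :
    set 'rV[R]_n :=
  [set x | [/\ forall i, 0 <= x 0 i, \sum_i x 0 i = 1 &
               forall i, i \notin s -> x 0 i = 0]].

Definition realization (R : realType) (n : nat) (K : set {set 'I_n}) :
    set 'rV[R]_n :=
  \bigcup_(s in K) @geom_simplex R n s.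

Definition graph_complex (n : nat) (e : rel 'I_n) : set {set 'I_n} :=
  [set s | (exists v, s = finset.set1 v) \/
           (exists u v, e u v /\ s = [set u; v]%SET)].

Definition same_edge (R : realType) (n : nat) (e : rel 'I_n)
    (x y : 'rV[R]_n) : Prop :=
  exists u v, [/\ e u v, geom_simplex [set u; v]%SET x &
                         geom_simplex [set u; v]%SET y].

(* [edge_path e x y l]: a piecewise linear path of length [l] from [x] to [y]
   in the realization of the graph. The norm on ['rV[R]_n] is the sup norm, so
   between the points [(1 - t) u + t v] and [(1 - t') u + t' v] of an edge
   [{u, v}] it gives [`|t - t'|]: each edge is isometric to [[0, 1]]. *)
Inductive edge_path (R : realType) (n : nat) (e : rel 'I_n) :
    'rV[R]_n -> 'rV[R]_n -> R -> Prop :=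
| edge_path_nil x : edge_path e x x 0
| edge_path_cons x y z l :
    same_edge e x y -> edge_path e y z l -> edge_path e x z (`|y - x| + l).

Definition graph_dist (R : realType) (n : nat) (e : rel 'I_n)
    (x y : 'rV[R]_n) : \bar R :=
  ereal_inf [set l%:E | l in edge_path e x y].

Definition graph_closed_ball (R : realType) (n : nat) (e : rel 'I_n)
    (x : 'rV[R]_n) (r : R) : set 'rV[R]_n :=
  [set p | realization (graph_complex e) p /\ (graph_dist e x p <= r%:E)%E].

Definition cech (R : realType) (n : nat) (e : rel 'I_n) (r : R) :
    set {set 'I_n} :=
  [set s | s != finset.set0 /\
           exists p, forall v, v \in s ->
             graph_closed_ball e (delta_mx 0 v) (r / 2) p].

(* The space N(G_m, 2). *)
Definition cechG2 (R : realType) (m : nat) : topologicalType :=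
  set_type (@realization R m (cech (bingraph m) (2 : R))).

(** * Wedges of spheres *)

Definition sphere (R : realType) (d : nat) : set 'rV[R]_d.+1 :=
  [set x | \sum_i x 0 i ^+ 2 = 1].
Arguments sphere R d : clear implicits.

Lemma sphere_delta (R : realType) (d : nat) :
  (delta_mx 0 0 : 'rV[R]_d.+1) \in sphere R d.
Proof.
rewrite inE /sphere /= (bigD1 0) //= big1 ?addr0 ?mxE ?expr1n // => i /negPf i0.
by rewrite mxE i0 andbF expr0n.
Qed.

Definition sphere_pt (R : realType) (d : nat) : sphere R d :=
  SigSub (sphere_delta R d).

(* The wedge of the pointed space [(X, x0)], which is the component of index
   [None], and of [n] copies of the [d]-sphere. *)
Definition wedge_spheres_family (R : realType) (d n : nat)
    (X : topologicalType) (i : option 'I_n) : topologicalType :=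
  if i is Some _ then set_type (sphere R d) else X.

Definition wedge_spheres_pt (R : realType) (d n : nat)
    (X : topologicalType) (x0 : X) (i : option 'I_n) :
    wedge_spheres_family R d X i :=
  if i is Some _ return wedge_spheres_family R d X i
  then sphere_pt R d else x0.

Definition wedge_spheres (R : realType) (d n : nat)
    (X : topologicalType) (x0 : X) : topologicalType :=
  wedge (@wedge_spheres_pt R d n X x0).

(* A one-point component is neutral for the wedge; it makes the wedge of no
   sphere a point rather than the empty space. *)
Definition bouquet (R : realType) (d n : nat) : topologicalType :=
  @wedge_spheres R d n (discrete_topology unit) tt.

(** * Homotopy equivalence *)

Definition homotopic (R : realType) (X Y : topologicalType) (f g : X -> Y) :
    Prop :=
  exists H : X * R -> Y,
    [/\ {within [set: X] `*` `[0, 1], continuous H},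
        forall x, H (x, 0) = f x & forall x, H (x, 1) = g x].

Definition homotopy_equivalent (R : realType) (X Y : topologicalType) : Prop :=
  exists (f : X -> Y) (g : Y -> X),
    [/\ continuous f, continuous g,
        homotopic R (g \o f) idfun & homotopic R (f \o g) idfun].

(* Main.v *)
(** Two facts reduce the theorem to combinatorics. At scale 2 the simplices of
    the Čech complex are the nonempty subsets of closed neighbourhoods [N[c]]
    (any witness can be moved to a vertex carrying some of its weight). And
    passing from [m - 1] to [m] vertices adds the vertex [v = m - 1], whose
    neighbours are obtained by deleting one of its [k] ones. They are
    independent, two of them have exactly one further common neighbour, and
    every other vertex is adjacent to at most two of them.

    So up to homotopy the link of [v] is a graph: a complete graph on the
    neighbours of [v], each of whose edges is doubled by a path through the
    further common neighbour. Fixing a neighbour [w0], and letting each vertex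
    of the link belong to one neighbour of [v] only, selects a spanning tree.
    The cone over the tree collapses, leaving the old complex, and the
    [C(k - 1, 2) + C(k, 2) = (k - 1)^2] remaining edges give as many triangles
    with apex [v]. The boundary of each is null-homotopic: three neighbours of
    [v] are coned off from the vertex of their 3-cube opposite to [v], and the
    other boundaries reduce to such triples. Attaching a simplex along a
    null-homotopic boundary amounts to wedging on a sphere.

    All homotopies fix the base point, so that the equivalences can be wedged
    with spheres and composed; this gives the bouquet by induction on [m]. *)

Require Import Defs.
From mathcomp Require Import all_boot all_order all_algebra.
From mathcomp Require Import all_classical all_reals all_analysis.
From mathcomp Require Import homotopy.
From mathcomp Require Import ring lra zify.

Set Implicit Arguments.
Unset Strict Implicit.
Unset Printing Implicit Defensive.

Import Order.TTheory GRing.Theory Num.Theory.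
Import numFieldNormedType.Exports.

Local Open Scope classical_set_scope.
Local Open Scope ring_scope.

(** * Continuous maps *)

(* A rigid head symbol for [continuous], so that the tactic [cts] can match
   on the shape of the function. *)
Definition cts (X Y : topologicalType) (f : X -> Y) : Prop := continuous f.

Section Continuity.
Context {X Y Z : topologicalType}.

Lemma cts_id : cts (fun x : X => x).
Proof. by move=> x. Qed.

Lemma cts_cst (y : Y) : cts (fun _ : X => y).
Proof. by move=> x; exact: cvg_cst. Qed.

Lemma cts_comp (g : Y -> Z) (f : X -> Y) :
  cts g -> cts f -> cts (fun x => g (f x)).
Proof. by move=> cg cf x; apply: continuous_comp; [exact: cf|exact: cg]. Qed.

Lemma cts_pair (f : X -> Y) (g : X -> Z) :
  cts f -> cts g -> cts (fun x => (f x, g x)).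
Proof. by move=> cf cg x; apply: cvg_pair; [exact: cf|exact: cg]. Qed.

Lemma cts_fst (f : X -> Y * Z) : cts f -> cts (fun x => (f x).1).
Proof. by move=> cf x; apply: continuous_comp; [exact: cf|exact: cvg_fst]. Qed.

Lemma cts_snd (f : X -> Y * Z) : cts f -> cts (fun x => (f x).2).
Proof. by move=> cf x; apply: continuous_comp; [exact: cf|exact: cvg_snd]. Qed.

Lemma cts_ext (g f : X -> Y) : f =1 g -> cts g -> cts f.
Proof. by move=> /funext ->. Qed.

Lemma cts_val (A : set X) (f : Z -> set_type A) :
  cts f -> cts (fun z => \val (f z)).
Proof.
by move=> cf z; apply: continuous_comp; [exact: cf|exact: initial_continuous].
Qed.

Lemma cts_sub (A : set X) (f : Z -> set_type A) :
  cts (fun z => \val (f z)) -> cts f.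
Proof. by move=> cf; apply: continuous_comp_initial. Qed.

End Continuity.

Section RealContinuity.
Context {R : realType} {X : topologicalType}.
Implicit Types f g : X -> R.

Lemma ctsD f g : cts f -> cts g -> cts (fun x => f x + g x).
Proof. by move=> cf cg x; apply: cvgD; [exact: cf|exact: cg]. Qed.

Lemma ctsN f : cts f -> cts (fun x => - f x).
Proof. by move=> cf x; apply: cvgN; exact: cf. Qed.

Lemma ctsM f g : cts f -> cts g -> cts (fun x => f x * g x).
Proof. by move=> cf cg x; apply: cvgM; [exact: cf|exact: cg]. Qed.

Lemma ctsV f : (forall x, f x != 0) -> cts f -> cts (fun x => (f x)^-1).
Proof. by move=> f0 cf x; apply: cvgV => //; exact: cf. Qed.

Lemma ctsX f n : cts f -> cts (fun x => f x ^+ n).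
Proof.
move=> cf; elim: n => [|n IH]; first exact: (@cts_cst _ _ (1 : R)).
by under eq_fun do rewrite exprS; exact: ctsM.
Qed.

Lemma cts_max f g : cts f -> cts g -> cts (fun x => Num.max (f x) (g x)).
Proof. by move=> cf cg x; apply: continuous_max; [exact: cf|exact: cg]. Qed.

Lemma cts_min f g : cts f -> cts g -> cts (fun x => Num.min (f x) (g x)).
Proof. by move=> cf cg x; apply: continuous_min; [exact: cf|exact: cg]. Qed.

Lemma cts_sqrt f : cts f -> cts (fun x => Num.sqrt (f x)).
Proof.
by move=> cf; apply: (@cts_comp _ _ _ Num.sqrt) => //; exact: sqrt_continuous.
Qed.

Lemma cts_bigop (op : R -> R -> R) (idx : R) (I : Type) (r : seq I)
    (P : pred I) (F : I -> X -> R) :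
  (forall f g, cts f -> cts g -> cts (fun x => op (f x) (g x))) ->
  (forall i, cts (F i)) -> cts (fun x => \big[op/idx]_(i <- r | P i) F i x).
Proof.
move=> cop cF; elim: r => [|i r IH].
  by under eq_fun do rewrite big_nil; exact: cts_cst.
by under eq_fun do rewrite big_cons; case: (P i) => //; exact: cop.
Qed.

Lemma cts_entry n (f : X -> 'rV[R]_n) i : cts f -> cts (fun x => f x 0 i).
Proof.
move=> cf; apply: (@cts_comp _ _ _ (fun M : 'rV[R]_n => M 0 i)) => //.
exact: coord_continuous.
Qed.

Lemma cts_row n (f : X -> 'I_n -> R) :
  (forall i, cts (f ^~ i)) -> cts (fun x => \row_i f x i : 'rV[R]_n).
Proof.
move=> cf x U [P PU PsubU].
suff: nbhs x (fun y => forall i, P 0 i (f y i)).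
  by apply: filterS => y Py; apply: PsubU => i j; rewrite (ord1 i) mxE.
by apply: filter_forall => i; apply: (cf i); have := PU 0 i; rewrite mxE.
Qed.

Lemma cts_rowD n (f g : X -> 'rV[R]_n) : cts f -> cts g -> cts (fun x => f x + g x).
Proof. by move=> cf cg x; apply: cvgD; [exact: cf|exact: cg]. Qed.

Lemma cts_rowN n (f : X -> 'rV[R]_n) : cts f -> cts (fun x => - f x).
Proof. by move=> cf x; apply: cvgN; exact: cf. Qed.

Lemma cts_rowZ n (a : X -> R) (f : X -> 'rV[R]_n) :
  cts a -> cts f -> cts (fun x => a x *: f x).
Proof. by move=> ca cf x; apply: cvgZ; [exact: ca|exact: cf]. Qed.

End RealContinuity.

Ltac cts_step :=
  match goal with
  | |- forall _, cts _ => intro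
  | H : ?P |- ?P => exact H
  | |- cts fst => exact (@cts_fst _ _ _ (fun x => x) cts_id)
  | |- cts snd => exact (@cts_snd _ _ _ (fun x => x) cts_id)
  | |- cts (fun _ => ?y) => exact (@cts_cst _ _ y)
  | |- cts (fun x => x) => exact cts_id
  | |- cts (fun x => (@?f x) + (@?g x)) => refine (@ctsD _ _ f g _ _)
  | |- cts (fun x => (@?f x) + (@?g x)) => refine (@cts_rowD _ _ _ f g _ _)
  | |- cts (fun x => (@?f x) * (@?g x)) => refine (@ctsM _ _ f g _ _)
  | |- cts (fun x => - (@?f x)) => refine (@ctsN _ _ f _)
  | |- cts (fun x => - (@?f x)) => refine (@cts_rowN _ _ _ f _)
  | |- cts (fun x => (@?f x) ^+ ?n) => refine (@ctsX _ _ f n _)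
  | |- cts (fun x => (@?f x)^-1) => refine (@ctsV _ _ f _ _)
  | |- cts (fun x => (@?f x) *: (@?g x)) => refine (@cts_rowZ _ _ _ f g _ _)
  | |- cts (fun x => Num.max (@?f x) (@?g x)) => refine (@cts_max _ _ f g _ _)
  | |- cts (fun x => Num.min (@?f x) (@?g x)) => refine (@cts_min _ _ f g _ _)
  | |- cts (fun x => Num.sqrt (@?f x)) => refine (@cts_sqrt _ _ f _)
  | |- cts (fun x => \sum_(i <- ?r | @?P i) @?F i x) =>
      refine (@cts_bigop _ _ _ _ _ r P (fun i x => F i x) (@ctsD _ _) _)
  | |- cts (fun x => \big[Num.max/?a]_(i <- ?r | @?P i) @?F i x) =>
      refine (@cts_bigop _ _ _ _ _ r P (fun i x => F i x) (@cts_max _ _) _)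
  | |- cts (fun x => \big[Num.min/?a]_(i <- ?r | @?P i) @?F i x) =>
      refine (@cts_bigop _ _ _ _ _ r P (fun i x => F i x) (@cts_min _ _) _)
  | |- cts (fun x => (@?f x, @?g x)) => refine (@cts_pair _ _ _ f g _ _)
  | |- cts (fun x => (@?f x).1) => refine (@cts_fst _ _ _ f _)
  | |- cts (fun x => (@?f x).2) => refine (@cts_snd _ _ _ f _)
  | |- cts (fun x => fun_of_matrix (@?f x) _ ?i) =>
      refine (@cts_entry _ _ _ f i _)
  | |- cts (fun x => @isSub.val_subdef _ _ _ _ (@?f x)) => refine (@cts_val _ _ _ f _)
  | |- cts (fun x => proj1_sig (@?f x)) => refine (@cts_val _ _ _ f _)
  | H : cts ?F |- cts (fun x => ?F (@?f x)) => refine (@cts_comp _ _ _ F f H _)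
  | H : forall l, cts (?F l) |- cts (fun x => ?F ?l (@?f x)) =>
      refine (@cts_comp _ _ _ (F l) f (H l) _)
  end.
Ltac cts := repeat cts_step.

Section Gluing.
Context {X Y : topologicalType}.

Lemma cts_within_eq (A : set X) (f g : X -> Y) : cts g ->
  (forall x, A x -> f x = g x) -> {within A, continuous f}.
Proof.
move=> cg fg; apply: (@subspace_eq_continuous _ _ _ g); last exact: continuous_subspaceT.
by move=> x /set_mem Ax; rewrite /from_subspace fg.
Qed.

Lemma cts_within_sub (A : set X) (f : X -> Y) :
  cts (fun a : set_type A => f (\val a)) -> {within A, continuous f}.
Proof. by move=> cf; apply/subspace_sigL_continuousP. Qed.

Lemma cts_closed_cover (I : finType) (C : I -> set X) (f : X -> Y) :
  (forall i, closed (C i)) -> (forall x, exists i, C i x) ->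
  (forall i, {within C i, continuous f}) -> cts f.
Proof.
move=> cC cov fC.
suff union (s : seq I) : {within \big[setU/set0]_(i <- s) C i, continuous f} /\
    closed (\big[setU/set0]_(i <- s) C i).
  have [] := union (index_enum I).
  rewrite (_ : \big[setU/set0]_(i <- _) _ = setT) => [cf _|].
    exact: (continuous_subspace_setT f).2 cf.
  apply/seteqP; split=> x // _; have [i Ci] := cov x.
  by rewrite -bigcup_seq; exists i => //=; rewrite mem_index_enum.
elim: s => [|i s [IH clIH]].
  by rewrite big_nil; split; [exact: continuous_subspace0|exact: closed0].
by rewrite big_cons; split; [exact: withinU_continuous|exact: closedU].
Qed.

Lemma cts_closed_glue (I : finType) (C : I -> set X) (f : I -> X -> Y) (h : X -> Y) :
  (forall i, closed (C i)) -> (forall x, exists i, C i x) -> (forall i, cts (f i)) ->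
  (forall i x, C i x -> h x = f i x) -> cts h.
Proof.
by move=> cC cov cf hf; apply: (cts_closed_cover cC cov) => i; exact: cts_within_eq (hf i).
Qed.

End Gluing.

Section RealCutoff.
Context {R : realType} {X : topologicalType}.

Lemma closed_preimage (Y : topologicalType) (f : X -> Y) (A : set Y) :
  cts f -> closed A -> closed (f @^-1` A).
Proof. by move=> cf cA; apply: preimage_closed => // x _; exact: cf. Qed.

Lemma closed_le_fun (f g : X -> R) : cts f -> cts g -> closed [set x | f x <= g x].
Proof.
move=> cf cg; rewrite (_ : [set x | _] = (fun x => g x - f x) @^-1` [set y | 0 <= y]).
  by apply: closed_preimage; [cts|exact: closed_ge].
by apply/seteqP; split=> x /=; rewrite subr_ge0.
Qed.

Lemma cts_if_le (Y : topologicalType) (a b : X -> R) (f g : X -> Y) :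
  cts a -> cts b -> cts f -> cts g -> (forall x, a x = b x -> f x = g x) ->
  cts (fun x => if a x <= b x then f x else g x).
Proof.
move=> ca cb cf cg fg.
pose side i := if i then [set x | a x <= b x] else [set x | b x <= a x].
apply: (@cts_closed_glue _ _ bool side (fun i => if i then f else g)).
- by case; exact: closed_le_fun.
- by move=> x; have [h|h] := orP (le_total (a x) (b x)); [exists true|exists false].
- by case.
- case=> x /= h; first by rewrite h.
  by case: ifPn => // ab; apply/fg/eqP; rewrite eq_le ab h.
Qed.

End RealCutoff.

Section UnitClamp.
Context {R : realType}.

Definition unit_clamp (t : R) : R := Num.max 0 (Num.min 1 t).

Lemma unit_clamp_cts : cts unit_clamp.
Proof. by rewrite /unit_clamp; cts. Qed.

Lemma unit_clamp_itv t : 0 <= unit_clamp t <= 1.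
Proof. by rewrite le_max lexx /= ge_max ler01 ge_min lexx. Qed.

Lemma unit_clamp_id t : 0 <= t <= 1 -> unit_clamp t = t.
Proof. by move=> /andP[t0 t1]; rewrite /unit_clamp min_r // max_r. Qed.

Lemma unit_clamp0 : unit_clamp 0 = 0.
Proof. by rewrite unit_clamp_id // lexx ler01. Qed.

Lemma unit_clamp1 : unit_clamp 1 = 1.
Proof. by rewrite unit_clamp_id // lexx ler01. Qed.

End UnitClamp.

(** * Relative homotopies and pointed equivalences *)

(* Homotopies are required to be continuous on all of [X * R], which loses
   nothing since the time parameter can be clamped to [[0, 1]]. *)
Definition homotopic_rel (R : realType) (X Y : topologicalType) (A : set X)
    (f g : X -> Y) : Prop :=
  exists H : X * R -> Y, [/\ cts H, forall x, H (x, 0) = f x,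
    forall x, H (x, 1) = g x & forall x t, A x -> H (x, t) = f x].

Definition pointed_equiv (R : realType) (X Y : topologicalType) (x : X) (y : Y) :
    Prop :=
  exists (f : X -> Y) (g : Y -> X), [/\ cts f, cts g, f x = y /\ g y = x,
    homotopic_rel R [set x] (fun a => g (f a)) (fun a => a) &
    homotopic_rel R [set y] (fun b => f (g b)) (fun b => b)].

Section RelativeHomotopy.
Context {R : realType}.
Implicit Types X Y Z W : topologicalType.

Lemma homotopic_rel_refl X Y (A : set X) (f : X -> Y) :
  cts f -> homotopic_rel R A f f.
Proof. by move=> cf; exists (fun z => f z.1); split=> //; cts. Qed.

Lemma homotopic_rel_eq X Y (A : set X) (f g : X -> Y) :
  cts f -> f =1 g -> homotopic_rel R A f g.
Proof. by move=> cf /funext <-; exact: homotopic_rel_refl. Qed.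

Lemma homotopic_rel_sym X Y (A : set X) (f g : X -> Y) :
  homotopic_rel R A f g -> homotopic_rel R A g f.
Proof.
move=> [H [cH H0 H1 HA]]; exists (fun z => H (z.1, 1 - z.2)); split=> /=.
- by cts.
- by move=> x; rewrite subr0.
- by move=> x; rewrite subrr.
- by move=> x t Ax; rewrite -H1 !HA.
Qed.

Lemma homotopic_rel_trans X Y (A : set X) (g f h : X -> Y) :
  homotopic_rel R A f g -> homotopic_rel R A g h -> homotopic_rel R A f h.
Proof.
move=> [H [cH H0 H1 HA]] [K [cK K0 K1 KA]].
exists (fun z => if z.2 <= 2^-1 then H (z.1, 2 * z.2) else K (z.1, 2 * z.2 - 1)).
split=> /=.
- apply: cts_if_le; cts.
  by move=> [x t] /= ->; rewrite mulfV // subrr H1 K0.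
- by move=> x; rewrite invr_ge0 ler0n mulr0 H0.
- move=> x; rewrite ifF; last by apply/negbTE; rewrite -ltNge; lra.
  by rewrite (_ : 2 * 1 - 1 = 1) ?K1 //; lra.
- by move=> x t Ax; case: ifP => _; rewrite ?HA // KA // -H1 HA.
Qed.

Lemma homotopic_rel_comp X Y Z W (C : set Z) (A : set X) (k : Z -> X) (f g : X -> Y)
    (h : Y -> W) : cts k -> k @` C `<=` A -> cts h -> homotopic_rel R A f g ->
  homotopic_rel R C (fun z => h (f (k z))) (fun z => h (g (k z))).
Proof.
move=> ck kC ch [H [cH H0 H1 HA]].
exists (fun z => h (H (k z.1, z.2))); split=> [|z|z|z t Cz] /=.
- by cts.
- by rewrite H0.
- by rewrite H1.
- by rewrite HA //; apply: kC; exists z.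
Qed.

Lemma homotopic_rel_homotopic X Y (A : set X) (f g : X -> Y) :
  homotopic_rel R A f g -> homotopic R f g.
Proof.
by move=> [H [cH H0 H1 _]]; exists H; split=> //; exact: continuous_subspaceT.
Qed.

Lemma pointed_equiv_trans Y X Z (y : Y) (x : X) (z : Z) :
  pointed_equiv R x y -> pointed_equiv R y z -> pointed_equiv R x z.
Proof.
move=> [f [g [cf cg [fx gy] gf fg]]] [f' [g' [cf' cg' [fy gz] gf' fg']]].
exists (fun a => f' (f a)), (fun a => g (g' a)); split.
- exact: cts_comp.
- exact: cts_comp.
- by rewrite fx fy gz gy.
- apply: homotopic_rel_trans gf; apply: homotopic_rel_comp cg gf' => //.
  by move=> _ [_ -> <-].
- apply: homotopic_rel_trans fg'; apply: homotopic_rel_comp cf' fg => //.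
  by move=> _ [_ -> <-].
Qed.

Lemma homeomorphic_pointed_equiv X Y (x : X) (y : Y) (f : X -> Y) (g : Y -> X) :
  cts f -> cts g -> cancel f g -> cancel g f -> f x = y -> pointed_equiv R x y.
Proof.
move=> cf cg fK gK fx; exists f, g; split=> //.
- by rewrite -fx fK.
- by apply: homotopic_rel_eq => //; exact: cts_comp.
- by apply: homotopic_rel_eq => //; exact: cts_comp.
Qed.

Lemma pointed_equiv_refl X (x : X) : pointed_equiv R x x.
Proof. by apply: (@homeomorphic_pointed_equiv _ _ _ _ id id) => //; exact: cts_id. Qed.

Lemma pointed_equiv_homotopy_equivalent X Y (x : X) (y : Y) :
  pointed_equiv R x y -> homotopy_equivalent R X Y.
Proof.
move=> [f [g [cf cg _ gf fg]]]; exists f, g.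
by split=> //; [exact: homotopic_rel_homotopic gf|exact: homotopic_rel_homotopic fg].
Qed.

Lemma deformation_retract_pointed_equiv (T : topologicalType) (A B : set T)
    (phi : T * R -> T) :
  A `<=` B -> cts phi ->
  (forall x t, B x -> 0 <= t <= 1 -> B (phi (x, t))) ->
  (forall x, B x -> phi (x, 0) = x) -> (forall x, B x -> A (phi (x, 1))) ->
  (forall x t, A x -> phi (x, t) = x) ->
  forall x (xB : x \in B) (xA : x \in A),
    pointed_equiv R (SigSub xB : set_type B) (SigSub xA : set_type A).
Proof.
move=> AB cphi phiB phi0 phi1 phiA x xB xA; have cc := @unit_clamp_cts R.
have retrP (z : set_type B) : phi (\val z, 1) \in A.
  by rewrite inE; apply: phi1; exact: set_mem (valP z).
have inclP (z : set_type A) : \val z \in B by rewrite inE; exact/AB/set_mem/valP.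
have flowP (z : set_type B * R) : phi (\val z.1, unit_clamp (1 - z.2)) \in B.
  by rewrite inE; apply: phiB; [exact: set_mem (valP _)|exact: unit_clamp_itv].
exists (fun z => SigSub (retrP z)), (fun z => SigSub (inclP z)); split.
- by apply: cts_sub => /=; cts.
- by apply: cts_sub => /=; cts.
- by split; apply: val_inj => //=; apply: phiA; exact/set_mem.
- exists (fun z => SigSub (flowP z)); split.
  + by apply: cts_sub => /=; cts.
  + by move=> z; apply: val_inj; rewrite /= subr0 unit_clamp1.
  + move=> z; apply: val_inj; rewrite /= subrr unit_clamp0.
    by apply: phi0; exact: set_mem (valP z).
  + by move=> z t ->; apply: val_inj => /=; rewrite !phiA //; exact/set_mem.
- apply: homotopic_rel_eq => [|z]; first by apply: cts_sub => /=; cts.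
  by apply: val_inj => /=; apply: phiA; exact: set_mem (valP z).
Qed.

End RelativeHomotopy.

(** * Wedges of spheres *)

Lemma set_type_hausdorff (X : topologicalType) (A : set X) :
  hausdorff_space X -> hausdorff_space (set_type A).
Proof.
move=> hX x y xy; apply: val_inj; apply: hX => U V Ux Vy.
have vc := @cts_val _ _ A _ (@cts_id (set_type A)).
by have [z [Uz Vz]] := xy _ _ (vc _ _ Ux) (vc _ _ Vy); exists (\val z).
Qed.

Section WedgeSpheres.
Context {R : realType} {d n : nat} {X : topologicalType} (x0 : X).
Local Notation W := (@wedge_spheres R d n X x0).
Local Notation pt := (@wedge_spheres_pt R d n X x0).

Definition wedge_base (x : X) : W := wedge_lift pt (i := None) x.

Definition wedge_sphere (l : 'I_n) (s : set_type (sphere R d)) : W :=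
  wedge_lift pt (i := Some l) s.

Lemma wedge_base_cts : cts wedge_base.
Proof. exact: (@wedge_lift_continuous _ _ pt None). Qed.

Lemma wedge_sphere_cts l : cts (wedge_sphere l).
Proof. exact: (@wedge_lift_continuous _ _ pt (Some l)). Qed.

Lemma wedge_sphere_pt l : wedge_sphere l (sphere_pt R d) = wedge_base x0.
Proof. exact: (@wedge_liftE _ _ pt None x0 (Some l) (sphere_pt R d)). Qed.

Lemma wedge_spheres_ind (P : W -> Prop) :
  (forall x, P (wedge_base x)) -> (forall l s, P (wedge_sphere l s)) -> forall w, P w.
Proof.
move=> Pb Ps w.
have : (\bigcup_i (@wedge_lift _ _ pt i) @` setT) w by rewrite wedgeTE.
by case=> -[l|] _ [z _ <-]; [exact: Ps|exact: Pb].
Qed.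

Section Elimination.
Context {Z : topologicalType}.

Definition wedge_spheres_fam (k : X -> Z) (s : 'I_n -> set_type (sphere R d) -> Z)
    (i : option 'I_n) : wedge_spheres_family R d X i -> Z :=
  match i with Some l => s l | None => k end.

Definition wedge_spheres_fun (k : X -> Z) (s : 'I_n -> set_type (sphere R d) -> Z) :
    W -> Z :=
  wedge_fun (wedge_spheres_fam k s).

Lemma wedge_spheres_fam_pt (k : X -> Z) (s : 'I_n -> set_type (sphere R d) -> Z) i j :
  (forall l, s l (sphere_pt R d) = k x0) ->
  wedge_spheres_fam k s (pt i) = wedge_spheres_fam k s (pt j).
Proof. by move=> sk; case: i => [i|]; case: j => [j|] //=; rewrite !sk. Qed.

Variables (k : X -> Z) (s : 'I_n -> set_type (sphere R d) -> Z).
Hypothesis agree : forall l, s l (sphere_pt R d) = k x0.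

Lemma wedge_spheres_fun_base x : wedge_spheres_fun k s (wedge_base x) = k x.
Proof.
apply: (@wedge_lift_funE _ _ pt _ (wedge_spheres_fam k s) None) => i j.
exact: wedge_spheres_fam_pt.
Qed.

Lemma wedge_spheres_fun_sphere l z : wedge_spheres_fun k s (wedge_sphere l z) = s l z.
Proof.
apply: (@wedge_lift_funE _ _ pt _ (wedge_spheres_fam k s) (Some l)) => i j.
exact: wedge_spheres_fam_pt.
Qed.

Lemma wedge_spheres_fun_cts : cts k -> (forall l, cts (s l)) ->
  cts (wedge_spheres_fun k s).
Proof.
move=> ck cs; apply: wedge_fun_continuous => [[l|]|i j]; [exact: cs|exact: ck|].
exact: wedge_spheres_fam_pt.
Qed.

End Elimination.

Lemma sphere_hausdorff : hausdorff_space (set_type (sphere R d)).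
Proof. exact/set_type_hausdorff/norm_hausdorff. Qed.

Lemma wedge_spheres_hausdorff : hausdorff_space X -> hausdorff_space W.
Proof.
by move=> hX; apply: wedge_hausdorff => -[l|]; [exact: sphere_hausdorff|].
Qed.

Lemma wedge_spheres_homotopy (Z : topologicalType) (k : X * R -> Z)
    (s : 'I_n -> set_type (sphere R d) * R -> Z) :
  hausdorff_space X -> cts k -> (forall l, cts (s l)) ->
  (forall l t, s l (sphere_pt R d, t) = k (x0, t)) ->
  exists H : W * R -> Z, [/\ cts H, forall x t, H (wedge_base x, t) = k (x, t) &
    forall l z t, H (wedge_sphere l z, t) = s l (z, t)].
Proof.
move=> hX ck cs agree.
pose F i (t : R) := @wedge_spheres_fam Z (fun x => k (x, t)) (fun l z => s l (z, t)) i.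
have Fpt t i j : F i t (pt i) = F j t (pt j) by exact: wedge_spheres_fam_pt.
exists (fun z => wedge_fun (p0 := pt) (F ^~ z.2) z.1); split.
- have : cts (uncurry (fun t => wedge_fun (p0 := pt) (F^~ t))).
    apply: wedge_fun_joint_continuous => // [|[l|]|[l|]].
    + exact: finite_finset.
    + apply/accessible_closed_set1/hausdorff_accessible; exact: sphere_hausdorff.
    + exact/accessible_closed_set1/hausdorff_accessible.
    + rewrite (_ : uncurry _ = fun z => s l (z.2, z.1)); last by apply/funext => -[].
      by apply: (@cts_comp _ _ _ (s l) (fun z => (z.2, z.1))); cts.
    + rewrite (_ : uncurry _ = fun z => k (z.2, z.1)); last by apply/funext => -[].
      by apply: (@cts_comp _ _ _ k (fun z => (z.2, z.1))); cts.
  by move=> cF; apply: (@cts_comp _ _ _ _ (fun z : W * R => (z.2, z.1)) cF); cts.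
- by move=> x t; rewrite /= (@wedge_lift_funE _ _ pt _ (F^~ t) None).
- by move=> l z t; rewrite /= (@wedge_lift_funE _ _ pt _ (F^~ t) (Some l)).
Qed.

End WedgeSpheres.

Arguments wedge_base {R d n X} x0 x.
Arguments wedge_sphere {R d n X} x0 l s.

Section WedgeMap.
Context {R : realType} {d n : nat}.
Implicit Types X Y Z : topologicalType.

Definition wedge_map X Y (x0 : X) (y0 : Y) (f : X -> Y) :
    @wedge_spheres R d n X x0 -> @wedge_spheres R d n Y y0 :=
  wedge_spheres_fun (fun x => wedge_base y0 (f x)) (wedge_sphere y0).
Arguments wedge_map {X Y} x0 y0 f w.

Section Theory.
Context {X Y : topologicalType} {x0 : X} {y0 : Y} (f : X -> Y).
Hypothesis f_pt : f x0 = y0.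

Let agree (l : 'I_n) : wedge_sphere y0 l (sphere_pt R d) = wedge_base y0 (f x0).
Proof. by rewrite f_pt wedge_sphere_pt. Qed.

Lemma wedge_map_base x : wedge_map x0 y0 f (wedge_base x0 x) = wedge_base y0 (f x).
Proof. exact: wedge_spheres_fun_base. Qed.

Lemma wedge_map_sphere l s : wedge_map x0 y0 f (wedge_sphere x0 l s) = wedge_sphere y0 l s.
Proof. exact: wedge_spheres_fun_sphere. Qed.

Lemma wedge_map_cts : cts f -> cts (wedge_map x0 y0 f).
Proof.
move=> cf; have wb := @wedge_base_cts R d n Y y0.
by apply: wedge_spheres_fun_cts => //; [cts|exact: wedge_sphere_cts].
Qed.

End Theory.

Lemma wedge_map_homotopic_id X Y (x0 : X) (y0 : Y) (f : X -> Y) (g : Y -> X) :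
  hausdorff_space X -> f x0 = y0 -> g y0 = x0 ->
  homotopic_rel R [set x0] (fun x => g (f x)) (fun x => x) ->
  homotopic_rel R [set wedge_base x0 x0]
    (fun w => wedge_map y0 x0 g (wedge_map x0 y0 f w)) (fun w => w).
Proof.
move=> hX fx gy [H [cH H0 H1 Hx]].
have wb := @wedge_base_cts R d n X x0; have ws l := @wedge_sphere_cts R d n X x0 l.
have [||l t|G [cG Gb Gs]] := @wedge_spheres_homotopy R d n X x0 _
    (fun z => wedge_base x0 (H z)) (fun l z => wedge_sphere x0 l z.1) hX.
- exact: cts_comp wb cH.
- by cts.
- by rewrite /= wedge_sphere_pt Hx // fx gy.
exists G; split=> //.
- by apply: wedge_spheres_ind => [x|l s];
    rewrite ?Gb ?Gs ?wedge_map_base ?wedge_map_sphere ?H0.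
- by apply: wedge_spheres_ind => [x|l s]; rewrite ?Gb ?Gs ?H1.
- by move=> _ t ->; rewrite Gb Hx // !wedge_map_base.
Qed.

Lemma wedge_pointed_equiv X Y (x : X) (y : Y) :
  hausdorff_space X -> hausdorff_space Y -> pointed_equiv R x y ->
  pointed_equiv R (wedge_base x x : @wedge_spheres R d n X x)
    (wedge_base y y : @wedge_spheres R d n Y y).
Proof.
move=> hX hY [f [g [cf cg [fx gy] gf fg]]].
exists (wedge_map x y f), (wedge_map y x g); split.
- exact: wedge_map_cts.
- exact: wedge_map_cts.
- by rewrite !wedge_map_base // fx gy.
- exact: wedge_map_homotopic_id.
- exact: wedge_map_homotopic_id.
Qed.

End WedgeMap.

Section WedgeAssociativity.
Context {R : realType} {d a b : nat} {X : topologicalType} (x0 : X).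
Let Wa : topologicalType := @wedge_spheres R d a X x0.
Let pa : Wa := wedge_base x0 x0.

Let merge_inner : Wa -> @wedge_spheres R d (a + b) X x0 :=
  wedge_spheres_fun (wedge_base x0) (fun l => wedge_sphere x0 (lshift b l)).

Let merge : @wedge_spheres R d b Wa pa -> @wedge_spheres R d (a + b) X x0 :=
  wedge_spheres_fun merge_inner (fun l => wedge_sphere x0 (rshift a l)).

Let split_sphere (l : 'I_(a + b)) (z : set_type (sphere R d)) :
    @wedge_spheres R d b Wa pa :=
  match fintype.split l with
  | inl i => wedge_base pa (wedge_sphere x0 i z)
  | inr j => wedge_sphere pa j z
  end.

Let unmerge : @wedge_spheres R d (a + b) X x0 -> @wedge_spheres R d b Wa pa :=
  wedge_spheres_fun (fun x => wedge_base pa (wedge_base x0 x)) split_sphere.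

Let merge_innerE : (forall x, merge_inner (wedge_base x0 x) = wedge_base x0 x) /\
  forall l z, merge_inner (wedge_sphere x0 l z) = wedge_sphere x0 (lshift b l) z.
Proof.
have agree l : wedge_sphere x0 (lshift b l) (sphere_pt R d) = wedge_base x0 x0.
  exact: wedge_sphere_pt.
by split=> *; rewrite /merge_inner ?wedge_spheres_fun_base ?wedge_spheres_fun_sphere.
Qed.

Let merge_agree l :
  wedge_sphere x0 (rshift a l) (sphere_pt R d) = merge_inner pa.
Proof. by rewrite merge_innerE.1 wedge_sphere_pt. Qed.

Let mergeE : (forall w, merge (wedge_base pa w) = merge_inner w) /\
  forall l z, merge (wedge_sphere pa l z) = wedge_sphere x0 (rshift a l) z.
Proof.
by split=> *; rewrite /merge ?wedge_spheres_fun_base ?wedge_spheres_fun_sphere.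
Qed.

Let split_agree l : split_sphere l (sphere_pt R d) = wedge_base pa (wedge_base x0 x0).
Proof. by rewrite /split_sphere; case: fintype.split => i; rewrite wedge_sphere_pt. Qed.

Let unmergeE : (forall x, unmerge (wedge_base x0 x) = wedge_base pa (wedge_base x0 x)) /\
  forall l z, unmerge (wedge_sphere x0 l z) = split_sphere l z.
Proof.
by split=> *; rewrite /unmerge ?wedge_spheres_fun_base ?wedge_spheres_fun_sphere.
Qed.

Lemma wedge_spheres_assoc :
  pointed_equiv R (wedge_base pa pa : @wedge_spheres R d b Wa pa)
    (wedge_base x0 x0 : @wedge_spheres R d (a + b) X x0).
Proof.
have [inb ins] := merge_innerE; have [mb ms] := mergeE; have [ub us] := unmergeE.
have wb := @wedge_base_cts R d; have ws := @wedge_sphere_cts R d.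
apply: (@homeomorphic_pointed_equiv _ _ _ _ _ merge unmerge).
- apply: wedge_spheres_fun_cts => //.
  by apply: wedge_spheres_fun_cts => // l; exact: wedge_sphere_pt.
- apply: wedge_spheres_fun_cts => // [|l]; first exact: cts_comp (wb _ _ _) (wb _ _ _).
  rewrite /split_sphere; case: fintype.split => i; last exact: ws.
  exact: cts_comp (wb _ _ _) (ws _ _ _ i).
- apply: wedge_spheres_ind => [|l z]; last first.
    by rewrite ms us /split_sphere (unsplitK (inr l)).
  apply: wedge_spheres_ind => [x|l z]; first by rewrite mb inb ub.
  by rewrite mb ins us /split_sphere (unsplitK (inl l)).
- apply: wedge_spheres_ind => [x|l z]; first by rewrite ub mb inb.
  rewrite us /split_sphere; have := splitK l.
  by case: fintype.split => i /= <-; rewrite ?mb ?ins ?ms.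
- by rewrite mb inb.
Qed.

End WedgeAssociativity.

Section Bouquet.
Context {R : realType} {d : nat}.

Definition bouquet_pt n : bouquet R d n :=
  @wedge_base R d n (discrete_topology unit) tt tt.

Lemma bouquet_hausdorff n : hausdorff_space (bouquet R d n).
Proof. exact/wedge_spheres_hausdorff/discrete_hausdorff. Qed.

Lemma pointed_equiv_bouquet_wedge (X Y : topologicalType) (x : X) (y : Y) a b :
  hausdorff_space Y -> pointed_equiv R y (bouquet_pt a) ->
  pointed_equiv R x (wedge_base y y : @wedge_spheres R d b Y y) ->
  pointed_equiv R x (bouquet_pt (a + b)).
Proof.
move=> hY ya xy; apply: (pointed_equiv_trans xy).
apply: (pointed_equiv_trans (wedge_pointed_equiv hY (@bouquet_hausdorff a) ya)).
exact: wedge_spheres_assoc.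
Qed.

End Bouquet.

(** * Euclidean spheres *)

Section EuclideanNorm.
Context {R : realType} {n : nat}.
Implicit Types (x y : 'rV[R]_n) (a : R).

Definition enorm x : R := Num.sqrt (\sum_i x 0 i ^+ 2).

Lemma sqr_enorm x : enorm x ^+ 2 = \sum_i x 0 i ^+ 2.
Proof. by rewrite sqr_sqrtr // sumr_ge0 // => i _; exact: sqr_ge0. Qed.

Lemma enorm_ge0 x : 0 <= enorm x.
Proof. exact: sqrtr_ge0. Qed.

Lemma enorm0 : enorm 0 = 0.
Proof.
rewrite /enorm big1 ?sqrtr0 // => i _.
by rewrite mxE expr0n.
Qed.

Lemma enorm_eq0 x : (enorm x == 0) = (x == 0).
Proof.
apply/idP/eqP => [/eqP x0|->]; last by rewrite enorm0.
apply/rowP => i; rewrite mxE; apply/eqP; rewrite -sqrf_eq0.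
have := sqr_enorm x; rewrite x0 expr0n /= => /esym/eqP.
by rewrite psumr_eq0 => [/allP/(_ i)|k _]; [rewrite mem_index_enum; exact|exact: sqr_ge0].
Qed.

Lemma enorm_gt0 x : (0 < enorm x) = (x != 0).
Proof. by rewrite lt_neqAle enorm_ge0 andbT eq_sym enorm_eq0. Qed.

Lemma enormZ a x : enorm (a *: x) = `|a| * enorm x.
Proof.
rewrite /enorm -sqrtr_sqr -sqrtrM ?sqr_ge0 // mulr_sumr; congr Num.sqrt.
by apply: eq_bigr => i _; rewrite mxE exprMn.
Qed.

Lemma enorm_cts : cts enorm.
Proof. by rewrite /enorm; cts. Qed.

End EuclideanNorm.

Section Sphere.
Context {R : realType} {d : nat}.
Local Notation S := (set_type (sphere R d)).
Implicit Types (s : S) (v : 'rV[R]_d.+1).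

Lemma sphereE v : (v \in sphere R d) = (enorm v == 1).
Proof.
rewrite -sqrp_eq1 ?enorm_ge0 // sqr_enorm.
by apply/idP/eqP; rewrite inE.
Qed.

Lemma enorm_sphere s : enorm (\val s) = 1.
Proof. by apply/eqP; rewrite -sphereE; exact: valP. Qed.

Definition sphere_normalize v : S := insubd (sphere_pt R d) ((enorm v)^-1 *: v).

Lemma val_sphere_normalize v : v != 0 ->
  \val (sphere_normalize v) = (enorm v)^-1 *: v.
Proof.
move=> v0; rewrite insubdK // sphereE enormZ ger0_norm ?invr_ge0 ?enorm_ge0 //.
by rewrite mulVf // enorm_eq0.
Qed.

Lemma sphere_neq0 s : \val s != 0.
Proof. by rewrite -enorm_eq0 enorm_sphere oner_eq0. Qed.

Lemma sphere_normalizeZ (a : R) s : 0 < a -> sphere_normalize (a *: \val s) = s.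
Proof.
move=> a0; apply: val_inj; rewrite val_sphere_normalize; last first.
  by rewrite scaler_eq0 negb_or gt_eqF // sphere_neq0.
by rewrite enormZ enorm_sphere mulr1 gtr0_norm // scalerA mulVf ?scale1r ?gt_eqF.
Qed.

Lemma sphere_normalizeK s : sphere_normalize (\val s) = s.
Proof. by rewrite -[\val s]scale1r sphere_normalizeZ. Qed.

Lemma cts_sphere_normalize (X : topologicalType) (f : X -> 'rV[R]_d.+1) :
  (forall x, f x != 0) -> cts f -> cts (fun x => sphere_normalize (f x)).
Proof.
move=> f0 cf; apply: cts_sub; have cn := @enorm_cts R d.+1.
apply: cts_ext (fun x => val_sphere_normalize (f0 x)) _.
by cts => x; rewrite enorm_eq0.
Qed.

Lemma sphere_segment_neq0 s s' (t : R) : \val s <> - \val s' ->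
  (1 - t) *: \val s + t *: \val s' != 0.
Proof.
move=> ss'; apply: contra_notN ss' => /eqP /addr0_eq e.
have nt : `|1 - t| = `|t|.
  by have := congr1 enorm e; rewrite -scaleNr !enormZ normrN !enorm_sphere !mulr1.
have tE : t = 2^-1.
  have := congr1 (fun r => r ^+ 2) nt; rewrite !real_normK ?num_real //; lra.
move: e; rewrite tE (_ : 1 - 2^-1 = 2^-1 :> R); last by lra.
by rewrite -scalerN => /scalerI <-; rewrite ?opprK // invr_eq0 pnatr_eq0.
Qed.

Lemma sphere_not_antipodal_homotopy (X : topologicalType) (f g : X -> S) :
  cts f -> cts g -> (forall x, \val (f x) <> - \val (g x)) ->
  exists H : X * R -> S, [/\ cts H, forall x, H (x, 0) = f x,
    forall x, H (x, 1) = g x & forall x t, f x = g x -> H (x, t) = f x].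
Proof.
move=> cf cg fg.
exists (fun z => sphere_normalize ((1 - z.2) *: \val (f z.1) + z.2 *: \val (g z.1))).
split=> /= [|x|x|x t e].
- apply: cts_sphere_normalize => [z|]; first exact: sphere_segment_neq0.
  by cts.
- by rewrite subr0 scale1r scale0r addr0 sphere_normalizeK.
- by rewrite subrr scale1r scale0r add0r sphere_normalizeK.
- by rewrite -e -scalerDl subrK scale1r sphere_normalizeK.
Qed.

End Sphere.

Section RowCons.
Context {R : realType} {d : nat}.
Implicit Types (a : R) (y : 'rV[R]_d) (v : 'rV[R]_d.+1).

Definition row_cons a y : 'rV[R]_d.+1 := \row_i oapp (y 0) a (unlift 0 i).

Definition row_tail v : 'rV[R]_d := \row_i v 0 (lift 0 i).

Lemma row_cons0 a y : row_cons a y 0 0 = a.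
Proof. by rewrite mxE unlift_none. Qed.

Lemma sphere_pt_row_cons : \val (sphere_pt R d) = row_cons 1 0.
Proof. by apply/rowP => i; rewrite !mxE; case: unliftP => [j|] -> /=; rewrite ?mxE. Qed.

Lemma row_consK a y : row_tail (row_cons a y) = y.
Proof. by apply/rowP => i; rewrite !mxE liftK. Qed.

Lemma row_tailZ a v : row_tail (a *: v) = a *: row_tail v.
Proof. by apply/rowP => i; rewrite !mxE. Qed.

Lemma row_consZ a b y : b *: row_cons a y = row_cons (b * a) (b *: y).
Proof. by apply/rowP => i; rewrite !mxE; case: unlift => [j|] /=; rewrite ?mxE. Qed.

Lemma row_cons_eta v : row_cons (v 0 0) (row_tail v) = v.
Proof. by apply/rowP => i; rewrite mxE; case: unliftP => [j|] -> /=; rewrite ?mxE. Qed.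

Lemma row_cons_eq0 a y : (row_cons a y == 0) = (a == 0) && (y == 0).
Proof.
apply/eqP/andP => [v0|[/eqP-> /eqP->]].
  have := row_cons0 a y; have := row_consK a y; rewrite v0 => <-; rewrite mxE => <-.
  by split=> //; apply/eqP/rowP => i; rewrite !mxE.
by apply/rowP => i; rewrite !mxE; case: unlift => [j|] /=; rewrite ?mxE.
Qed.

Lemma sqr_enorm_row v : enorm v ^+ 2 = v 0 0 ^+ 2 + enorm (row_tail v) ^+ 2.
Proof.
by rewrite !sqr_enorm big_ord_recl; congr (_ + _); apply: eq_bigr => i _; rewrite mxE.
Qed.

Lemma enorm_row_cons0 y : enorm (row_cons 0 y) = enorm y.
Proof.
apply/eqP; rewrite -(@eqrXn2 _ 2) ?enorm_ge0 //.
by rewrite sqr_enorm_row row_cons0 row_consK expr0n add0r.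
Qed.

Lemma cts_row_cons (X : topologicalType) (a : X -> R) (y : X -> 'rV[R]_d) :
  cts a -> cts y -> cts (fun x => row_cons (a x) (y x)).
Proof.
move=> ca cy; apply: cts_row => i.
by case: unlift => [j|] /=; cts.
Qed.

Lemma row_tail_cts : cts row_tail.
Proof. by apply: cts_row => i; cts. Qed.

End RowCons.

(** * Gauges *)

Section Gauge.
Context {R : realType} {d : nat}.
Implicit Types (rho : 'rV[R]_d -> R) (y : 'rV[R]_d).

Definition gauge rho : Prop := [/\ cts rho,
  forall a y, 0 <= a -> rho (a *: y) = a * rho y & forall y, enorm y <= rho y].

Definition gauge_clamp rho y : 'rV[R]_d := (Num.max 1 (rho y))^-1 *: y.

(* Normalized, it sends the unit ball of the gauge onto the sphere, its center to
   the antipode of the base point and its boundary to the base point. *)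
Definition wrap_vec rho y : 'rV[R]_d.+1 :=
  row_cons (2 * rho y - 1) (Num.max 0 (1 - rho y) *: y).

Definition wrap rho y : set_type (sphere R d) := sphere_normalize (wrap_vec rho y).

Variable rho : 'rV[R]_d -> R.
Hypothesis rho_gauge : gauge rho.

Lemma gauge_cts : cts rho.
Proof. by case: rho_gauge. Qed.

Lemma gaugeZ a y : 0 <= a -> rho (a *: y) = a * rho y.
Proof. by case: rho_gauge => _ + _; exact. Qed.

Lemma enorm_le_gauge y : enorm y <= rho y.
Proof. by case: rho_gauge. Qed.

Lemma gauge_ge0 y : 0 <= rho y.
Proof. exact: le_trans (enorm_ge0 y) (enorm_le_gauge y). Qed.

Lemma gauge0 : rho 0 = 0.
Proof. by rewrite -(scale0r 0) gaugeZ // mul0r. Qed.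

Lemma gauge_clamp_id y : rho y <= 1 -> gauge_clamp rho y = y.
Proof. by move=> y1; rewrite /gauge_clamp max_l // invr1 scale1r. Qed.

Lemma gauge_clamp_ge1 y : 1 <= rho y -> rho (gauge_clamp rho y) = 1.
Proof.
move=> y1; rewrite /gauge_clamp max_r // gaugeZ ?invr_ge0 ?gauge_ge0 // mulVf //.
by rewrite gt_eqF //; lra.
Qed.

Lemma gauge_clamp_le1 y : rho (gauge_clamp rho y) <= 1.
Proof.
by have [h|/ltW h] := leP (rho y) 1; [rewrite gauge_clamp_id|rewrite gauge_clamp_ge1].
Qed.

Lemma gauge_clampK y : gauge_clamp rho (gauge_clamp rho y) = gauge_clamp rho y.
Proof. exact/gauge_clamp_id/gauge_clamp_le1. Qed.

Lemma gauge_clampZ a y : 1 <= a -> 1 <= rho y ->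
  gauge_clamp rho (a *: y) = gauge_clamp rho y.
Proof.
move=> a1 y1; have a0 : 0 < a by lra.
rewrite /gauge_clamp gaugeZ ?ltW // !max_r //; last by nra.
by rewrite scalerA invfM mulrAC mulVf ?mul1r // gt_eqF.
Qed.

Lemma gauge_clamp_cts : cts (gauge_clamp rho).
Proof.
have rc := gauge_cts; rewrite /gauge_clamp; cts => y.
by rewrite gt_eqF // lt_max ltr01.
Qed.

Lemma gauge_sphere_equator (s : set_type (sphere R d)) :
  (\val s) 0 0 = 0 -> 1 <= rho (row_tail (\val s)).
Proof.
move=> s0; apply: le_trans (enorm_le_gauge _); have := sqr_enorm_row (\val s).
rewrite s0 enorm_sphere expr1n expr0n add0r => /esym/eqP.
by rewrite sqrp_eq1 ?enorm_ge0 // => /eqP ->.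
Qed.

Lemma wrap_vec_neq0 y : wrap_vec rho y != 0.
Proof.
have [half|half] := eqVneq (2 * rho y - 1) 0; last by rewrite row_cons_eq0 (negbTE half).
have y2 : rho y = 2^-1 by lra.
have y0 : y != 0 by apply: contra_eq_neq y2 => ->; rewrite gauge0 eq_sym invr_eq0 pnatr_eq0.
rewrite row_cons_eq0 scaler_eq0 (negbTE y0) orbF y2 negb_and; apply/orP; right.
by rewrite gt_eqF // lt_max; apply/orP; right; lra.
Qed.

Lemma wrap_cts : cts (wrap rho).
Proof.
have rc := gauge_cts; apply: cts_sphere_normalize; first exact: wrap_vec_neq0.
by apply: cts_row_cons; cts.
Qed.

Lemma wrap_pt y : 1 <= rho y -> wrap rho y = sphere_pt R d.
Proof.
move=> y1; have a0 : 0 < 2 * rho y - 1 by lra.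
rewrite -[RHS](sphere_normalizeZ _ a0) sphere_pt_row_cons row_consZ mulr1 scaler0.
by rewrite /wrap /wrap_vec max_l ?scale0r // subr_le0.
Qed.

Lemma wrap_head_le0 y : ((\val (wrap rho y)) 0 0 <= 0) = (rho y <= 2^-1).
Proof.
rewrite val_sphere_normalize ?wrap_vec_neq0 // mxE pmulr_rle0; last first.
  by rewrite invr_gt0 enorm_gt0 wrap_vec_neq0.
by rewrite row_cons0; apply/idP/idP; lra.
Qed.

Lemma wrap_tail y : row_tail (\val (wrap rho y)) =
  ((enorm (wrap_vec rho y))^-1 * Num.max 0 (1 - rho y)) *: y.
Proof. by rewrite val_sphere_normalize ?wrap_vec_neq0 // row_tailZ row_consK scalerA. Qed.

End Gauge.

(** * Attaching cells along null-homotopic boundaries *)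

Section CellAttachment.
Context {R : realType} {d N : nat} {T : topologicalType}.
Variables (rho : 'rV[R]_d -> R) (A B : set T) (x0 : set_type A).
Variables (chart : 'I_N -> 'rV[R]_d -> T) (coord : 'I_N -> T -> 'rV[R]_d).
Variable filling : 'I_N -> 'rV[R]_d -> set_type A.
Implicit Types (l : 'I_N) (y : 'rV[R]_d) (a : set_type A) (b : set_type B) (t : R).

Hypothesis rho_gauge : gauge rho.
Hypothesis A_closed : closed A.
Hypothesis A_sub : A `<=` B.
Hypothesis chart_sub : forall l y, B (chart l y).
Hypothesis cover : forall x, B x -> A x \/ exists l y, x = chart l y.
Hypothesis chart_cts : forall l, cts (chart l).
Hypothesis chart_closed : forall l, closed (range (chart l)).
Hypothesis coord_cts : forall l, cts (coord l).
Hypothesis chart_clamp : forall l y, chart l (gauge_clamp rho y) = chart l y.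
Hypothesis coordK : forall l y, coord l (chart l y) = gauge_clamp rho y.
Hypothesis chart_disjoint : forall l l' y y',
  l != l' -> chart l y = chart l' y' -> A (chart l y).
Hypothesis chart_boundary : forall l y, A (chart l y) -> 1 <= rho y.
Hypothesis filling_cts : forall l, cts (filling l).
Hypothesis filling0 : forall l, filling l 0 = x0.
Hypothesis filling_boundary : forall l y, 1 <= rho y -> \val (filling l y) = chart l y.

Let inclP a : \val a \in B.
Proof. by rewrite inE; exact/A_sub/set_mem/valP. Qed.

Let cellP l y : chart l y \in B.
Proof. by rewrite inE. Qed.

Definition attach_incl a : set_type B := SigSub (inclP a).

Definition attach_cell l y : set_type B := SigSub (cellP l y).

Local Notation incl := attach_incl.
Local Notation cell := attach_cell.

Lemma attach_incl_cts : cts incl.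
Proof. by apply: cts_sub => /=; cts. Qed.

Lemma attach_cell_cts l : cts (cell l).
Proof. by apply: cts_sub; exact: chart_cts. Qed.

Lemma attach_cell_clamp l y : cell l (gauge_clamp rho y) = cell l y.
Proof. by apply: val_inj; exact: chart_clamp. Qed.

Lemma attach_cellZ l r y : 1 <= r -> 1 <= rho y -> cell l (r *: y) = cell l y.
Proof.
by move=> r1 y1; rewrite -attach_cell_clamp (gauge_clampZ rho_gauge) // attach_cell_clamp.
Qed.

Lemma attach_cell_filling l y : 1 <= rho y -> cell l y = incl (filling l y).
Proof. by move=> y1; apply: val_inj; rewrite /= filling_boundary. Qed.

Lemma filling_clamp l y : filling l (gauge_clamp rho y) = filling l y.
Proof.
have [y1|/ltW y1] := leP (rho y) 1; first by rewrite gauge_clamp_id.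
by apply: val_inj; rewrite !filling_boundary ?chart_clamp // gauge_clamp_ge1.
Qed.

Lemma attach_ind (P : set_type B -> Prop) : (forall a, P (incl a)) ->
  (forall l y, rho y <= 1 -> P (cell l y)) -> forall b, P b.
Proof.
move=> Pa Pc b; have [Ab|[l [y by_]]] := cover (set_mem (valP b)).
  by rewrite (_ : b = incl (SigSub (mem_set Ab))) //; exact: val_inj.
rewrite (_ : b = cell l (gauge_clamp rho y)); first exact/Pc/gauge_clamp_le1.
by rewrite attach_cell_clamp; exact: val_inj.
Qed.

Section Glue.
Context {Z : topologicalType} (k : set_type A * R -> Z) (h : 'I_N -> 'rV[R]_d * R -> Z).
Hypothesis k_cts : cts k.
Hypothesis h_cts : forall l, cts (h l).
Hypothesis agree : forall l y t, rho y = 1 -> h l (y, t) = k (filling l y, t).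

Let glue (z : set_type B * R) : Z :=
  let x := \val z.1 in
  if pselect (A x) then k (insubd x0 x, z.2)
  else if [pick l | `[<range (chart l) x>]] is Some l then h l (coord l x, z.2)
  else k (x0, z.2).

Let glue_incl a t : glue (incl a, t) = k (a, t).
Proof.
by rewrite /glue; case: pselect => [Aa|[]]; [rewrite /= valKd|exact: set_mem (valP a)].
Qed.

Let glue_cell l y t : rho y <= 1 -> glue (cell l y, t) = h l (y, t).
Proof.
move=> y1; have [Ay|nA] := pselect (A (chart l y)).
  have ry : rho y = 1 by apply/eqP; rewrite eq_le y1 (chart_boundary Ay).
  by rewrite attach_cell_filling ?ry // glue_incl agree.
rewrite /glue; case: pselect => // nA'; case: pickP => [l' /asboolP[y' _ /= e]|/(_ l)].
  have [->|ll'] := eqVneq l' l; first by rewrite coordK gauge_clamp_id.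
  by case: nA; rewrite -e; exact: chart_disjoint ll' e.
by move/asboolPn; case; exists y.
Qed.

Lemma attach_glue : exists H : set_type B * R -> Z, [/\ cts H,
  forall a t, H (incl a, t) = k (a, t) &
  forall l y t, rho y <= 1 -> H (cell l y, t) = h l (y, t)].
Proof.
exists glue; split=> //.
pose piece (i : option 'I_N) : set (set_type B * R) :=
  if i is Some l then [set z | range (chart l) (\val z.1)] else [set z | A (\val z.1)].
have val_cts : cts (fun z : set_type B * R => \val z.1) by cts.
apply: (@cts_closed_cover _ _ _ piece) => [[l|]|z|[l|]].
- exact: closed_preimage val_cts (@chart_closed l).
- exact: closed_preimage val_cts A_closed.
- have [Az|[l [y e]]] := cover (set_mem (valP z.1)); first by exists None.
  by exists (Some l), y.
- have cell_cts : cts (fun z : set_type B * R => h l (coord l (\val z.1), z.2)) by cts.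
  apply: (cts_within_eq cell_cts) => -[b t] [y _ /= e].
  rewrite -e coordK -glue_cell ?gauge_clamp_le1 //.
  by rewrite attach_cell_clamp; congr (glue (_, _)); exact: val_inj.
- apply: cts_within_sub.
  have inA (z : set_type (piece None)) : \val (\val z).1 \in A by exact: valP z.
  pose restr (z : set_type (piece None)) : set_type A * R :=
    (SigSub (inA z), (\val z).2).
  apply: (@cts_ext _ _ (fun z => k (restr z))) => [z|]; last first.
    by apply: cts_comp k_cts _; apply: cts_pair; [apply: cts_sub => /=|]; cts.
  rewrite -glue_incl [LHS](congr1 glue (surjective_pairing _)).
  by congr (glue (_, _)); exact: val_inj.
Qed.

End Glue.

Local Notation W := (@wedge_spheres R d N (set_type A) x0).

(* The inner half of a cell wraps around the sphere; on the outer half the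
   filling contracts the boundary to the base point, and further so as the
   time [z.2] passes. *)
Definition pinch l (z : 'rV[R]_d * R) : W :=
  if rho z.1 <= 2^-1 then wedge_sphere x0 l (wrap rho (2 *: z.1))
  else wedge_base x0 (filling l (((1 - z.2) * (2 * rho z.1 - 1)) *: z.1)).

Definition unpinch l (s : set_type (sphere R d)) : set_type B :=
  if (\val s) 0 0 <= 0 then cell l (row_tail (\val s))
  else incl (filling l (row_tail (\val s))).

Lemma pinch_cts l : cts (pinch l).
Proof.
have rc := gauge_cts rho_gauge; have wc := wrap_cts rho_gauge.
have wb := @wedge_base_cts R d N _ x0; have ws := @wedge_sphere_cts R d N _ x0.
apply: cts_if_le; cts => z z2.
rewrite wrap_pt ?(gaugeZ rho_gauge) //; last by rewrite z2; lra.
by rewrite wedge_sphere_pt z2 mulfV // subrr mulr0 scale0r filling0.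
Qed.

Lemma pinch_boundary l y t : rho y = 1 ->
  pinch l (y, t) = wedge_base x0 (filling l ((1 - t) *: y)).
Proof.
move=> y1; rewrite /pinch /= y1 ifF; last by apply/negbTE; rewrite -ltNge; lra.
by congr (wedge_base _ (filling _ (_ *: _))); lra.
Qed.

Lemma unpinch_cts l : cts (unpinch l).
Proof.
have tc := @row_tail_cts R d; have ic := attach_incl_cts; have cc := attach_cell_cts.
apply: cts_if_le; cts => s s0.
by rewrite attach_cell_filling //; exact: gauge_sphere_equator.
Qed.

Lemma unpinch_pt l : unpinch l (sphere_pt R d) = incl x0.
Proof.
rewrite /unpinch sphere_pt_row_cons row_cons0 row_consK filling0 ifF //.
by apply/negbTE; rewrite -ltNge ltr01.
Qed.

(* The factor by which [unpinch \o pinch] stretches the cell radially. *)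
Definition stretch y : R :=
  2 * ((enorm (wrap_vec rho (2 *: y)))^-1 * Num.max 0 (1 - 2 * rho y)) +
  Num.max 0 (2 * rho y - 1).

Lemma stretch_cts : cts stretch.
Proof.
have rc := gauge_cts rho_gauge; have nc := @enorm_cts R d.+1.
rewrite /stretch /wrap_vec; cts => [y|]; last by apply: cts_row_cons; cts.
by rewrite enorm_eq0; exact: wrap_vec_neq0.
Qed.

Lemma stretch_ge0 y : 0 <= stretch y.
Proof.
by rewrite addr_ge0 ?mulr_ge0 ?invr_ge0 ?enorm_ge0 // le_max lexx.
Qed.

Lemma stretch_boundary y : rho y = 1 -> stretch y = 1.
Proof.
move=> y1; rewrite /stretch y1 [Num.max 0 (1 - _)]max_l; last by lra.
by rewrite !mulr0 add0r max_r; lra.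
Qed.

Lemma stretch_inner y : rho y <= 2^-1 ->
  row_tail (\val (wrap rho (2 *: y))) = stretch y *: y.
Proof.
move=> y2; rewrite wrap_tail // (gaugeZ rho_gauge) // scalerA mulrC.
by rewrite /stretch [Num.max 0 (2 * _ - 1)]max_l ?addr0 //; lra.
Qed.

Lemma stretch_outer y : 2^-1 <= rho y -> stretch y = 2 * rho y - 1.
Proof.
move=> y2; rewrite /stretch [Num.max 0 (1 - _)]max_l ?mulr0 ?add0r; last by lra.
by rewrite max_r //; lra.
Qed.

Lemma stretch_equator y : rho y = 4^-1 -> 1 <= rho (stretch y *: y).
Proof.
move=> y4; rewrite gaugeZ ?stretch_ge0 //.
have y0 : 0 < enorm y.
  by rewrite enorm_gt0; apply: contra_eq_neq y4 => ->; rewrite gauge0 // eq_sym.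
have -> : stretch y = (enorm y)^-1.
  rewrite /stretch [Num.max 0 (2 * _ - 1)]max_l ?addr0; last by lra.
  suff -> : wrap_vec rho (2 *: y) = row_cons 0 y.
    rewrite enorm_row_cons0 max_r; last by lra.
    by rewrite y4 mulrCA (_ : 2 * (1 - _) = 1) ?mulr1 //; lra.
  rewrite /wrap_vec gaugeZ // y4 max_r; last by lra.
  by congr row_cons; [lra|rewrite scalerA (_ : _ * 2 = 1) ?scale1r //; lra].
by rewrite mulrC ler_pdivlMr // mul1r enorm_le_gauge.
Qed.

Definition attach_unpinch : W -> set_type B := wedge_spheres_fun incl unpinch.

Lemma attach_unpinch_base a : attach_unpinch (wedge_base x0 a) = incl a.
Proof. exact/wedge_spheres_fun_base/unpinch_pt. Qed.

Lemma attach_unpinch_sphere l s : attach_unpinch (wedge_sphere x0 l s) = unpinch l s.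
Proof. exact/wedge_spheres_fun_sphere/unpinch_pt. Qed.

Lemma attach_unpinch_cts : cts attach_unpinch.
Proof.
apply: wedge_spheres_fun_cts; [exact: unpinch_pt|exact: attach_incl_cts|].
exact: unpinch_cts.
Qed.

Lemma attach_unpinchK l y : attach_unpinch (pinch l (y, 0)) =
  if rho y <= 4^-1 then cell l (stretch y *: y) else incl (filling l (stretch y *: y)).
Proof.
rewrite /pinch /=; have [y2|y2] := leP (rho y) 2^-1.
  rewrite attach_unpinch_sphere /unpinch wrap_head_le0 // stretch_inner //.
  rewrite gaugeZ // (_ : (2 * rho y <= 2^-1) = (rho y <= 4^-1)) //.
  by apply/idP/idP; lra.
rewrite attach_unpinch_base subr0 mul1r (stretch_outer (ltW y2)) ifF //.
by apply/negbTE; rewrite -ltNge; lra.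
Qed.

Let push l (z : 'rV[R]_d * R) : set_type B :=
  let y := (stretch z.1 + 4 * Num.max 0 z.2) *: z.1 in
  if rho z.1 <= 4^-1 then cell l y else incl (filling l y).

Let slide l (z : 'rV[R]_d * R) : set_type B :=
  let c := unit_clamp z.2 in
  cell l (((1 - c) * (stretch z.1 + 4) + c) *: z.1).

Let push_cts l : cts (push l).
Proof.
have rc := gauge_cts rho_gauge; have sc := stretch_cts.
have ic := attach_incl_cts; have cc := attach_cell_cts.
apply: cts_if_le; cts => z /stretch_equator z4.
rewrite attach_cell_filling // (le_trans z4) // !gaugeZ ?stretch_ge0 //.
  by rewrite ler_wpM2r ?gauge_ge0 // lerDl mulr_ge0 // le_max lexx.
by rewrite addr_ge0 ?stretch_ge0 // mulr_ge0 // le_max lexx.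
Qed.

Let slide_cts l : cts (slide l).
Proof.
by have sc := stretch_cts; have uc := @unit_clamp_cts R;
  have cc := attach_cell_cts; rewrite /slide; cts.
Qed.

Let push_boundary l y t : rho y = 1 -> push l (y, t) = incl (filling l y).
Proof.
move=> y1; have r1 : 1 <= 1 + 4 * Num.max 0 t by rewrite lerDl mulr_ge0 // le_max lexx.
rewrite /push /= (stretch_boundary y1) -!attach_cell_filling ?attach_cellZ ?if_same ?y1 //.
by rewrite gaugeZ // ?y1; lra.
Qed.

Let slide_boundary l y t : rho y = 1 -> slide l (y, t) = incl (filling l y).
Proof.
move=> y1; rewrite -attach_cell_filling ?y1 // /slide /= stretch_boundary //
  attach_cellZ ?y1 //.
by have /andP[] := unit_clamp_itv t; lra.
Qed.

Let push1 l y : push l (y, 1) = slide l (y, 0).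
Proof.
rewrite /push /slide /= unit_clamp0 subr0 mul1r addr0 max_r // mulr1.
case: leP => // y4; have ? := stretch_ge0 y.
by rewrite attach_cell_filling // gaugeZ //; [nra|lra].
Qed.

Let slide1 l y : slide l (y, 1) = cell l y.
Proof. by rewrite /slide /= unit_clamp1 subrr mul0r add0r scale1r. Qed.

(* First push the part of the cell folded into the filling out to the boundary,
   then undo the radial stretch. *)
Lemma attach_unpinch_pinch_homotopic (f : set_type B -> W) :
  (forall a, f (incl a) = wedge_base x0 a) ->
  (forall l y, rho y <= 1 -> f (cell l y) = pinch l (y, 0)) ->
  homotopic_rel R [set incl x0] (fun b => attach_unpinch (f b)) (fun b => b).
Proof.
move=> f_incl f_cell; have ic := attach_incl_cts.
have incl_cts : cts (fun z : set_type A * R => incl z.1) by cts.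
have [Hp [cHp Hp_incl Hp_cell]] := attach_glue incl_cts push_cts push_boundary.
have [Hs [cHs Hs_incl Hs_cell]] := attach_glue incl_cts slide_cts slide_boundary.
apply: (@homotopic_rel_trans _ _ _ _ (fun b => Hs (b, 0))).
  exists Hp; split=> // [b|b|_ t ->]; last by rewrite Hp_incl f_incl attach_unpinch_base.
    elim/attach_ind: b => [a|l y y1]; first by rewrite Hp_incl f_incl attach_unpinch_base.
    by rewrite Hp_cell // f_cell // attach_unpinchK /push /= maxxx mulr0 addr0.
  elim/attach_ind: b => [a|l y y1]; first by rewrite Hp_incl Hs_incl.
  by rewrite Hp_cell // Hs_cell // push1.
exists Hs; split=> // [b|_ t ->]; last by rewrite !Hs_incl.
by elim/attach_ind: b => [a|l y y1]; rewrite ?Hs_incl // Hs_cell // slide1.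
Qed.

(* What remains of [pinch \o unpinch] once the filling is contracted. *)
Let squeeze (s : set_type (sphere R d)) : set_type (sphere R d) :=
  if (\val s) 0 0 <= 0 then wrap rho (2 *: gauge_clamp rho (row_tail (\val s)))
  else sphere_pt R d.

Let contract l (z : set_type (sphere R d) * R) : W :=
  let y := gauge_clamp rho (row_tail (\val z.1)) in
  if (\val z.1) 0 0 <= 0 then pinch l (y, z.2)
  else wedge_base x0 (filling l ((1 - z.2) *: y)).

Let equator_clamp (s : set_type (sphere R d)) :
  (\val s) 0 0 = 0 -> rho (gauge_clamp rho (row_tail (\val s))) = 1.
Proof. by move=> s0; apply/gauge_clamp_ge1/gauge_sphere_equator. Qed.

Let squeeze_cts : cts squeeze.
Proof.
have tc := @row_tail_cts R d; have wc := wrap_cts rho_gauge.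
have cc := gauge_clamp_cts rho_gauge.
apply: cts_if_le; cts => s /equator_clamp s1.
by rewrite wrap_pt // gaugeZ // s1; lra.
Qed.

Let contract_cts l : cts (contract l).
Proof.
have tc := @row_tail_cts R d; have cc := gauge_clamp_cts rho_gauge.
have wb := @wedge_base_cts R d N _ x0; have pc := pinch_cts.
by apply: cts_if_le; cts => z /equator_clamp z1; rewrite pinch_boundary.
Qed.

Let sphere_pt_head : (\val (sphere_pt R d)) 0 0 = 1.
Proof. by rewrite sphere_pt_row_cons row_cons0. Qed.

Let squeeze_pt : squeeze (sphere_pt R d) = sphere_pt R d.
Proof. by rewrite /squeeze sphere_pt_head ifF //; apply/negbTE; rewrite -ltNge. Qed.

Let contract_pt l t : contract l (sphere_pt R d, t) = wedge_base x0 x0.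
Proof.
rewrite /contract [fst _]/= sphere_pt_head ifF; last by apply/negbTE; rewrite -ltNge.
by rewrite sphere_pt_row_cons row_consK /gauge_clamp !scaler0 filling0.
Qed.

Let contract1 l s : contract l (s, 1) = wedge_sphere x0 l (squeeze s).
Proof.
rewrite /contract /squeeze /pinch /= subrr mul0r !scale0r filling0.
case: ifP => _; last by rewrite wedge_sphere_pt.
case: leP => // /ltW y2; rewrite wrap_pt ?wedge_sphere_pt // gaugeZ //; lra.
Qed.

Let squeeze_not_antipodal s : \val (squeeze s) <> - \val s.
Proof.
rewrite /squeeze; case: leP => [s0|s0] e.
  have tail0 : row_tail (\val s) = 0.
    have := congr1 row_tail e.
    rewrite wrap_tail // -(scaleN1r (\val s)) row_tailZ !scalerA => /eqP.
    rewrite -subr_eq0 -scalerBl scaler_eq0 => /orP[|/eqP //]; apply: contraTeq => _.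
    rewrite gt_eqF // opprK ltr_pwDr // !mulr_ge0 ?invr_ge0 ?enorm_ge0 // le_max ?lexx //.
    by rewrite ler01.
  have head1 : (\val s) 0 0 ^+ 2 = 1.
    by have := sqr_enorm_row (\val s);
      rewrite enorm_sphere tail0 enorm0 expr0n addr0 expr1n.
  have := congr1 (fun v : 'rV_d.+1 => v 0 0) e; rewrite mxE.
  have := wrap_head_le0 rho_gauge (2 *: gauge_clamp rho (row_tail (\val s))).
  by rewrite tail0 /gauge_clamp !scaler0 gauge0 // invr_ge0 ler0n => w0 we; nra.
have := congr1 (fun v : 'rV_d.+1 => v 0 0) e; rewrite sphere_pt_head mxE; lra.
Qed.

Lemma attach_pinch_unpinch_homotopic (f : set_type B -> W) :
  hausdorff_space (set_type A) ->
  (forall a, f (incl a) = wedge_base x0 a) ->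
  (forall l y, rho y <= 1 -> f (cell l y) = pinch l (y, 0)) ->
  homotopic_rel R [set wedge_base x0 x0] (fun w => f (attach_unpinch w)) (fun w => w).
Proof.
move=> hA f_incl f_cell.
have wb := @wedge_base_cts R d N _ x0; have ws := @wedge_sphere_cts R d N _ x0.
have base_cts : cts (fun z : set_type A * R => wedge_base x0 z.1 : W) by cts.
have [Hc [cHc Hc_base Hc_sphere]] :=
  wedge_spheres_homotopy hA base_cts contract_cts contract_pt.
have [G [cG G0 G1 Gfix]] :=
  sphere_not_antipodal_homotopy squeeze_cts cts_id squeeze_not_antipodal.
have [||l t|Hg [cHg Hg_base Hg_sphere]] := @wedge_spheres_homotopy R d N _ x0 W
    (fun z => wedge_base x0 z.1) (fun l z => wedge_sphere x0 l (G z)) hA.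
- by [].
- by cts.
- by rewrite Gfix squeeze_pt // wedge_sphere_pt.
apply: (@homotopic_rel_trans _ _ _ _ (fun w => Hc (w, 1))).
  exists Hc; split=> // [w|_ t ->]; last by rewrite Hc_base attach_unpinch_base f_incl.
  move: w; apply: wedge_spheres_ind => [a|l s].
    by rewrite Hc_base attach_unpinch_base f_incl.
  rewrite Hc_sphere attach_unpinch_sphere /contract /unpinch /=; case: ifP => _.
    by rewrite -attach_cell_clamp f_cell // gauge_clamp_le1.
  by rewrite f_incl subr0 scale1r filling_clamp.
exists Hg; split=> // [w|w|_ t ->]; last by rewrite Hg_base Hc_base.
  by move: w; apply: wedge_spheres_ind => [a|l s];
    rewrite ?Hg_base ?Hc_base // Hg_sphere Hc_sphere G0 contract1.
by move: w; apply: wedge_spheres_ind => [a|l s]; rewrite ?Hg_base // Hg_sphere G1.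
Qed.

Lemma attach_pointed_equiv : hausdorff_space (set_type A) ->
  pointed_equiv R (incl x0) (wedge_base x0 x0 : W).
Proof.
move=> hA; have wb := @wedge_base_cts R d N _ x0; have pc := pinch_cts.
have [||l y t y1|F [cF F_incl F_cell]] := @attach_glue W (fun z => wedge_base x0 z.1)
    (fun l z => pinch l (z.1, 0)).
- by cts.
- by cts.
- by rewrite pinch_boundary // subr0 scale1r.
pose f b := F (b, 0); have cf : cts f by rewrite /f; cts.
exists f, attach_unpinch; split=> //.
- exact: attach_unpinch_cts.
- by rewrite /f F_incl attach_unpinch_base.
- by apply: attach_unpinch_pinch_homotopic => *; rewrite /f ?F_incl ?F_cell.
- by apply: attach_pinch_unpinch_homotopic => // *; rewrite /f ?F_incl ?F_cell.
Qed.

End CellAttachment.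

(** * Simplicial complexes and collapses *)

Definition is_complex (n : nat) (K : set {set 'I_n}) : Prop :=
  (forall s, K s -> s != finset.set0) /\
  forall s t : {set 'I_n}, K s -> t \subset s -> t != finset.set0 -> K t.

Definition space (R : realType) (n : nat) (K : set {set 'I_n}) : topologicalType :=
  set_type (@realization R n K).

Lemma space_hausdorff (R : realType) (n : nat) (K : set {set 'I_n}) :
  hausdorff_space (space R K).
Proof. exact/set_type_hausdorff/norm_hausdorff. Qed.

Section Realization.
Context {R : realType} {n : nat}.
Implicit Types (K : set {set 'I_n}) (x : 'rV[R]_n) (s t : {set 'I_n}).

Definition supp x : {set 'I_n} := [set i | x 0 i != 0]%SET.

Lemma supp_neq0 x : \sum_i x 0 i = 1 -> supp x != finset.set0.
Proof.
move=> s1; apply/eqP => s0; have := oner_neq0 R; rewrite -s1 big1 ?eqxx // => i _.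
by have : i \notin supp x; [rewrite s0 inE|rewrite inE negbK => /eqP].
Qed.

Lemma geom_simplexP s x : geom_simplex s x <->
  [/\ forall i, 0 <= x 0 i, \sum_i x 0 i = 1 & supp x \subset s].
Proof.
split=> -[x0 x1 xs]; split=> //.
  by apply/fintype.subsetP => i; rewrite inE; apply: contraNT => /xs ->.
move=> i si; apply/eqP; apply: contraNT si => xi.
by move/fintype.subsetP: xs; apply; rewrite inE.
Qed.

Lemma realizationP K x : is_complex K -> realization K x <->
  [/\ forall i, 0 <= x 0 i, \sum_i x 0 i = 1 & K (supp x)].
Proof.
move=> [_ faces]; split=> [[s Ks /geom_simplexP[x0 x1 xs]]|[x0 x1 Kx]].
  by split=> //; apply: faces xs _ => //; exact: supp_neq0.
by exists (supp x) => //; apply/geom_simplexP.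
Qed.

Lemma realizationS K K' : K' `<=` K -> @realization R n K' `<=` realization K.
Proof. by move=> KK' x [s Ks xs]; exists s => //; exact: KK'. Qed.

Lemma geom_simplex_delta s i : i \in s -> geom_simplex s (delta_mx 0 i : 'rV[R]_n).
Proof.
move=> is_; split=> [k||k].
- by rewrite mxE; case: (_ && _).
- rewrite (bigD1 i) //= mxE !eqxx big1 ?addr0 // => k /negbTE ki.
  by rewrite mxE ki andbF.
- by apply: contraNeq => /[!mxE]; case: (eqVneq k i) => [-> _|]; rewrite ?andbF ?eqxx.
Qed.

Lemma closed_geom_simplex s : closed (@geom_simplex R n s).
Proof.
have cone : cts (fun _ : 'rV[R]_n => 1 : R) by cts.
have ctot : cts (fun x : 'rV[R]_n => \sum_i x 0 i) by cts.
rewrite (_ : geom_simplex s = (\bigcap_i [set x | 0 <= x 0 i]) `&`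
  ([set x | \sum_i x 0 i <= 1] `&` [set x | 1 <= \sum_i x 0 i]) `&`
  (\bigcap_(i in [set i | i \notin s]) [set x | x 0 i <= 0])).
  apply: closedI; first apply: closedI.
  - by apply: closed_bigI => i _; apply: closed_le_fun; cts.
  - by apply: closedI; exact: closed_le_fun.
  - by apply: closed_bigI => i _; apply: closed_le_fun; cts.
apply/seteqP; split=> x /=.
  move=> [x0 x1 xs]; have {}x1 : \sum_i x 0 i = 1 := x1.
  split; first (split; [by move=> i _; exact: x0|by split; rewrite /= x1]).
  by move=> i /= /xs ->.
move=> [[x0 [x1 x1']] xs]; split.
- by move=> i; exact: x0.
- by apply/eqP; rewrite eq_le; apply/andP.
- by move=> i si; apply/eqP; rewrite eq_le x0 // xs.
Qed.

Lemma closed_realization K : closed (@realization R n K).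
Proof.
apply: closed_bigcup; first exact: finite_finset.
by move=> s _; exact: closed_geom_simplex.
Qed.

End Realization.

Definition retract_equiv (R : realType) (n : nat) (K K' : set {set 'I_n}) : Prop :=
  K' `<=` K /\ forall x (xK : x \in realization K) (xK' : x \in realization K'),
    pointed_equiv R (SigSub xK : space R K) (SigSub xK' : space R K').

Section Collapse.
Context {R : realType} {n : nat}.
Implicit Types (K : set {set 'I_n}) (s t : {set 'I_n}).

Lemma retract_equiv_refl K : retract_equiv R K K.
Proof.
by split=> // x xK xK'; rewrite (bool_irrelevance xK' xK); exact: pointed_equiv_refl.
Qed.

Lemma retract_equiv_trans K1 K K2 :
  retract_equiv R K K1 -> retract_equiv R K1 K2 -> retract_equiv R K K2.
Proof.
move=> [s1 p1] [s2 p2]; split; first exact: subset_trans s2 s1.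
move=> x xK xK2; have xK1 : x \in realization K1.
  by move: xK2; rewrite !inE; exact: realizationS.
exact: pointed_equiv_trans (p1 x xK xK1) (p2 x xK1 xK2).
Qed.

Section ToggleVertex.
Variables (K K' : set {set 'I_n}) (a : 'I_n).
Hypothesis K_complex : is_complex K.
Hypothesis K'_complex : is_complex K'.
Hypothesis K'_sub : K' `<=` K.
Hypothesis K'a : K' (finset.set1 a).
Hypothesis toggle : forall s, K s -> ~ K' s -> K (a |: s)%SET /\ ~ K' (s :\ a)%SET.
Implicit Types x : 'rV[R]_n.

(* Lowering all coordinates but the one of [a] at unit speed keeps a point in
   [K] until its support reaches [K']; the hitting time is a min-max of
   coordinates, hence continuous. *)
Let excess s x : R := \big[Num.max/0]_(i | (i \notin s) && (i != a)) x 0 i.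
Let hitting_time x : R := \big[Num.min/1]_(s | `[<K' s>]) excess s x.
Let lowered x (t : R) i : R := Num.max 0 (x 0 i - t * hitting_time x).
Let flow (z : 'rV[R]_n * R) : 'rV[R]_n := \row_i
  if i == a then 1 - \sum_(k | k != a) lowered z.1 z.2 k else lowered z.1 z.2 i.

Let flow_cts : cts flow.
Proof.
have hc : cts hitting_time by rewrite /hitting_time /excess; cts.
have lc i : cts (fun z : 'rV[R]_n * R => lowered z.1 z.2 i) by rewrite /lowered; cts.
apply: cts_row => i.
by case: (i == a); cts.
Qed.

Let excess_ge0 s x : 0 <= excess s x.
Proof. exact: bigmax_ge_id. Qed.

Let hitting_time_ge0 x : 0 <= hitting_time x.
Proof. by rewrite /hitting_time; elim/big_ind: _ => // u v u0 v0; rewrite le_min u0. Qed.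

Let hitting_time_le s x : K' s -> hitting_time x <= excess s x.
Proof. by move=> K's; apply: bigmin_inf (lexx _); exact/asboolP. Qed.

Let hitting_time_attained x : (forall i, 0 <= x 0 i) -> \sum_i x 0 i = 1 ->
  exists2 s, K' s & hitting_time x = excess s x.
Proof.
move=> x0 x1; have Ka : `[<K' (finset.set1 a)>] by exact/asboolP.
have := @arg_minP _ _ _ _ (fun s => `[<K' s>]) (excess ^~ x) Ka.
case=> s /asboolP K's smin; exists s => //; apply/eqP; rewrite eq_le hitting_time_le //=.
apply: le_bigmin => //; apply: bigmax_le => // i _.
by rewrite -x1 (bigD1 i) //= lerDl sumr_ge0.
Qed.

Let hitting_time_eq0 x : realization K' x -> hitting_time x = 0.
Proof.
move=> /(realizationP _ K'_complex)[x0 x1 K'x]; apply/eqP.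
rewrite eq_le hitting_time_ge0 andbT (le_trans (hitting_time_le _ K'x)) //.
by apply: bigmax_le => // i; rewrite inE negbK => /andP[/eqP ->].
Qed.

Let flow_sum z : \sum_i flow z 0 i = 1.
Proof.
rewrite (bigD1 a) //= mxE eqxx (eq_bigr (lowered z.1 z.2)) ?subrK // => i /negbTE ia.
by rewrite mxE ia.
Qed.

Let flow_ge0 x (t : R) : (forall i, 0 <= x 0 i) -> \sum_i x 0 i = 1 -> 0 <= t ->
  forall i, 0 <= flow (x, t) 0 i.
Proof.
move=> x0 x1 t0 i; rewrite mxE; case: eqP => _ /=; last by rewrite le_max lexx.
rewrite subr_ge0 -x1 [leRHS](bigD1 a) //= ler_wpDl ?x0 //.
by apply: ler_sum => k _; rewrite ge_max x0 /= gerBl mulr_ge0.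
Qed.

Let flow_supp x (t : R) : (forall i, 0 <= x 0 i) -> 0 <= t ->
  supp (flow (x, t)) \subset (a |: supp x)%SET.
Proof.
move=> x0 t0; apply/fintype.subsetP => i; rewrite !inE mxE.
have [//|ia /=] := eqVneq i a; apply: contraNneq => xi.
by rewrite /lowered xi sub0r max_l // oppr_le0 mulr_ge0.
Qed.

Let flow_id x (t : R) : (forall i, 0 <= x 0 i) -> \sum_i x 0 i = 1 ->
  t * hitting_time x = 0 -> flow (x, t) = x.
Proof.
move=> x0 x1 tt; have lx i : lowered x t i = x 0 i by rewrite /lowered tt subr0 max_r.
apply/rowP => i; rewrite mxE /= lx; case: eqP => [->|//].
rewrite (eq_bigr (fun k => x 0 k)) // -x1 (bigD1 a) //=; ring.
Qed.

Let flow_in x (t : R) : realization K x -> 0 <= t -> realization K (flow (x, t)).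
Proof.
move=> Kx t0; have [x0 x1 Ksx] := (realizationP _ K_complex).1 Kx.
apply/(realizationP _ K_complex); split; [exact: flow_ge0|exact: flow_sum|].
have [K'sx|nK'] := pselect (K' (supp x)).
  by rewrite flow_id // hitting_time_eq0 ?mulr0 //; apply/(realizationP _ K'_complex).
apply: K_complex.2 (toggle Ksx nK').1 (flow_supp x0 t0) _.
exact/supp_neq0/flow_sum.
Qed.

Let flow_end x : realization K x -> realization K' (flow (x, 1)).
Proof.
move=> Kx; have [x0 x1 _] := (realizationP _ K_complex).1 Kx.
apply/(realizationP _ K'_complex); split; [exact: flow_ge0|exact: flow_sum|].
have [//|nK'] := pselect (K' (supp (flow (x, 1)))).
have [_ _ Kf] := (realizationP _ K_complex).1 (flow_in Kx ler01).
have [_ []] := toggle Kf nK'.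
have [s K's ts] := hitting_time_attained x0 x1.
apply: K'_complex.2 K's _ _.
  apply/fintype.subsetP => i; rewrite !inE mxE => /andP[ia]; rewrite (negbTE ia).
  apply: contraNT => si; rewrite /lowered /= mul1r max_l // subr_le0 ts.
  by apply: (@le_bigmax_cond _ _ _ _ i); rewrite si.
apply: contra_notN nK' => /eqP e.
suff -> : supp (flow (x, 1)) = finset.set1 a by [].
apply/eqP; rewrite eqEcard -finset.setD_eq0 e eqxx cards1 /= card_gt0.
exact/supp_neq0/flow_sum.
Qed.

Lemma toggle_vertex_collapse : retract_equiv R K K'.
Proof.
split=> //; apply: (@deformation_retract_pointed_equiv _ _ _ _ flow) => //.
- exact: realizationS.
- by move=> x t Kx /andP[t0 t1]; exact: flow_in.
- by move=> x /(realizationP _ K_complex)[x0 x1 _]; rewrite flow_id ?mul0r.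
- move=> x t K'x; have [x0 x1 _] := (realizationP _ K'_complex).1 K'x.
  by rewrite flow_id // hitting_time_eq0 ?mulr0.
Qed.

End ToggleVertex.

(* The pivot [a s] matches [s] with [a s |: s]; simplices with different
   pivots are incomparable, so the pivots can be toggled one after another. *)
Lemma matching_collapse (K K' : set {set 'I_n}) (a : {set 'I_n} -> 'I_n) :
  is_complex K -> is_complex K' -> K' `<=` K ->
  (forall s, K s -> ~ K' s ->
     [/\ K' (finset.set1 (a s)), K (a s |: s)%SET & ~ K' (s :\ a s)%SET]) ->
  (forall s t, K s -> ~ K' t -> t \subset s -> t != finset.set0 -> a t = a s) ->
  retract_equiv R K K'.
Proof.
move=> cK cK' K'K pivot coherent.
pose L (r : seq 'I_n) : set {set 'I_n} := [set s | K' s \/ [/\ K s, ~ K' s & a s \in r]].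
have cL r : is_complex (L r).
  split=> [s [/cK'.1//|[/cK.1//]]|s t [K's|[Ks nK's ar]] ts t0].
    by left; exact: cK'.2 K's ts t0.
  have [K't|nK't] := pselect (K' t); [by left|right; split=> //].
    exact: cK.2 Ks ts t0.
  by rewrite (coherent s t).
have -> : K = L (enum 'I_n).
  apply/seteqP; split=> s => [Ks|[/K'K//|[]//]].
  by have [|] := pselect (K' s); [left|right; rewrite mem_enum].
elim: (enum 'I_n) => [|w r IH].
  rewrite (_ : L [::] = K'); first exact: retract_equiv_refl.
  by apply/seteqP; split=> s => [[//|[]//]|]; left.
have LS : L r `<=` L (w :: r).
  by move=> s [|[Ks nK's ar]]; [left|right; rewrite inE ar orbT].
have [[s [Ks nK's aw nr]]|none] :=
    pselect (exists s, [/\ K s, ~ K' s, a s = w & w \notin r]); last first.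
  rewrite (_ : L (w :: r) = L r) //; apply/seteqP; split=> // s [|[Ks nK's]]; first by left.
  rewrite inE => /predU1P[aw|ar]; right=> //; split=> //.
  by apply: contra_notT none => nr; exists s; rewrite -{2}aw.
apply: retract_equiv_trans IH; apply: (@toggle_vertex_collapse _ _ w) => //.
  by left; rewrite -aw; have [] := pivot s Ks nK's.
move=> {s Ks nK's aw} s [K's|[Ks nK's asr]] nL; first by case: nL; left.
have aw : a s = w.
  by move: asr; rewrite inE => /predU1P[//|ar]; case: nL; right.
have [_ Kas nK'as] := pivot s Ks nK's; rewrite aw in Kas nK'as.
have sas : s \subset (w |: s)%SET by exact: finset.subsetUr.
split; first right.
  split=> //; last by rewrite -(coherent _ s) // ?cK.1 // aw inE eqxx.
  by move=> K'ws; apply: nK's; apply: cK'.2 K'ws sas (cK.1 _ Ks).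
move=> [//|[Ksw _]]; rewrite (coherent s) ?aw ?finset.subD1set ?(negbTE nr) //.
exact: cK.1.
Qed.

End Collapse.

(** * Relabelling vertices *)

Section Relabel.
Context {R : realType} {m n : nat} (f : 'I_m -> 'I_n).
Hypothesis f_inj : injective f.
Implicit Types (x : 'rV[R]_m) (y : 'rV[R]_n) (s : {set 'I_m}).

Definition push_row x : 'rV[R]_n := \row_i \sum_(k | f k == i) x 0 k.

Definition pull_row y : 'rV[R]_m := \row_k y 0 (f k).

Lemma push_rowE x k : push_row x 0 (f k) = x 0 k.
Proof.
rewrite mxE (eq_bigl (pred1 k)) ?big_pred1_eq // => i.
by rewrite /= (inj_eq f_inj).
Qed.

Lemma push_row_out x i : i \notin codom f -> push_row x 0 i = 0.
Proof.
by move=> fi; rewrite mxE big_pred0 // => k; apply: contraNF fi => /eqP<-; exact: codom_f.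
Qed.

Lemma push_rowK : cancel push_row pull_row.
Proof. by move=> x; apply/rowP => k; rewrite mxE push_rowE. Qed.

Lemma pull_rowK y : (forall i, i \notin codom f -> y 0 i = 0) ->
  push_row (pull_row y) = y.
Proof.
move=> y0; apply/rowP => i; have [/codomP[k ->]|fi] := boolP (i \in codom f).
  by rewrite push_rowE mxE.
by rewrite push_row_out ?y0.
Qed.

Lemma geom_simplex_push s x :
  geom_simplex (f @: s)%SET (push_row x) <-> geom_simplex s x.
Proof.
have sum_push : \sum_i push_row x 0 i = \sum_k x 0 k.
  rewrite (partition_big f xpredT) //=.
  by apply: eq_bigr => i _; rewrite mxE.
split=> -[x0 x1 xs]; split.
- by move=> k; rewrite -push_rowE.
- by rewrite -sum_push.
- by move=> k ks; rewrite -push_rowE xs // (mem_imset _ _ f_inj).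
- by move=> i; rewrite mxE sumr_ge0.
- by rewrite sum_push.
- move=> i fs; rewrite mxE big1 // => k /eqP fk; apply: xs.
  by apply: contra fs => ks; rewrite -fk imset_f.
Qed.

Lemma geom_simplex_pull s y :
  geom_simplex (f @: s)%SET y -> push_row (pull_row y) = y.
Proof.
move=> [_ _ ys]; apply: pull_rowK => i fi; apply: ys.
by apply: contra fi => /imsetP[k _ ->]; exact: codom_f.
Qed.

Lemma push_row_cts : cts push_row.
Proof. by apply: cts_row => i; cts. Qed.

Lemma pull_row_cts : cts pull_row.
Proof. by apply: cts_row => i; cts. Qed.

Lemma relabel_pointed_equiv (K : set {set 'I_m}) (K' : set {set 'I_n}) :
  (forall t, K' t <-> exists2 s, K s & t = (f @: s)%SET) ->
  forall x : space R K, exists y : space R K', pointed_equiv R y x.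
Proof.
move=> K'E x.
have pushP (z : space R K) : push_row (\val z) \in realization K'.
  have [s Ks zs] := set_mem (valP z); rewrite inE; exists (f @: s)%SET.
    by apply/K'E; exists s.
  exact/geom_simplex_push.
have pullK (z : space R K') : push_row (pull_row (\val z)) = \val z.
  have [t /K'E[s _ ->] zs] := set_mem (valP z); exact: geom_simplex_pull zs.
have pullP (z : space R K') : pull_row (\val z) \in realization K.
  have [t /K'E[s Ks ->] zs] := set_mem (valP z); rewrite inE; exists s => //.
  by apply/geom_simplex_push; rewrite pullK.
have push_cts := push_row_cts; have pull_cts := pull_row_cts.
exists (SigSub (pushP x)).
apply: (@homeomorphic_pointed_equiv _ _ _ _ _ (fun z => SigSub (pullP z) : space R K)
    (fun z => SigSub (pushP z) : space R K')).
- by apply: cts_sub => /=; cts.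
- by apply: cts_sub => /=; cts.
- by move=> z; apply: val_inj; exact: pullK.
- by move=> z; apply: val_inj; exact: push_rowK.
- by apply: val_inj; exact: push_rowK.
Qed.

End Relabel.

(** * Null-homotopic boundaries of simplices *)

Section SimplexRetraction.
Context {R : realType} {n : nat}.
Implicit Types (s : {set 'I_n}) (x : 'rV[R]_n).

Let mass s x : R := \sum_(i in s) Num.max 0 (x 0 i).

(* Drop the negative part, then share out what is missing and rescale what is
   in excess of total mass 1. *)
Definition simplex_retr s x : 'rV[R]_n := \row_i
  if i \in s then (Num.max 0 (x 0 i) + Num.max 0 (1 - mass s x) / #|s|%:R) /
    Num.max 1 (mass s x) else 0.

Let mass_gt0 s x : 0 < Num.max 1 (mass s x).
Proof. by rewrite lt_max ltr01. Qed.

Lemma simplex_retr_cts s : cts (simplex_retr s).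
Proof.
apply: cts_row => i.
by rewrite /mass; case: (i \in s); cts => x; rewrite gt_eqF ?mass_gt0.
Qed.

Lemma simplex_retr_simplex s x : s != finset.set0 -> geom_simplex s (simplex_retr s x).
Proof.
rewrite -card_gt0 => s0; split=> [i||i /negbTE si]; last by rewrite mxE si.
  rewrite mxE; case: ifP => // _; apply: divr_ge0; last exact/ltW/mass_gt0.
  by rewrite addr_ge0 ?divr_ge0 // le_max lexx.
rewrite (bigID (mem s)) /= [X in _ + X]big1 ?addr0; last first.
  by move=> i /negbTE si; rewrite mxE si.
rewrite (eq_bigr (fun i => (Num.max 0 (x 0 i) + Num.max 0 (1 - mass s x) / #|s|%:R) /
    Num.max 1 (mass s x))); last by move=> i si; rewrite mxE si.
rewrite -mulr_suml big_split /= sumr_const -/(mass s x) -[_ / _ *+ _]mulr_natr.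
rewrite divfK; last first.
  by rewrite pnatr_eq0 -lt0n.
rewrite (_ : mass s x + _ = Num.max 1 (mass s x)) ?divff ?gt_eqF ?mass_gt0 //.
have [h|/ltW h] := leP (mass s x) 1.
  by rewrite max_r ?max_l //; lra.
by rewrite max_l ?max_r //; lra.
Qed.

Lemma simplex_retr_id s x : geom_simplex s x -> simplex_retr s x = x.
Proof.
move=> [x0 x1 xs].
have massE : mass s x = 1.
  rewrite -[RHS]x1 [RHS](bigID (mem s)) /= [X in _ + X]big1 ?addr0; last by move=> i /xs.
  by apply: eq_bigr => i _; rewrite max_r // x0.
apply/rowP => i; rewrite mxE massE subrr !maxxx mul0r addr0 divr1.
by case: ifPn => [_|/xs ->//]; rewrite max_r // x0.
Qed.

End SimplexRetraction.

Section BoundaryNull.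
Context {R : realType} {n : nat}.
Implicit Types (K : set {set 'I_n}) (s : {set 'I_n}) (x : 'rV[R]_n).

Lemma supp_proper s x i : geom_simplex s x -> i \in s -> x 0 i = 0 ->
  supp x \proper s.
Proof.
move=> /geom_simplexP[_ _ xs] is_ xi; apply/properP; split=> //.
by exists i; rewrite // inE xi eqxx.
Qed.

(* The boundary of the simplex [s] is null-homotopic in [K]: its inclusion
   extends to the whole simplex. *)
Definition boundary_null K s : Prop := exists Psi : 'rV[R]_n -> space R K, cts Psi /\
  forall x, geom_simplex s x -> supp x \proper s -> \val (Psi x) = x.

Lemma simplex_boundary_null K s : s != finset.set0 -> K s -> boundary_null K s.
Proof.
move=> s0 Ks; have retrP x : simplex_retr s x \in realization K.
  by rewrite inE; exists s => //; exact: simplex_retr_simplex.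
exists (fun x => SigSub (retrP x)); split.
  by apply: cts_sub; exact: simplex_retr_cts.
by move=> x xs _; exact: simplex_retr_id.
Qed.

Section Cone.
Variables (K : set {set 'I_n}) (s : {set 'I_n}) (w : 'I_n).
Hypothesis ws : w \notin s.

Let least x : R := \big[Num.min/1]_(i in s) x 0 i.

(* The point [shave x] is the projection of [x] from the barycenter of [s] to
   the cone from [w] over the boundary of [s]. *)
Let shave x : 'rV[R]_n := \row_i
  if i == w then #|s|%:R * least x else if i \in s then x 0 i - least x else x 0 i.

Let shave_cts : cts shave.
Proof.
have lc : cts least by rewrite /least; cts.
apply: cts_row => i.
by case: (i == w); [cts|case: (i \in s); cts].
Qed.

Let least_le x i : i \in s -> least x <= x 0 i.
Proof. by move=> is_; exact: bigmin_inf is_ (lexx _). Qed.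

Let least_attained x : s != finset.set0 -> geom_simplex s x ->
  exists2 i, i \in s & least x = x 0 i.
Proof.
move=> /finset.set0Pn[i0 i0s] [x0 x1 _].
have [i is_ imin] := @arg_minP _ _ _ i0 (mem s) (fun i => x 0 i) i0s.
exists i => //; apply/eqP; rewrite eq_le least_le //=; apply: le_bigmin => [|k ks].
  by rewrite -[leRHS]x1 (bigD1 i) //= lerDl sumr_ge0.
exact: imin.
Qed.

Let least_ge0 x : geom_simplex s x -> 0 <= least x.
Proof. by move=> [x0 _ _]; apply: le_bigmin => // i _; exact: x0. Qed.

Let shave_simplex x i : geom_simplex s x -> i \in s -> x 0 i = least x ->
  geom_simplex (w |: s :\ i)%SET (shave x).
Proof.
move=> xs is_ xi; have [x0 x1 xout] := xs; split.
- move=> k; rewrite mxE; case: ifP => _; first by rewrite mulr_ge0 ?least_ge0.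
  by case: ifP => [ks|_]; rewrite ?subr_ge0 ?least_le ?x0.
- rewrite (bigD1 w) //= mxE eqxx.
  rewrite (eq_bigr (fun k => x 0 k - (k \in s)%:R * least x)); last first.
    by move=> k /negbTE kw; rewrite mxE kw; case: ifP; rewrite ?mul1r ?mul0r ?subr0.
  rewrite sumrB -mulr_suml.
  have -> : \sum_(k | k != w) x 0 k = 1.
    by rewrite -[RHS]x1 [RHS](bigD1 w) //= xout // add0r.
  rewrite -natr_sum (_ : (\sum_(k | _) _)%N = #|s|); first by rewrite addrC subrK.
  rewrite -sum1_card [RHS]big_mkcond [RHS](bigD1 w) //= (negbTE ws) add0n.
  by apply: eq_bigr => k _; case: (k \in s).
- move=> k; rewrite !inE negb_or negb_and negbK => /andP[/negbTE kw /orP[/eqP->|ks]].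
    by rewrite mxE is_ xi subrr ifN //; apply: contraNneq ws => <-.
  by rewrite mxE kw (negbTE ks) xout.
Qed.

Let shave_id x : geom_simplex s x -> least x = 0 -> shave x = x.
Proof.
move=> [_ _ xs] m0; apply/rowP => k; rewrite mxE m0 mulr0 subr0 if_same.
by case: eqP => // ->; rewrite xs.
Qed.

Let shave_proper x i j : geom_simplex s x -> i \in s -> j \in s -> j != i ->
  x 0 i = least x -> x 0 j = least x -> supp (shave x) \proper (w |: s :\ i)%SET.
Proof.
move=> xs is_ js ji xi xj; apply: (supp_proper (shave_simplex xs is_ xi) (i := j)).
  by rewrite !inE ji js orbT.
by rewrite mxE xj subrr js ifN //; apply: contraNneq ws => <-.
Qed.

Lemma boundary_null_cone : s != finset.set0 ->
  (forall i, i \in s -> boundary_null K (w |: s :\ i)%SET) -> boundary_null K s.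
Proof.
move=> s0 faces; have [i0 i0s] := finset.set0Pn _ s0.
pose I : finType := {i : 'I_n | i \in s}.
have /choice[Psi PsiP] : forall i : I, boundary_null K (w |: s :\ \val i)%SET.
  by move=> i; exact/faces/valP.
pose cone x :=
  Psi (odflt (exist _ i0 i0s) [pick i : I | x 0 (\val i) == least x]) (shave x).
have coneE x (i : I) : geom_simplex s x -> x 0 (\val i) = least x ->
    cone x = Psi i (shave x).
  move=> xs xi; rewrite /cone; case: pickP => [k /eqP xk|/(_ i)] /=; last first.
    by rewrite xi eqxx.
  have [->//|ki] := eqVneq k i.
  have Psi_shave (j j' : I) : x 0 (\val j) = least x -> x 0 (\val j') = least x ->
      j' != j -> \val (Psi j (shave x)) = shave x.
    move=> xj xj' jj'; apply: (PsiP j).2; first exact: shave_simplex (valP j) xj.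
    exact: shave_proper (valP j) (valP j') jj' xj xj'.
  by apply: val_inj; rewrite (Psi_shave k i) 1?eq_sym // (Psi_shave i k).
have rc := @simplex_retr_cts R n s; have cs := shave_cts.
have retr_s x := @simplex_retr_simplex R n s x s0.
exists (fun x => cone (simplex_retr s x)); split; last first.
  move=> x xs xprop; rewrite simplex_retr_id //.
  have [i is_ xi] : exists2 i, i \in s & x 0 i = 0.
    have /properP[_ [i is_]] := xprop.
    by rewrite inE negbK => /eqP; exists i.
  have m0 : least x = 0.
    by apply/eqP; rewrite eq_le least_ge0 // andbT -xi least_le.
  have xw : geom_simplex (w |: s :\ i)%SET x.
    by rewrite -(shave_id xs m0); apply: shave_simplex; rewrite ?m0.
  rewrite (coneE x (exist _ i is_)) ?m0 // shave_id //; apply: (PsiP _).2 => //=.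
  apply: (@supp_proper _ _ w xw); first by rewrite !inE eqxx.
  by have [_ _ ->] := xs.
pose region (i : I) : set 'rV[R]_n :=
  [set x | simplex_retr s x 0 (\val i) <= least (simplex_retr s x)].
have lc : cts least by rewrite /least; cts.
apply: (@cts_closed_glue _ _ _ region (fun i x => Psi i (shave (simplex_retr s x)))).
- by move=> i; apply: closed_le_fun; cts.
- move=> x; have [i is_ xi] := least_attained s0 (retr_s x).
  by exists (exist _ i is_); rewrite /region /= xi.
- by move=> i; have [ci _] := PsiP i; cts.
- move=> i x /= xi; apply: coneE => //; apply/eqP; rewrite eq_le xi least_le //.
  exact: valP.
Qed.

End Cone.
End BoundaryNull.

Arguments boundary_null R {n} K s.

(** * Attaching simplices along null-homotopic boundaries *)

Section Barycentric.
Context {R : realType} {d : nat}.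
Implicit Types (y : 'rV[R]_d) (p : 'rV[R]_d.+1).
Local Notation c := (d.+1%:R^-1 : R).

(* Barycentric coordinates on the standard simplex, centered at its barycenter. *)
Definition bary y : 'rV[R]_d.+1 := row_cons (c - \sum_j y 0 j) (\row_j (c + y 0 j)).

Definition unbary p : 'rV[R]_d := \row_j (row_tail p 0 j - c).

Definition simplex_gauge y : R :=
  \big[Num.max/0]_k (1 - d.+1%:R * bary y 0 k).

Lemma baryK : cancel bary unbary.
Proof. by move=> y; apply/rowP => j; rewrite mxE row_consK mxE addrC addKr. Qed.

Lemma bary_head y : bary y 0 0 = c - \sum_j y 0 j.
Proof. exact: row_cons0. Qed.

Lemma bary_lift y j : bary y 0 (lift 0 j) = c + y 0 j.
Proof. by rewrite mxE liftK /= mxE. Qed.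

Lemma unbaryK p : \sum_k p 0 k = 1 -> bary (unbary p) = p.
Proof.
rewrite big_ord_recl => p1; have {}p1 : p 0 0 + \sum_j p 0 (lift 0 j) = 1 := p1.
rewrite -[RHS]row_cons_eta; congr row_cons; last first.
  by apply/rowP => j; rewrite !mxE addrC subrK.
rewrite (eq_bigr (fun j => p 0 (lift 0 j) - c)); last by move=> j _; rewrite !mxE.
rewrite sumrB sumr_const card_ord -[c *+ d]mulr_natr.
have -> : c * d%:R = 1 - c by rewrite -[d%:R](addrK 1) natr1 mulrBr mulr1 mulVf.
by rewrite (_ : \sum_j _ = 1 - p 0 0) -?p1; ring.
Qed.

Lemma sum_bary y : \sum_k bary y 0 k = 1.
Proof.
rewrite big_ord_recl bary_head [X in _ + X](eq_bigr (fun j => c + y 0 j)).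
  rewrite big_split /= sumr_const card_ord addrACA [- _ + _]addrC subrr addr0.
  by rewrite -mulrS -[c *+ _]mulr_natr mulVf.
by move=> j _; rewrite bary_lift.
Qed.

Lemma bary_cts : cts bary.
Proof. by apply: cts_row_cons; [cts|apply: cts_row => j; cts]. Qed.

Lemma unbary_cts : cts unbary.
Proof. by apply: cts_row => j; have tc := @row_tail_cts R d; cts. Qed.

Let form y k : R := 1 - d.+1%:R * bary y 0 k.

Let form_head y : form y 0 = d.+1%:R * \sum_j y 0 j.
Proof. by rewrite /form bary_head mulrBr divff // opprB addrC subrK. Qed.

Let form_lift y j : form y (lift 0 j) = - (d.+1%:R * y 0 j).
Proof. by rewrite /form bary_lift mulrDr divff // opprD addrA subrr add0r. Qed.

Let formZ a y k : form (a *: y) k = a * form y k.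
Proof.
case: (unliftP 0 k) => [j ->|->]; first by rewrite !form_lift mxE; ring.
rewrite !form_head mulrCA; congr (_ * _); rewrite mulr_sumr.
by apply: eq_bigr => j _; rewrite mxE.
Qed.

Let sum_form y : \sum_k form y k = 0.
Proof. by rewrite sumrB -mulr_sumr sum_bary sumr_const card_ord mulr1 subrr. Qed.

Let form_le y k : form y k <= simplex_gauge y.
Proof. exact: le_bigmax. Qed.

Let sum_sqr_form_le y : \sum_k form y k ^+ 2 <= (d.+1%:R * simplex_gauge y) ^+ 2.
Proof.
set r := simplex_gauge y; have r0 : 0 <= r by exact: bigmax_ge_id.
have sum_gap : \sum_k (r - form y k) = d.+1%:R * r.
  by rewrite sumrB sum_form subr0 sumr_const card_ord -[r *+ _]mulr_natl.
have gap_le k : r - form y k <= d.+1%:R * r.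
  rewrite -sum_gap (bigD1 k) //= lerDl sumr_ge0 // => i _.
  by rewrite subr_ge0 form_le.
have le k : form y k ^+ 2 <= (d.+1%:R * r - 2 * r) * (r - form y k) + r ^+ 2.
  by have := gap_le k; have := form_le y k; rewrite -/r; nra.
apply: le_trans (ler_sum _ (fun k _ => le k)) _.
rewrite big_split /= -mulr_sumr sum_gap sumr_const card_ord -[r ^+ 2 *+ _]mulr_natl.
have : 0 <= d.+1%:R * r ^+ 2 by rewrite mulr_ge0 ?sqr_ge0.
by nra.
Qed.

Lemma simplex_gauge_gauge : gauge simplex_gauge.
Proof.
have bc := bary_cts; split=> [|a y a0|y].
- by rewrite /simplex_gauge; cts.
- rewrite /simplex_gauge (big_morph ( *%R a) (fun u v => maxr_pMr u v a0) (mulr0 a)).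
  by apply: eq_bigr => k _; exact: formZ.
- have r0 : 0 <= simplex_gauge y by exact: bigmax_ge_id.
  have d0 : 0 < d.+1%:R ^+ 2 :> R by rewrite exprn_gt0.
  rewrite -ler_sqr ?nnegrE ?enorm_ge0 // -(ler_pM2l d0) -[leRHS]exprMn.
  apply: le_trans (sum_sqr_form_le y); rewrite sqr_enorm big_ord_recl mulr_sumr.
  rewrite ler_wpDl ?sqr_ge0 //; apply: ler_sum => j _.
  by rewrite form_lift sqrrN exprMn.
Qed.

Lemma simplex_gauge_le1 y : (simplex_gauge y <= 1) <-> forall k, 0 <= bary y 0 k.
Proof.
have form_le1 k : (form y k <= 1) = (0 <= bary y 0 k).
  by rewrite gerBl pmulr_rge0.
split=> [r1 k|b0]; first by rewrite -form_le1 (le_trans (form_le _ _)).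
by apply: bigmax_le => // k _; rewrite form_le1.
Qed.

Lemma simplex_gauge_lt1 y k : simplex_gauge y < 1 -> 0 < bary y 0 k.
Proof.
move=> /(le_lt_trans (form_le y k)).
by rewrite /form gtrBl pmulr_rgt0.
Qed.

Lemma simplex_gauge_ge1 y : 1 <= simplex_gauge y -> exists k,
  bary (gauge_clamp simplex_gauge y) 0 k = 0.
Proof.
move=> /(gauge_clamp_ge1 simplex_gauge_gauge); set z := gauge_clamp _ y => z1.
have z0 := (simplex_gauge_le1 z).1; rewrite z1 in z0.
have [k /eqP|none] := pickP (fun k => bary z 0 k == 0); first by exists k.
have : simplex_gauge z < 1.
  apply: bigmax_lt => // k _; rewrite gtrBl pmulr_rgt0 // lt_neqAle eq_sym none /=.
  exact: z0.
by rewrite z1 ltxx.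
Qed.

End Barycentric.

Section SimplexChart.
Context {R : realType} {d n : nat} (t : 'I_d.+1 -> 'I_n).
Hypothesis t_inj : injective t.
Local Notation s := [set t k | k in finset.setT]%SET.
Local Notation rho := (@simplex_gauge R d).
Implicit Types (y : 'rV[R]_d) (x : 'rV[R]_n).

Definition simplex_chart y : 'rV[R]_n := push_row t (bary (gauge_clamp rho y)).

Definition simplex_coord x : 'rV[R]_d := unbary (pull_row t x).

Lemma simplex_chart_cts : cts simplex_chart.
Proof.
have pc := @push_row_cts R _ _ t; have bc := @bary_cts R d.
have cc := gauge_clamp_cts (@simplex_gauge_gauge R d).
by rewrite /simplex_chart; cts.
Qed.

Lemma simplex_coord_cts : cts simplex_coord.
Proof.
have pc := @pull_row_cts R _ _ t; have bc := @unbary_cts R d.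
by rewrite /simplex_coord; cts.
Qed.

Lemma simplex_chart_clamp y : simplex_chart (gauge_clamp rho y) = simplex_chart y.
Proof. by rewrite /simplex_chart gauge_clampK //; exact: simplex_gauge_gauge. Qed.

Lemma simplex_chartK y : simplex_coord (simplex_chart y) = gauge_clamp rho y.
Proof. by rewrite /simplex_coord push_rowK // baryK. Qed.

Lemma simplex_chart_simplex y : geom_simplex s (simplex_chart y).
Proof.
apply/geom_simplex_push => //; split; [|exact: sum_bary|by move=> k; rewrite inE].
exact/simplex_gauge_le1/gauge_clamp_le1/simplex_gauge_gauge.
Qed.

Lemma simplex_coordK x : geom_simplex s x -> simplex_chart (simplex_coord x) = x.
Proof.
move=> xs; have [p0 p1 _] : geom_simplex finset.setT (pull_row t x).
  by apply/(geom_simplex_push t_inj); rewrite (geom_simplex_pull t_inj xs).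
rewrite /simplex_chart gauge_clamp_id.
  by rewrite unbaryK // (geom_simplex_pull t_inj xs).
by apply/simplex_gauge_le1 => k; rewrite unbaryK.
Qed.

Lemma range_simplex_chart : range simplex_chart = geom_simplex s.
Proof.
apply/seteqP; split=> [_ [y _ <-]|x xs]; first exact: simplex_chart_simplex.
by exists (simplex_coord x) => //; exact: simplex_coordK.
Qed.

Lemma supp_simplex_chart_interior y : rho y < 1 -> supp (simplex_chart y) = s.
Proof.
move=> y1; apply/eqP; rewrite finset.eqEsubset.
have [_ _ ->] := (geom_simplexP _ _).1 (simplex_chart_simplex y).
apply/fintype.subsetP => _ /imsetP[k _ ->]; rewrite inE push_rowE //.
by rewrite gt_eqF // gauge_clamp_id ?ltW //; exact: simplex_gauge_lt1.
Qed.

Lemma supp_simplex_chart_boundary y : 1 <= rho y -> supp (simplex_chart y) \proper s.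
Proof.
move=> /simplex_gauge_ge1[k yk].
apply: (supp_proper (simplex_chart_simplex y) (i := t k)); first exact: imset_f.
by rewrite push_rowE.
Qed.

End SimplexChart.

Definition joined (R : realType) (X : topologicalType) (x y : X) : Prop :=
  homotopic_rel R set0 (fun _ : discrete_topology unit => x) (fun _ => y).

Lemma joined_path (R : realType) (X : topologicalType) (x y : X) :
  joined R x y -> exists g : R -> X, [/\ cts g, g 0 = x & g 1 = y].
Proof.
move=> [H [cH H0 H1 _]]; exists (fun r => H (tt, r)); split=> //.
by apply: (cts_comp cH); apply: (@cts_pair _ (discrete_topology unit));
  [exact: cts_cst|exact: cts_id].
Qed.

Section Joined.
Context {R : realType} {X : topologicalType}.
Implicit Types x y z : X.

Lemma joined_refl x : joined R x x.
Proof. exact/homotopic_rel_refl/cts_cst. Qed.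

Lemma joined_sym x y : joined R x y -> joined R y x.
Proof. exact: homotopic_rel_sym. Qed.

Lemma joined_trans y x z : joined R x y -> joined R y z -> joined R x z.
Proof. exact: homotopic_rel_trans. Qed.

Lemma path_joined (g : R -> X) : cts g -> joined R (g 0) (g 1).
Proof. by move=> cg; exists (fun u => g u.2); split=> //; cts. Qed.

End Joined.

Section ComplexConnected.
Context {R : realType} {n : nat}.
Variable K : set {set 'I_n}.

Lemma simplex_joined (s : {set 'I_n}) (x y : space R K) : K s ->
  geom_simplex s (\val x) -> geom_simplex s (\val y) -> joined R x y.
Proof.
move=> Ks [x0 x1 xs] [y0 y1 ys]; have uc := @unit_clamp_cts R.
pose g t : 'rV[R]_n := (1 - unit_clamp t) *: \val x + unit_clamp t *: \val y.
have gP t : g t \in realization K.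
  have /andP[t0 t1] := unit_clamp_itv t; rewrite inE; exists s => //; split.
  - by move=> i; rewrite !mxE addr_ge0 // mulr_ge0 // subr_ge0.
  - rewrite (eq_bigr (fun i => (1 - unit_clamp t) * (\val x) 0 i +
      unit_clamp t * (\val y) 0 i)) => [|i _]; last by rewrite !mxE.
    by rewrite big_split /= -!mulr_sumr x1 y1; lra.
  - by move=> i si; rewrite !mxE xs // ys // !mulr0 addr0.
pose h t : space R K := SigSub (gP t).
have cg : cts g by rewrite /g; cts.
have ch : cts h by apply: cts_sub.
rewrite (_ : x = h 0); last first.
  by apply: val_inj; rewrite /= /g unit_clamp0 subr0 scale1r scale0r addr0.
rewrite (_ : y = h 1); first exact: path_joined.
by apply: val_inj; rewrite /= /g unit_clamp1 subrr scale1r scale0r add0r.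
Qed.

Hypothesis K_complex : is_complex K.
Variable e : rel 'I_n.
Hypothesis e_connected : forall x y, connect e x y.
Hypothesis K_vertex : forall x, K (finset.set1 x).
Hypothesis K_edge : forall x y, e x y -> K [set x; y]%SET.

Lemma complex_connected (x y : space R K) : joined R x y.
Proof.
have deltaP k : (delta_mx 0 k : 'rV[R]_n) \in realization K.
  by rewrite inE; exists (finset.set1 k) => //; apply: geom_simplex_delta; rewrite inE.
pose vertex k : space R K := SigSub (deltaP k).
have to_vertex z : exists k, joined R z (vertex k).
  have [z0 z1 zs] := (realizationP _ K_complex).1 (set_mem (valP z)).
  have [k ks] := finset.set0Pn _ (supp_neq0 z1); exists k.
  by apply: (simplex_joined zs); [apply/geom_simplexP|exact: geom_simplex_delta].
have [k xk] := to_vertex x; have [l yl] := to_vertex y.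
apply: (joined_trans xk); apply: joined_trans (joined_sym yl).
have /connectP[p] := e_connected k l; elim: p k {xk} => [|j p IH] k /=.
  by move=> _ ->; exact: joined_refl.
move=> /andP[kj jp] lE; apply: joined_trans (IH j jp lE).
by apply: (simplex_joined (K_edge kj)); apply: geom_simplex_delta; rewrite !inE eqxx ?orbT.
Qed.

End ComplexConnected.

Lemma card_imset_ord (T : finType) (m : nat) (s : {set T}) : #|s| = m ->
  exists2 t : 'I_m -> T, injective t & s = [set t k | k in finset.setT]%SET.
Proof.
move=> <-; exists (fun k => enum_val k); first exact: enum_val_inj.
apply/setP => x; apply/idP/imsetP => [xs|[k _ ->]]; last exact: enum_valP.
by exists (enum_rank_in xs x); rewrite ?enum_rankK_in.
Qed.

Section AttachSimplices.
Context {R : realType} {d n : nat}.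
Variables (A B : set {set 'I_n}) (F : {set {set 'I_n}}).
Implicit Types s t : {set 'I_n}.

Hypothesis A_complex : is_complex A.
Hypothesis A_connected : forall x y : space R A, joined R x y.
Hypothesis BE : forall s, B s <-> A s \/ s \in F.
Hypothesis F_card : forall s, s \in F -> #|s| = d.+1.
Hypothesis F_new : forall s, s \in F -> ~ A s.
Hypothesis F_faces : forall s t, s \in F -> t \proper s -> t != finset.set0 -> A t.
Hypothesis F_null : forall s, s \in F -> boundary_null R A s.

Lemma boundary_null_filling (x0 : space R A) (t : 'I_d.+1 -> 'I_n) : injective t ->
  boundary_null R A [set t k | k in finset.setT]%SET ->
  exists Psi : 'rV[R]_d -> space R A, [/\ cts Psi, Psi 0 = x0 &
    forall y, 1 <= simplex_gauge y -> \val (Psi y) = simplex_chart t y].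
Proof.
move=> t_inj [P [cP PE]]; have rho_gauge := @simplex_gauge_gauge R d.
have rc := gauge_cts rho_gauge; have sc := @simplex_chart_cts R d n t.
have [g [cg g0 g1]] := joined_path (A_connected x0 (P (simplex_chart t 0))).
exists (fun y => if simplex_gauge y <= 2^-1 then g (2 * simplex_gauge y)
  else P (simplex_chart t ((2 * simplex_gauge y - 1) *: y))); split.
- by apply: cts_if_le; cts => y y2; rewrite y2 mulfV // subrr scale0r g1.
- by rewrite gauge0 // invr_ge0 ler0n mulr0 g0.
- move=> y y1; rewrite ifF; last by apply/negbTE; rewrite -ltNge; lra.
  rewrite /simplex_chart gauge_clampZ //; last by lra.
  rewrite -/(simplex_chart t y); apply: PE; first exact: simplex_chart_simplex.
  exact: supp_simplex_chart_boundary.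
Qed.

Lemma attach_complex : is_complex B.
Proof.
split=> [s /BE[/A_complex.1//|/F_card s_card]|s t /BE[As|Fs] ts t0].
- by rewrite -card_gt0 s_card.
- by apply/BE; left; exact: A_complex.2 As ts t0.
- have [->|tns] := eqVneq t s; apply/BE; [by right|left].
  by apply: F_faces Fs _ t0; rewrite finset.properEneq tns.
Qed.

Lemma simplices_meet s s' (x : 'rV[R]_n) : s \in F -> s' \in F -> s != s' ->
  geom_simplex s x -> geom_simplex s' x -> realization A x.
Proof.
move=> Fs Fs' ss' /geom_simplexP[x0 x1 xs] /geom_simplexP[_ _ xs'].
apply/(realizationP _ A_complex); split=> //; apply: (F_faces Fs) (supp_neq0 x1).
rewrite finset.properEneq xs andbT; apply: contra_neq ss' => e.
by apply/eqP; rewrite eqEcard (F_card Fs) (F_card Fs') leqnn andbT -e.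
Qed.

Lemma attach_simplices_pointed_equiv x (xA : x \in @realization R n A)
    (xB : x \in @realization R n B) :
  pointed_equiv R (SigSub xB : space R B)
    (@wedge_base R d #|F| (space R A) (SigSub xA) (SigSub xA)).
Proof.
have AB : realization A `<=` @realization R n B.
  by apply: realizationS => s As; apply/BE; left.
have /choice[t tP] : forall l : 'I_#|F|, exists t : 'I_d.+1 -> 'I_n,
    injective t /\ enum_val l = [set t k | k in finset.setT]%SET.
  by move=> l; have [t] := card_imset_ord (F_card (enum_valP l)); exists t.
have t_inj l : injective (t l) by have [] := tP l.
have FE l : [set t l k | k in finset.setT]%SET \in F.
  by have [_ <-] := tP l; exact: enum_valP.
have /choice[Psi PsiP] l := boundary_null_filling (SigSub xA) (@t_inj l) (F_null (FE l)).
rewrite (_ : SigSub xB = attach_incl AB (SigSub xA)); last exact: val_inj.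
apply: (@attach_pointed_equiv R d #|F| _ (@simplex_gauge R d) _ _ _
    (fun l => simplex_chart (t l)) (fun l => simplex_coord (t l)) Psi).
- exact: simplex_gauge_gauge.
- exact: closed_realization.
- move=> l y; exists (enum_val l); first by apply/BE; right; exact: enum_valP.
  by have [_ ->] := tP l; exact: simplex_chart_simplex.
- move=> y /(realizationP _ attach_complex)[y0 y1 /BE[As|Fs]].
    by left; apply/(realizationP _ A_complex).
  right; exists (enum_rank_in Fs (supp y)); have [_ tE] := tP (enum_rank_in Fs (supp y)).
  exists (simplex_coord (t (enum_rank_in Fs (supp y))) y); rewrite simplex_coordK //.
  by apply/geom_simplexP; rewrite -tE enum_rankK_in.
- by move=> l; exact: simplex_chart_cts.
- by move=> l; rewrite range_simplex_chart //; exact: closed_geom_simplex.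
- by move=> l; exact: simplex_coord_cts.
- by move=> l y; exact: simplex_chart_clamp.
- by move=> l y; exact: simplex_chartK.
- move=> l l' y y' ll' e; apply: (simplices_meet (FE l) (FE l')).
  + by apply: contra_neq ll'; have [_ <-] := tP l; have [_ <-] := tP l';
      exact: enum_val_inj.
  + exact: simplex_chart_simplex.
  + by rewrite e; exact: simplex_chart_simplex.
- move=> l y /(realizationP _ A_complex)[_ _ As]; rewrite leNgt; apply/negP => y1.
  by apply: (F_new (FE l)); rewrite -(supp_simplex_chart_interior (@t_inj l) y1).
- by move=> l; have [] := PsiP l.
- by move=> l; have [] := PsiP l.
- by move=> l; have [] := PsiP l.
- exact: space_hausdorff.
Qed.

End AttachSimplices.
(** * Neighbourhood complexes *)

Lemma setD1_id (T : finType) (A : {set T}) (x : T) : x \notin A -> (A :\ x)%SET = A.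
Proof.
by move=> xA; apply/setP => y; rewrite !inE; case: eqP => // ->; rewrite (negbTE xA).
Qed.

Section ConeAdjunction.
Context {R : realType} {n : nat}.
Implicit Types (s t : {set 'I_n}) (K L : set {set 'I_n}).

Definition hereditary L : Prop := forall s t : {set 'I_n}, L s -> t \subset s -> L t.

Definition cone_adj K (v : 'I_n) L : set {set 'I_n} :=
  K `|` [set s : {set 'I_n} | v \in s /\ L (s :\ v)%SET].

Lemma hereditaryU L L' : hereditary L -> hereditary L' -> hereditary (L `|` L').
Proof.
move=> hL hL' s t [Ls|L's] ts; [left; exact: hL Ls ts|right; exact: hL' L's ts].
Qed.

Lemma cone_adjS K v L L' : L' `<=` L -> cone_adj K v L' `<=` cone_adj K v L.
Proof. by move=> L'L s [Ks|[vs L's]]; [left|right; split=> //; exact: L'L]. Qed.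

Lemma cone_adj_complex K v L : is_complex K -> hereditary L ->
  (forall s, L s -> s != finset.set0 -> K s) -> is_complex (cone_adj K v L).
Proof.
move=> cK hL LK; split=> [s [/cK.1//|[vs _]]|s t [Ks|[vs Ls]] ts t0].
- by apply/finset.set0Pn; exists v.
- by left; exact: cK.2 Ks ts t0.
- have Lt : L (t :\ v)%SET by apply: hL Ls _; exact: finset.setSD.
  have [vt|vt] := boolP (v \in t); [by right|left; apply: LK => //].
  by rewrite -(setD1_id vt).
Qed.

Lemma cone_matching_collapse K v L L' (a : {set 'I_n} -> 'I_n) :
  is_complex K -> (forall s, K s -> v \notin s) ->
  hereditary L -> hereditary L' -> L' `<=` L ->
  (forall s, L s -> s != finset.set0 -> K s) ->
  (forall s, L s -> ~ L' s -> L (a s |: s)%SET /\ ~ L' (s :\ a s)%SET) ->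
  (forall s t, L s -> ~ L' t -> t \subset s -> a t = a s) ->
  retract_equiv R (cone_adj K v L) (cone_adj K v L').
Proof.
move=> cK vK hL hL' L'L LK pivot coherent.
have cL := cone_adj_complex v cK hL LK.
have cL' : is_complex (cone_adj K v L').
  by apply: cone_adj_complex => // s /L'L; exact: LK.
have new s : cone_adj K v L s -> ~ cone_adj K v L' s ->
    [/\ v \in s, L (s :\ v)%SET & ~ L' (s :\ v)%SET].
  move=> [Ks|[vs Ls]] nL'; first by case: nL'; left.
  by split=> // L's; apply: nL'; right.
apply: (@matching_collapse _ _ _ _ (fun s => a (s :\ v)%SET)) => //.
- exact: cone_adjS.
- move=> s Ls /(new s Ls)[vs Lsv nL'sv].
  have [] := pivot _ Lsv nL'sv; set w := a _ => Lw nL'w.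
  have Kw : K (w |: s :\ v)%SET.
    by apply: LK Lw _; apply/finset.set0Pn; exists w; rewrite finset.setU11.
  have wv : w != v by have := vK _ Kw; rewrite !inE negb_or eq_sym => /andP[].
  split.
  + left; apply: cK.2 Kw _ _; first by rewrite finset.subsetUl.
    by apply/finset.set0Pn; exists w; rewrite inE.
  + right; split; first by rewrite !inE vs orbT.
    by rewrite finset.setDUl (setD1_id (A := finset.set1 w)) // inE eq_sym.
  + move=> [/vK|[_]]; first by rewrite !inE eq_sym wv vs.
    by rewrite finset.setDDl finset.setUC -finset.setDDl.
- move=> s t Ls nL't ts t0.
  have [vt Lt nLt] := new t (cL.2 _ _ Ls ts t0) nL't.
  have vs : v \in s by move/fintype.subsetP: ts; exact.
  apply: coherent => //; last exact: finset.setSD.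
  by case: Ls => [/vK|[]//]; rewrite vs.
Qed.

End ConeAdjunction.

Section NeighbourhoodComplex.
Context {n : nat} (e : rel 'I_n).
Implicit Types (c v w x : 'I_n) (s : {set 'I_n}).

Definition nbrs v : {set 'I_n} := [set w | e v w]%SET.

Definition clnbrs v : {set 'I_n} := (v |: nbrs v)%SET.

Definition nbhd_complex : set {set 'I_n} :=
  [set s : {set 'I_n} | s != finset.set0 /\ exists c, s \subset clnbrs c].

Definition nbhd_complex_del v : set {set 'I_n} :=
  [set s : {set 'I_n} | s != finset.set0 /\
    exists2 c, c != v & s \subset (clnbrs c :\ v)%SET].

Lemma in_clnbrs c x : (x \in clnbrs c) = (x == c) || e c x.
Proof. by rewrite !inE. Qed.

Lemma nbhd_complex_complex : is_complex nbhd_complex.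
Proof.
split=> [s []//|s t [_ [c sc]] ts t0]; split=> //; exists c.
exact: fintype.subset_trans sc.
Qed.

Lemma nbhd_complex_del_complex v : is_complex (nbhd_complex_del v).
Proof.
split=> [s []//|s t [_ [c cv sc]] ts t0]; split=> //; exists c => //.
exact: fintype.subset_trans sc.
Qed.

Lemma nbhd_complex_delP v s : nbhd_complex_del v s -> v \notin s.
Proof.
by move=> [_ [c _ /fintype.subsetP sc]]; apply/negP => /sc; rewrite !inE eqxx.
Qed.

Lemma nbhd_complex_del_sub v : nbhd_complex_del v `<=` nbhd_complex.
Proof.
move=> s [s0 [c _ sc]]; split=> //; exists c.
exact/(fintype.subset_trans sc)/finset.subD1set.
Qed.

End NeighbourhoodComplex.

Section AddVertex.
Context {R : realType} {n : nat}.
Variables (e : rel 'I_n) (v w0 : 'I_n).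
Implicit Types (c u w x y : 'I_n) (p s t : {set 'I_n}).
Local Notation W := (nbrs e v).
Local Notation K0 := (nbhd_complex_del e v).

Hypothesis e_sym : symmetric e.
Hypothesis e_irr : irreflexive e.
Hypothesis w0W : w0 \in W.
Hypothesis nbrs_independent : forall w w', w \in W -> w' \in W -> ~~ e w w'.
Hypothesis nbrs_common : forall w w', w \in W -> w' \in W -> w != w' ->
  #|nbrs e w :&: nbrs e w'| = 2%N.
Hypothesis nbrs_meet : forall c, c != v -> (#|W :&: nbrs e c| <= 2)%N.

Lemma nbr_neq w : w \in W -> w != v.
Proof. by rewrite inE; apply: contraTneq => ->; rewrite e_irr. Qed.

Lemma sub_nbrs_notin p : p \subset W -> v \notin p.
Proof. by move=> /fintype.subsetP pW; apply/negP => /pW; rewrite inE e_irr. Qed.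

Lemma nbr_in_nbr w : w \in W -> v \in nbrs e w.
Proof. by rewrite !inE e_sym. Qed.

Lemma nbrs_meet_clnbrs w x : w \in W -> x \in W -> x \in clnbrs e w -> x = w.
Proof.
move=> wW xW; rewrite in_clnbrs => /orP[/eqP //|].
by rewrite (negbTE (nbrs_independent wW xW)).
Qed.

Lemma common_nbr w w' : w \in W -> w' \in W -> w != w' ->
  exists x, [/\ x != v, e w x, e w' x &
    forall y, y != v -> e w y -> e w' y -> y = x].
Proof.
move=> wW w'W ww'; have := nbrs_common wW w'W ww'.
rewrite (cardsD1 v) finset.in_setI !nbr_in_nbr // => -[/eqP/cards1P[x xE]].
have inE' y : (y == x) = [&& y != v, e w y & e w' y].
  by move/setP: xE => /(_ y); rewrite !inE => ->.
exists x; have := inE' x; rewrite eqxx => /esym/and3P[xv wx w'x].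
by split=> // y yv wy w'y; apply/eqP; rewrite inE' yv wy.
Qed.

(* Assigns each vertex of the link of [v] to one neighbour of [v]. *)
Definition owner x : 'I_n :=
  odflt x [pick w | (w \in W) && (x \in clnbrs e w)].

Lemma ownerP w x : w \in W -> x \in clnbrs e w ->
  owner x \in W /\ x \in clnbrs e (owner x).
Proof.
move=> wW xw; rewrite /owner; case: pickP => [w' /andP[]//|/(_ w)].
by rewrite wW xw.
Qed.

Lemma owner_nbr w : w \in W -> owner w = w.
Proof.
move=> wW; have [oW wo] := ownerP wW (finset.setU11 w _).
by have := nbrs_meet_clnbrs oW wW wo.
Qed.

Definition owned w : {set 'I_n} := [set x in clnbrs e w | (x != v) && (owner x == w)]%SET.

Definition ball_link : set {set 'I_n} :=
  [set s : {set 'I_n} | exists2 w, w \in W & s \subset (clnbrs e w :\ v)%SET].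

Definition pair_link : set {set 'I_n} :=
  [set s : {set 'I_n} | s \subset W /\ (#|s| <= 2)%N].

Definition star_link : set {set 'I_n} :=
  [set s : {set 'I_n} | s \subset W /\ (#|s :\ w0| <= 1)%N].

Definition owner_link : set {set 'I_n} :=
  [set s : {set 'I_n} | exists2 w, w \in W & s \subset owned w].

Definition full_link : set {set 'I_n} := ball_link `|` pair_link.

Definition tree_link : set {set 'I_n} := star_link `|` owner_link.

Definition nbr_loops : {set {set 'I_n}} :=
  [set p : {set 'I_n} | p \subset (W :\ w0)%SET & #|p| == 2%N]%SET.

Definition owner_loops : {set {set 'I_n}} :=
  [set p : {set 'I_n} | [exists w, exists x, [&& w \in W, x \in clnbrs e w :\ v, owner x != w &
     p == [set x; w]]]]%SET.

Definition graph_link : set {set 'I_n} :=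
  tree_link `|` [set p : {set 'I_n} | p \in nbr_loops :|: owner_loops].

Lemma owner_loopsP p : reflect
  (exists w x, [/\ w \in W, x != v, e w x, owner x != w & p = [set x; w]%SET])
  (p \in owner_loops).
Proof.
rewrite inE; apply: (iffP existsP) => [[w /existsP[x /and4P[wW]]]|[w [x]]].
  rewrite 2!inE in_clnbrs => /andP[xv /predU1P[xw|wx] ox /eqP pE].
    by rewrite xw owner_nbr ?eqxx in ox.
  by exists w, x.
move=> [wW xv wx ox pE]; exists w; apply/existsP; exists x.
by rewrite wW 2!inE in_clnbrs xv wx orbT ox pE eqxx.
Qed.

Lemma ball_link_hereditary : hereditary ball_link.
Proof. by move=> s t [w wW sw] ts; exists w => //; exact: fintype.subset_trans sw. Qed.

Lemma pair_link_hereditary : hereditary pair_link.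
Proof.
move=> s t [sW s2] ts; split; first exact: fintype.subset_trans sW.
exact: leq_trans (subset_leq_card ts) s2.
Qed.

Lemma star_link_hereditary : hereditary star_link.
Proof.
move=> s t [sW s1] ts; split; first exact: fintype.subset_trans sW.
exact: leq_trans (subset_leq_card (finset.setSD _ ts)) s1.
Qed.

Lemma owner_link_hereditary : hereditary owner_link.
Proof. by move=> s t [w wW sw] ts; exists w => //; exact: fintype.subset_trans sw. Qed.

Lemma full_link_hereditary : hereditary full_link.
Proof. exact: hereditaryU ball_link_hereditary pair_link_hereditary. Qed.

Lemma tree_link_hereditary : hereditary tree_link.
Proof. exact: hereditaryU star_link_hereditary owner_link_hereditary. Qed.

Lemma small_full_link s : full_link s -> (#|s| <= 1)%N -> tree_link s.
Proof.
move=> Ls s1; have [|[sW _]] := Ls; last first.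
  by left; split=> //; exact: leq_trans (subset_leq_card (finset.subD1set _ _)) s1.
have [->|] := eqVneq s finset.set0.
  by left; split; [exact: finset.sub0set|rewrite finset.set0D cards0].
rewrite -card_gt0 => s0 [w wW sw]; right.
have /cards1P[x sE] : #|s| == 1%N by rewrite eqn_leq s1.
move: sw; rewrite sE finset.sub1set 2!inE => /andP[xv xw].
have [oW xo] := ownerP wW xw; exists (owner x) => //.
by rewrite finset.sub1set inE xo xv eqxx.
Qed.

Lemma tree_link_full : tree_link `<=` full_link.
Proof.
move=> s [[sW s1]|[w wW sw]]; [right|left].
  by split=> //; rewrite (cardsD1 w0); exact: leq_add (leq_b1 _) s1.
exists w => //; apply: fintype.subset_trans sw _.
by apply/fintype.subsetP => x; rewrite !inE => /and3P[-> ->].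
Qed.

Lemma graph_link_full : graph_link `<=` full_link.
Proof.
move=> s [/tree_link_full//|] /=; rewrite finset.in_setU => /orP[|/owner_loopsP].
  rewrite inE => /andP[/finset.subsetD1P[sW _] /eqP s2].
  by right; split; rewrite ?s2.
move=> [w [x [wW xv wx _ ->]]]; left; exists w => //.
by rewrite finset.subUset !finset.sub1set !inE xv wx (nbr_neq wW) eqxx orbT.
Qed.

Lemma loop_card p : p \in (nbr_loops :|: owner_loops)%SET -> #|p| = 2%N.
Proof.
rewrite finset.in_setU => /orP[|/owner_loopsP]; first by rewrite inE => /andP[_ /eqP].
move=> [w [x [wW _ wx ox ->]]]; rewrite cards2 (_ : x != w) //.
by apply: contraNneq ox => ->; rewrite owner_nbr.
Qed.

Lemma graph_link_hereditary : hereditary graph_link.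
Proof.
move=> s t [Ls|/= ls] ts; first by left; exact: tree_link_hereditary Ls ts.
have [->|tns] := eqVneq t s; [by right|left].
apply: small_full_link.
  by apply: full_link_hereditary ts; apply: graph_link_full; right.
have /proper_card : t \proper s by rewrite finset.properEneq tns.
by rewrite (loop_card ls) ltnS.
Qed.

Lemma full_link_del s : full_link s -> s != finset.set0 -> K0 s.
Proof.
move=> [[w wW sw]|[sW s2]] s0; split=> //; first by exists w; [exact: nbr_neq|].
have [s1|] := leqP #|s| 1.
  have /cards1P[x sE] : #|s| == 1%N by rewrite eqn_leq s1 card_gt0.
  move: sW; rewrite sE finset.sub1set => xW; exists x; first exact: nbr_neq.
  by rewrite finset.sub1set !inE nbr_neq ?eqxx.
move=> s2'; have /cards2P[w [w' [ww' sE]]] : #|s| == 2%N by rewrite eqn_leq s2.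
move: sW; rewrite sE finset.subUset !finset.sub1set => /andP[wW w'W].
have [x [xv wx w'x _]] := common_nbr wW w'W ww'; exists x => //.
by rewrite finset.subUset !finset.sub1set !inE !nbr_neq // !(e_sym x) wx w'x !orbT.
Qed.

Local Notation cone L := (cone_adj K0 v L).

Lemma cone_complex (L : set {set 'I_n}) : hereditary L -> L `<=` full_link ->
  is_complex (cone L).
Proof.
move=> hL LF; apply: cone_adj_complex => //; first exact: nbhd_complex_del_complex.
by move=> s /LF; exact: full_link_del.
Qed.

Lemma cone_collapse (L L' : set {set 'I_n}) (a : {set 'I_n} -> 'I_n) :
  hereditary L -> hereditary L' -> L' `<=` L -> L `<=` full_link ->
  (forall s, L s -> ~ L' s -> L (a s |: s)%SET /\ ~ L' (s :\ a s)%SET) ->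
  (forall s t, L s -> ~ L' t -> t \subset s -> a t = a s) ->
  retract_equiv R (cone L) (cone L').
Proof.
move=> hL hL' L'L LF; apply: cone_matching_collapse => //.
- exact: nbhd_complex_del_complex.
- by move=> s; exact: nbhd_complex_delP.
- by move=> s /LF; exact: full_link_del.
Qed.

Lemma nbrs_meet_clnbrs_card c : c != v -> (#|W :&: clnbrs e c| <= 2)%N.
Proof.
move=> cv; have [cW|cW] := boolP (c \in W).
  apply: (@leq_trans #|[set c]%SET|); last by rewrite cards1.
  apply: subset_leq_card; apply/fintype.subsetP => x; rewrite finset.in_setI finset.in_set1.
  by move=> /andP[xW /(nbrs_meet_clnbrs cW xW) ->].
rewrite (_ : W :&: clnbrs e c = W :&: nbrs e c)%SET; first exact: nbrs_meet.
apply/setP => x; rewrite !finset.in_setI finset.in_setU1.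
by have [->|//] := eqVneq x c; rewrite (negbTE cW).
Qed.

Lemma nbhd_complex_collapse_full : retract_equiv R (nbhd_complex e) (cone full_link).
Proof.
have cN := nbhd_complex_complex e.
have empty_full : full_link finset.set0.
  by right; split; [exact: finset.sub0set|rewrite cards0].
apply: (@matching_collapse _ _ _ _ (fun=> v)) => //.
- exact: cone_complex full_link_hereditary _.
- move=> s [/nbhd_complex_del_sub//|[vs Ls]]; split; first by apply/finset.set0Pn; exists v.
  have [[w wW /fintype.subsetP sw]|[/fintype.subsetP sW _]] := Ls; [exists w|exists v].
    apply/fintype.subsetP => x xs; have [->|xv] := eqVneq x v.
      by rewrite finset.in_setU1 nbr_in_nbr ?orbT.
    by have : x \in (s :\ v)%SET by [rewrite !inE xv]; move=> /sw; rewrite inE => /andP[].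
  apply/fintype.subsetP => x xs; have [->|xv] := eqVneq x v; first exact: finset.setU11.
  by rewrite finset.in_setU sW ?orbT // !inE xv.
- move=> s Ns nFs.
  have sv : s \subset clnbrs e v.
    have [s0 [c sc]] := Ns; have [<- //|cv] := eqVneq c v; case: nFs.
    have sc' : (s :\ v)%SET \subset (clnbrs e c :\ v)%SET by exact: finset.setSD.
    have [vs|vs] := boolP (v \in s); last first.
      by left; split=> //; exists c => //; rewrite -[s](setD1_id vs).
    right; split=> //; left; exists c => //.
    by move/fintype.subsetP: sc => /(_ v vs); rewrite !inE e_sym eq_sym (negbTE cv).
  split.
  + by right; split; [rewrite finset.in_set1|rewrite finset.setDv].
  + split; first by apply/finset.set0Pn; exists v; rewrite finset.setU11.
    by exists v; rewrite finset.subUset sv finset.sub1set finset.setU11.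
  + move=> [K0sv|[]]; last by rewrite !inE eqxx.
    have [sv0 [c cv sc]] := K0sv; apply: nFs.
    have [vs|vs] := boolP (v \in s); last by left; rewrite -(setD1_id vs).
    right; split=> //; right; have sW : (s :\ v)%SET \subset W by rewrite finset.subDset.
    split=> //; apply: leq_trans (nbrs_meet_clnbrs_card cv); apply: subset_leq_card.
    by rewrite finset.subsetI sW (fintype.subset_trans sc) ?finset.subD1set.
Qed.

Lemma pair_link_graph s : pair_link s -> graph_link s.
Proof.
move=> [sW s2]; have [s1|s1] := leqP #|s :\ w0| 1; first by left; left.
have w0s : w0 \notin s.
  by apply: contraL s1 => w0s; move: s2; rewrite (cardsD1 w0) w0s add1n ltnS -leqNgt.
rewrite setD1_id // in s1; right=> /=; rewrite finset.in_setU inE.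
by rewrite finset.subsetD1 sW w0s eqn_leq s2 s1.
Qed.

(* A simplex of the ball around [w] that is not in [graph_link] has two vertices
   besides [w], so no other ball contains it. *)
Lemma ball_link_thick w s : w \in W -> s \subset (clnbrs e w :\ v)%SET ->
  ~ graph_link s -> exists x y, [/\ x \in (s :\ w)%SET, y \in (s :\ w)%SET, x != y &
    owner x != w].
Proof.
move=> wW sw nGs; have [x xs xo] : exists2 x, x \in s & x \notin owned w.
  by apply/subsetPn/negP => so; apply: nGs; left; right; exists w.
have /setD1P[xv xw] := fintype.subsetP sw x xs.
rewrite inE xw xv /= in xo.
have xnw : x != w by apply: contraNneq xo => ->; rewrite owner_nbr.
have [y ys] : exists2 y, y \in s & y \notin [set x; w]%SET.
  apply/subsetPn/negP => sxw; apply: nGs; apply: graph_link_hereditary sxw.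
  right=> /=; rewrite finset.in_setU; apply/orP; right; apply/owner_loopsP.
  by exists w, x; move: xw; rewrite in_clnbrs (negbTE xnw).
rewrite !inE negb_or => /andP[yx yw]; exists x, y.
by rewrite !inE xs ys xnw yw eq_sym yx.
Qed.

Lemma ball_uniq w w' x y : w \in W -> w' \in W -> x != w -> y != w -> x != y ->
  x != v -> y != v -> x \in clnbrs e w -> y \in clnbrs e w ->
  x \in clnbrs e w' -> y \in clnbrs e w' -> w = w'.
Proof.
move=> wW w'W xw yw xy xv yv xB yB xB' yB'; apply: contraTeq xy => ww'.
have adj z : z != w -> z \in clnbrs e w -> z \in clnbrs e w' -> e w z /\ e w' z.
  rewrite !in_clnbrs => /negbTE -> /= wz /predU1P[zw'|//].
  by move: wz; rewrite zw' (negbTE (nbrs_independent wW w'W)).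
have [u [_ _ _ uE]] := common_nbr wW w'W ww'.
have [wx w'x] := adj x xw xB xB'; have [wy w'y] := adj y yw yB yB'.
by rewrite negbK (uE x) // (uE y).
Qed.

Definition ball_center s : 'I_n :=
  odflt v [pick w | (w \in W) && (s \subset (clnbrs e w :\ v)%SET)].

Lemma ball_centerE w s : w \in W -> s \subset (clnbrs e w :\ v)%SET ->
  ~ graph_link s -> ball_center s = w.
Proof.
move=> wW sw nGs; rewrite /ball_center.
case: pickP => [w' /andP[w'W sw']|/(_ w)] /=; last first.
  by rewrite wW sw.
have [x [y [/setD1P[xw xs] /setD1P[yw ys] xy _]]] := ball_link_thick wW sw nGs.
have /setD1P[xv xB] := fintype.subsetP sw x xs.
have /setD1P[yv yB] := fintype.subsetP sw y ys.
have /setD1P[_ xB'] := fintype.subsetP sw' x xs.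
have /setD1P[_ yB'] := fintype.subsetP sw' y ys.
by rewrite (ball_uniq wW w'W xw yw xy).
Qed.

Lemma full_collapse_graph : retract_equiv R (cone full_link) (cone graph_link).
Proof.
have ball s : full_link s -> ~ graph_link s ->
    exists2 w, w \in W & s \subset (clnbrs e w :\ v)%SET.
  by move=> [//|/pair_link_graph].
apply: (cone_collapse full_link_hereditary graph_link_hereditary graph_link_full
  (a := ball_center)) => // [s Fs nGs|s t Fs nGt ts].
  have [w wW sw] := ball s Fs nGs; rewrite (ball_centerE wW sw nGs).
  split.
    left; exists w => //; rewrite finset.subUset sw andbT finset.sub1set !inE eqxx.
    by rewrite nbr_neq.
  have [x [y [xs ys xy ox]]] := ball_link_thick wW sw nGs.
  have in_ball z : z \in (s :\ w)%SET -> [/\ z != w, z != v & z \in clnbrs e w].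
    by move=> /setD1P[zw /(fintype.subsetP sw)/setD1P[zv zB]].
  have [xw xv xB] := in_ball x xs; have [yw yv yB] := in_ball y ys.
  have not_nbrs p : p \subset W -> x \in p -> False.
    by move=> /fintype.subsetP pW /pW xW; move: xw;
      rewrite (nbrs_meet_clnbrs wW xW xB) eqxx.
  case=> [[[sW _]|[w' w'W /fintype.subsetP so]]|/=]; first exact: not_nbrs sW xs.
    have /setIdP[xB' /andP[_ /eqP xo]] := so x xs; have /setIdP[yB' _] := so y ys.
    by move: ox; rewrite xo (ball_uniq wW w'W xw yw xy xv yv xB yB xB' yB') eqxx.
  rewrite finset.in_setU => /orP[|/owner_loopsP[w' [x' [w'W _ _ _ sE]]]].
    by rewrite inE => /andP[/finset.subsetD1P[sW _] _]; exact: not_nbrs sW xs.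
  have /in_ball[w'w _ w'B] : w' \in (s :\ w)%SET by rewrite sE !inE eqxx orbT.
  by move: w'w; rewrite (nbrs_meet_clnbrs wW w'W w'B) eqxx.
have nGs : ~ graph_link s by move=> Gs; apply: nGt; exact: graph_link_hereditary Gs ts.
have [w wW sw] := ball s Fs nGs.
by rewrite (ball_centerE wW sw) // (ball_centerE wW) // (fintype.subset_trans ts).
Qed.

Definition owner_of s : 'I_n := odflt v [pick w | (w \in W) && (s \subset owned w)].

Lemma owner_ofE w s : w \in W -> s \subset owned w -> s != finset.set0 -> owner_of s = w.
Proof.
move=> wW sw /finset.set0Pn[x xs]; rewrite /owner_of.
case: pickP => [w' /andP[w'W sw']|/(_ w)] /=; last by rewrite wW sw.
have /setIdP[_ /andP[_ /eqP <-]] := fintype.subsetP sw x xs.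
by have /setIdP[_ /andP[_ /eqP <-]] := fintype.subsetP sw' x xs.
Qed.

Lemma tree_collapse_star : retract_equiv R (cone tree_link) (cone star_link).
Proof.
have empty_star : star_link finset.set0.
  by split; [exact: finset.sub0set|rewrite finset.set0D cards0].
have thin s : tree_link s -> ~ star_link s ->
    s != finset.set0 /\ exists2 w, w \in W & s \subset owned w.
  move=> [//|os] nSs; split=> //.
  by apply: contra_notN nSs => /eqP ->.
apply: (cone_collapse tree_link_hereditary star_link_hereditary _ tree_link_full
  (a := owner_of)) => // [s Ss|s Ts nSs|s t Ts nSt ts]; first by left.
  have [s0 [w wW sw]] := thin s Ts nSs; rewrite (owner_ofE wW sw s0); split.
    right; exists w => //; rewrite finset.subUset sw andbT finset.sub1set !inE eqxx.
    by rewrite nbr_neq // owner_nbr ?eqxx.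
  move=> [/fintype.subsetP sW _]; apply: nSs.
  have sw1 : s \subset [set w]%SET.
    apply/fintype.subsetP => x xs; rewrite inE; apply/negPn/negP => xw.
    have xW : x \in W by apply: sW; rewrite !inE xw.
    have := fintype.subsetP sw x xs; rewrite inE => /andP[xB _].
    by move: xw; rewrite (nbrs_meet_clnbrs wW xW xB) eqxx.
  apply: star_link_hereditary sw1; split; first by rewrite finset.sub1set.
  by rewrite (leq_trans (subset_leq_card (finset.subD1set _ _))) ?cards1.
have [s0 [w wW sw]] := thin s Ts (fun Ss => nSt (star_link_hereditary Ss ts)).
have t0 : t != finset.set0 by apply: contra_notN nSt => /eqP ->.
by rewrite (owner_ofE wW sw) // (owner_ofE wW (fintype.subset_trans ts sw)).
Qed.

Lemma star_collapse_del : retract_equiv R (cone star_link) K0.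
Proof.
have del0 : K0 = cone set0 by apply/seteqP; split=> s; [left|case=> // -[]].
rewrite [X in retract_equiv _ _ X]del0.
apply: (cone_collapse star_link_hereditary _ _ _ (a := fun=> w0)) => //.
  by move=> s Ss; apply: tree_link_full; left.
move=> s [sW s1] _; split=> //; split.
  by rewrite finset.subUset sW finset.sub1set w0W.
by rewrite finset.setDUl finset.setDv finset.set0U.
Qed.

Lemma nbhd_complex_collapse_graph : retract_equiv R (nbhd_complex e) (cone graph_link).
Proof. exact: retract_equiv_trans nbhd_complex_collapse_full full_collapse_graph. Qed.

Lemma tree_collapse_del : retract_equiv R (cone tree_link) K0.
Proof. exact: retract_equiv_trans tree_collapse_star star_collapse_del. Qed.

Local Notation loops := (nbr_loops :|: owner_loops)%SET.

Definition loop_triangles : {set {set 'I_n}} := [set (v |: p)%SET | p in loops]%SET.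

Lemma tree_cone_complex : is_complex (cone tree_link).
Proof. exact: cone_complex tree_link_hereditary tree_link_full. Qed.

Lemma loop_full p : p \in loops -> full_link p.
Proof. by move=> lp; apply: graph_link_full; right. Qed.

Lemma full_link_notin s : full_link s -> v \notin s.
Proof.
have [->|s0 Fs] := eqVneq s finset.set0; first by rewrite inE.
exact: nbhd_complex_delP (full_link_del Fs s0).
Qed.

Lemma loop_not_tree p : p \in loops -> ~ tree_link p.
Proof.
rewrite finset.in_setU => /orP[|/owner_loopsP[w [x [wW _ wx ox ->]]]].
  rewrite inE => /andP[/finset.subsetD1P[pW w0p] p2] [[_]|[w wW po]].
    by rewrite setD1_id // (eqP p2).
  have in_w x : x \in p -> x = w.
    move=> xp; have /setIdP[xB _] := fintype.subsetP po x xp.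
    exact: nbrs_meet_clnbrs wW (fintype.subsetP pW x xp) xB.
  have /cards2P[x [y [xy pE]]] := p2.
  have xw : x = w by apply: in_w; rewrite pE !inE eqxx.
  have yw : y = w by apply: in_w; rewrite pE !inE eqxx orbT.
  by rewrite xw yw eqxx in xy.
case=> [[/fintype.subsetP xwW _]|[w' _ /fintype.subsetP xwo]].
  have xW : x \in W by apply: xwW; rewrite !inE eqxx.
  by move: wx; rewrite (negbTE (nbrs_independent wW xW)).
have /setIdP[_ /andP[_ /eqP wo]] : w \in owned w' by apply: xwo; rewrite !inE eqxx orbT.
have /setIdP[_ /andP[_ /eqP xo]] : x \in owned w' by apply: xwo; rewrite !inE eqxx.
by rewrite xo -wo owner_nbr ?eqxx in ox.
Qed.

Lemma graph_coneE s : cone graph_link s <-> cone tree_link s \/ s \in loop_triangles.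
Proof.
split=> [[K0s|[vs [Ts|ls]]]|[|/imsetP[p lp ->]]].
- by left; left.
- by left; right.
- by right; apply/imsetP; exists (s :\ v)%SET; rewrite // finset.setD1K.
- by apply: cone_adjS => t; left.
- right; split; first exact: finset.setU11.
  by rewrite setU1K ?(full_link_notin (loop_full lp)) //; right.
Qed.

Lemma loop_triangle_card s : s \in loop_triangles -> #|s| = 3%N.
Proof.
move=> /imsetP[p lp ->]; rewrite cardsU1 (full_link_notin (loop_full lp)).
by rewrite (loop_card lp).
Qed.

Lemma loop_triangle_new s : s \in loop_triangles -> ~ cone tree_link s.
Proof.
move=> /imsetP[p lp ->]; have vp := full_link_notin (loop_full lp).
move=> [/nbhd_complex_delP|[_]]; first by rewrite finset.setU11.
by rewrite setU1K //; exact: loop_not_tree.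
Qed.

Lemma loop_triangle_face s t : s \in loop_triangles -> t \proper s ->
  t != finset.set0 -> cone tree_link t.
Proof.
move=> Ts ts t0; have /proper_card := ts; rewrite (loop_triangle_card Ts) => t3.
have /imsetP[p lp sE] := Ts.
have tp : (t :\ v)%SET \subset p by rewrite finset.subDset -sE proper_sub.
have Ft := full_link_hereditary (loop_full lp) tp.
have [vt|vt] := boolP (v \in t).
  right; split=> //; apply: small_full_link => //.
  by move: t3; rewrite (cardsD1 v) vt.
by left; rewrite -(setD1_id vt); apply: full_link_del => //; rewrite setD1_id.
Qed.

Hypothesis nbrs_cube : forall s, s \subset W -> #|s| = 3%N ->
  exists2 t, t != v & forall w, w \in s ->
    exists2 u, u != v & (t |: s :\ w)%SET \subset nbrs e u.

Lemma nbrs_triple_null s : s \subset W -> #|s| = 3%N -> boundary_null R (cone tree_link) s.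
Proof.
move=> sW s3; have [t tv opposite] := nbrs_cube sW s3.
have s0 : s != finset.set0 by rewrite -card_gt0 s3.
apply: (@boundary_null_cone _ _ _ _ t) => // [|w ws].
  apply/negP => ts; have [u uv] := opposite t ts; rewrite finset.setD1K // => su.
  have /subset_leq_card : s \subset (W :&: nbrs e u)%SET by rewrite finset.subsetI sW.
  by rewrite s3 leqNgt ltnS nbrs_meet.
have tsw : (t |: s :\ w)%SET != finset.set0.
  by apply/finset.set0Pn; exists t; rewrite finset.setU11.
have [u uv tsu] := opposite w ws; apply: simplex_boundary_null => //; left; split=> //.
exists u => //; rewrite finset.subsetD1 (fintype.subset_trans tsu) ?finset.subsetUr //=.
rewrite !inE negb_or eq_sym tv negb_and; apply/orP; right.
exact: sub_nbrs_notin.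
Qed.

Lemma pair_triangle_null p : p \subset W -> #|p| = 2%N ->
  boundary_null R (cone tree_link) (v |: p)%SET.
Proof.
move=> pW p2.
have vp := sub_nbrs_notin pW.
have star_null (q : {set 'I_n}) : q \subset W -> (#|q :\ w0| <= 1)%N ->
    boundary_null R (cone tree_link) (v |: q)%SET.
  move=> qW q1; have vq := sub_nbrs_notin qW.
  apply: simplex_boundary_null.
    by apply/finset.set0Pn; exists v; rewrite finset.setU11.
  by right; split; [rewrite finset.setU11|rewrite setU1K //; left].
have [w0p|w0p] := boolP (w0 \in p).
  by apply: star_null => //; move: p2; rewrite (cardsD1 w0 p) w0p add1n => -[->].
apply: (@boundary_null_cone _ _ _ _ w0).
- by rewrite finset.in_setU1 negb_or (negbTE w0p) andbT nbr_neq.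
- by apply/finset.set0Pn; exists v; rewrite finset.setU11.
move=> i; rewrite finset.in_setU1 => /predU1P[->|ip].
  rewrite setU1K //; apply: nbrs_triple_null.
    by rewrite finset.subUset finset.sub1set w0W.
  by rewrite cardsU1 w0p p2.
have -> : (w0 |: (v |: p) :\ i = v |: (w0 |: p :\ i))%SET.
  have vi : v != i by apply: contraNneq vp => ->.
  apply/setP => y; rewrite !inE; case: (eqVneq y v) => [->|_] //=.
  by rewrite vi orbT.
apply: star_null.
  by rewrite finset.subUset finset.sub1set w0W (fintype.subset_trans _ pW) ?finset.subD1set.
rewrite setU1K; last by rewrite !inE negb_and w0p orbT.
by move: p2; rewrite (cardsD1 i p) ip add1n => -[->].
Qed.

Lemma loop_triangle_null s : s \in loop_triangles -> boundary_null R (cone tree_link) s.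
Proof.
move=> /imsetP[p lp ->]; have lp' := lp; move: lp; rewrite finset.in_setU => /orP[|].
  rewrite inE => /andP[/finset.subsetD1P[pW _] /eqP p2]; exact: pair_triangle_null.
move=> /owner_loopsP[w [x [wW xv wx ox pE]]].
have [oW xo] : owner x \in W /\ x \in clnbrs e (owner x).
  by apply: (ownerP wW); rewrite in_clnbrs wx orbT.
have xW : x \notin W by apply: contraL wx; exact: nbrs_independent.
have ex : x != owner x by apply: contraNneq xW => ->.
have eox : e (owner x) x by move: xo; rewrite in_clnbrs (negbTE ex).
have xw : x != w by apply: contraNneq xW => ->.
set o := owner x in ox oW xo ex eox *.
have [ov wv] := (nbr_neq oW, nbr_neq wW).
rewrite {p}pE in lp' *; have vp := full_link_notin (loop_full lp').
apply: (@boundary_null_cone _ _ _ _ o).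
- by rewrite !inE !negb_or ov eq_sym ex.
- by apply/finset.set0Pn; exists v; rewrite finset.setU11.
move=> i; rewrite !inE => /or3P[] /eqP->.
- rewrite setU1K //; apply: simplex_boundary_null.
    by apply/finset.set0Pn; exists o; rewrite finset.setU11.
  left; split; first by apply/finset.set0Pn; exists o; rewrite finset.setU11.
  exists x => //; apply/fintype.subsetP => y; rewrite !inE !(e_sym x).
  by move=> /or3P[] /eqP->; rewrite ?ov ?xv ?wv ?eox ?wx ?eqxx ?orbT.
- have -> : (o |: (v |: [set x; w]) :\ x = v |: [set o; w])%SET.
    apply/setP => y; rewrite !inE; have [->|_] := eqVneq y x.
      by rewrite (negbTE ex) (negbTE xv) (negbTE xw).
    by rewrite /= orbCA.
  by apply: pair_triangle_null; rewrite ?finset.subUset ?finset.sub1set ?oW // cards2 ox.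
- have -> : (o |: (v |: [set x; w]) :\ w = v |: [set o; x])%SET.
    apply/setP => y; rewrite !inE; have [->|_] := eqVneq y w.
      by rewrite eq_sym (negbTE ox) (negbTE wv) eq_sym (negbTE xw).
    by rewrite /= orbF orbCA.
  apply: simplex_boundary_null.
    by apply/finset.set0Pn; exists v; rewrite finset.setU11.
  right; split; first exact: finset.setU11.
  rewrite setU1K; last by rewrite !inE negb_or !(eq_sym v) ov xv.
  right; exists o => //; rewrite finset.subUset !finset.sub1set !inE ov xv eox.
  by rewrite owner_nbr ?eqxx ?orbT.
Qed.

Hypothesis e_connected : forall x y, connect e x y.

Lemma tree_cone_connected (a b : space R (cone tree_link)) : joined R a b.
Proof.
have star_cone s : v \in s -> (s :\ v)%SET \subset W -> (#|s :\ v| <= 1)%N ->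
    cone tree_link s.
  move=> vs sW s1; right; split=> //; left; split=> //.
  exact: leq_trans (subset_leq_card (finset.subD1set _ _)) s1.
apply: (complex_connected tree_cone_complex e_connected) => [x|x y xy].
  have [->|xv] := eqVneq x v.
    by apply: star_cone; rewrite ?finset.in_set1 ?finset.setDv ?finset.sub0set ?cards0.
  left; split; first by apply/finset.set0Pn; exists x; rewrite inE.
  by exists x => //; rewrite finset.sub1set !inE xv eqxx.
have edge w : w \in W -> cone tree_link [set v; w]%SET.
  move=> wW; have wv : v != w by rewrite eq_sym nbr_neq.
  apply: star_cone; first by rewrite !inE eqxx.
    by rewrite setU1K ?inE // finset.sub1set.
  by rewrite setU1K ?inE // cards1.
have [xv|xv] := eqVneq x v; first by rewrite xv; apply: edge; rewrite inE -xv.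
have [yv|yv] := eqVneq y v.
  by rewrite yv finset.setUC; apply: edge; rewrite inE e_sym -yv.
left; split; first by apply/finset.set0Pn; exists x; rewrite !inE eqxx.
exists x => //; rewrite finset.subUset !finset.sub1set !inE xv yv eqxx xy.
by rewrite orbT.
Qed.

Definition crossing p : 'I_n := odflt v [pick x | (x != v) && (p \subset nbrs e x)].

Lemma crossingP p : p \subset W -> #|p| = 2%N ->
  crossing p != v /\ (W :&: nbrs e (crossing p))%SET = p.
Proof.
move=> pW p2; have /eqP/cards2P[w [w' [ww' pE]]] := p2.
have [wW w'W] : w \in W /\ w' \in W.
  by split; apply: (fintype.subsetP pW); rewrite pE !inE eqxx ?orbT.
have [x [xv wx w'x _]] := common_nbr wW w'W ww'.
rewrite /crossing; case: pickP => [y /andP[yv py]|/(_ x)] /=; last first.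
  by rewrite xv pE finset.subUset !finset.sub1set !inE !(e_sym x) wx w'x.
split=> //; apply/eqP; rewrite eq_sym eqEcard finset.subsetI pW py p2.
exact: nbrs_meet.
Qed.

Lemma crossingE x w w' : w \in W -> w' \in W -> w != w' -> x != v -> e w x -> e w' x ->
  crossing [set w; w']%SET = x.
Proof.
move=> wW w'W ww' xv wx w'x; have [u [_ _ _ uE]] := common_nbr wW w'W ww'.
have pW : [set w; w']%SET \subset W by rewrite finset.subUset !finset.sub1set wW.
have p2 : #|[set w; w']%SET| = 2%N by rewrite cards2 ww'.
have [cv cE] := crossingP pW p2.
have adj y : y \in [set w; w']%SET -> e y (crossing [set w; w']%SET).
  by rewrite -{1}cE finset.in_setI e_sym => /andP[_]; rewrite inE.
by rewrite (uE x) // [LHS]uE // adj // !inE eqxx ?orbT.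
Qed.

Lemma crossing_notin p : p \subset W -> #|p| = 2%N -> crossing p \notin W.
Proof.
move=> pW p2; have [_ cE] := crossingP pW p2.
have [w wp] : exists w, w \in p by apply/finset.set0Pn; rewrite -card_gt0 p2.
move: (wp); rewrite -{1}cE finset.in_setI => /andP[wW]; rewrite inE.
by apply: contraL => cW; exact: nbrs_independent.
Qed.

Lemma owner_crossing p : p \subset W -> #|p| = 2%N -> owner (crossing p) \in p.
Proof.
move=> pW p2; have [cv cE] := crossingP pW p2; have cW := crossing_notin pW p2.
have [w wp] : exists w, w \in p by apply/finset.set0Pn; rewrite -card_gt0 p2.
move: (wp); rewrite -{1}cE finset.in_setI => /andP[wW]; rewrite inE e_sym => wc.
have [oW] : owner (crossing p) \in W /\ crossing p \in clnbrs e (owner (crossing p)).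
  by apply: (ownerP wW); rewrite in_clnbrs wc orbT.
rewrite in_clnbrs => /predU1P[co|oc]; first by rewrite co oW in cW.
by rewrite -{2}cE finset.in_setI oW inE e_sym.
Qed.

Let pair_loop p : {set 'I_n} := (crossing p |: p :\ owner (crossing p))%SET.

Let pairs_of_nbrs : {set {set 'I_n}} :=
  [set p : {set 'I_n} | p \subset W & #|p| == 2%N]%SET.

Lemma owner_loopsE : owner_loops = [set pair_loop p | p in pairs_of_nbrs]%SET.
Proof.
apply/setP => q; apply/owner_loopsP/imsetP => [[w [x [wW xv wx ox ->]]]|[p]].
  have [oW] : owner x \in W /\ x \in clnbrs e (owner x).
    by apply: (ownerP wW); rewrite in_clnbrs wx orbT.
  rewrite in_clnbrs => /predU1P[xo|eo].
    by move: wx; rewrite xo (negbTE (nbrs_independent wW oW)).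
  exists [set owner x; w]%SET.
    by rewrite inE finset.subUset !finset.sub1set oW wW cards2 ox.
  by rewrite /pair_loop (crossingE oW wW ox xv eo wx) setU1K // inE.
rewrite inE => /andP[pW /eqP p2] ->.
have [cv cE] := crossingP pW p2; have op := owner_crossing pW p2.
have /cards1P[w pw] : #|p :\ owner (crossing p)| == 1%N.
  by move: p2; rewrite (cardsD1 (owner (crossing p))) op add1n => -[->].
have : w \in (p :\ owner (crossing p))%SET by rewrite pw inE.
move=> /setD1P[wo]; rewrite -{1}cE finset.in_setI => /andP[wW wc].
exists w, (crossing p); split=> //; first by rewrite inE e_sym in wc.
  by rewrite eq_sym.
by rewrite /pair_loop pw.
Qed.

Lemma pair_loop_inj : {in pairs_of_nbrs &, injective pair_loop}.
Proof.
move=> p q; rewrite !inE => /andP[pW /eqP p2] /andP[qW /eqP q2] pq.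
have [[_ pE] [_ qE]] := (crossingP pW p2, crossingP qW q2).
rewrite -pE -qE; suff -> : crossing p = crossing q by [].
have : crossing p \in pair_loop q by rewrite -pq finset.setU11.
rewrite finset.in_setU1 => /predU1P[//|/setD1P[_ /(fintype.subsetP qW)]].
by rewrite (negbTE (crossing_notin pW p2)).
Qed.

Lemma loops_disjoint : nbr_loops :&: owner_loops = finset.set0.
Proof.
apply/setP => p; rewrite finset.in_setI finset.in_set0; apply/negP => /andP[].
rewrite inE => /andP[/finset.subsetD1P[pW _] _] /owner_loopsP[w [x [wW _ wx _ pE]]].
have xW : x \in W by apply: (fintype.subsetP pW); rewrite pE !inE eqxx.
by move: wx; rewrite (negbTE (nbrs_independent wW xW)).
Qed.

Lemma card_loop_triangles : #|loop_triangles| = ((#|W| - 1) ^ 2)%N.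
Proof.
rewrite card_in_imset => [|p q lp lq pq]; last first.
  rewrite -(setU1K (full_link_notin (loop_full lp))) pq.
  by rewrite setU1K ?(full_link_notin (loop_full lq)).
rewrite cardsU loops_disjoint cards0 subn0 owner_loopsE (card_in_imset pair_loop_inj).
rewrite !cards_draws (cardsD1 w0 W) w0W add1n subn1 /=.
set k := #|_|; rewrite binS bin1 -mulnn.
by have := mul_bin_diag k 1; rewrite bin1; case: k => [|k] //=; nia.
Qed.

Lemma nbhd_complex_add_vertex (x : 'rV[R]_n) (xN : x \in realization (nbhd_complex e))
    (xD : x \in @realization R n K0) :
  pointed_equiv R (SigSub xN : space R (nbhd_complex e))
    (@wedge_base R 2 ((#|W| - 1) ^ 2) (space R K0) (SigSub xD) (SigSub xD)).
Proof.
have [_ upper] := nbhd_complex_collapse_graph; have [sub lower] := tree_collapse_del.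
have xT : x \in realization (cone tree_link).
  by move: xD; rewrite !inE; exact: realizationS.
have xG : x \in realization (cone graph_link).
  by move: xT; rewrite !inE; apply/realizationS/cone_adjS => t; left.
apply: (pointed_equiv_trans (upper x xN xG)).
apply: (pointed_equiv_trans _ (wedge_pointed_equiv (@space_hausdorff _ _ _)
  (@space_hausdorff _ _ _) (lower x xT xD))).
rewrite -card_loop_triangles.
apply: attach_simplices_pointed_equiv.
- exact: tree_cone_complex.
- exact: tree_cone_connected.
- exact: graph_coneE.
- exact: loop_triangle_card.
- exact: loop_triangle_new.
- exact: loop_triangle_face.
- exact: loop_triangle_null.
Qed.

End AddVertex.

(** * The Čech complex at scale two *)

Section CechScaleTwo.
Context {R : realType} {n : nat} (e : rel 'I_n).
Implicit Types (a b c u v w : 'I_n) (x y p : 'rV[R]_n) (s t : {set 'I_n}).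
Hypothesis e_sym : symmetric e.
Hypothesis e_irr : irreflexive e.

(* Graph distance to [v], truncated at 2; its affine extension [height v] to the
   realization is 1-Lipschitz along edges. *)
Definition trunc_dist v u : R := if u == v then 0 else if e v u then 1 else 2.

Definition height v x : R := \sum_k x 0 k * trunc_dist v k.

Lemma trunc_dist_edge v a b : e a b -> `|trunc_dist v a - trunc_dist v b| <= 1.
Proof.
move=> ab; rewrite /trunc_dist ler_norml.
have [av|av] := eqVneq a v; have [bv|bv] := eqVneq b v.
- by apply/andP; split; lra.
- by rewrite -av ab; apply/andP; split; lra.
- by rewrite -bv e_sym ab; apply/andP; split; lra.
- by case: (e v a); case: (e v b); apply/andP; split; lra.
Qed.

Lemma trunc_dist_le1 v u : trunc_dist v u <= 1 -> v \in clnbrs e u.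
Proof.
rewrite in_clnbrs /trunc_dist eq_sym e_sym.
by case: eqVneq => //= _; case: (e u v) => //; lra.
Qed.

Lemma trunc_dist_ge1 v u : v != u -> 1 <= trunc_dist v u.
Proof. by rewrite /trunc_dist eq_sym => /negbTE ->; case: (e v u); lra. Qed.

Lemma edge_neq a b : e a b -> a != b.
Proof. by apply: contraTneq => ->; rewrite e_irr. Qed.

Lemma edge_sum a b x (F : 'I_n -> R) : a != b -> geom_simplex [set a; b]%SET x ->
  \sum_k x 0 k * F k = x 0 a * F a + x 0 b * F b.
Proof.
move=> ab [_ _ xs]; rewrite (bigD1 a) //= (bigD1 b) 1?eq_sym //= big1 ?addr0 //.
by move=> k /andP[ka kb]; rewrite xs ?mul0r // !inE negb_or ka.
Qed.

Lemma edge_coord a b x : a != b -> geom_simplex [set a; b]%SET x -> x 0 a + x 0 b = 1.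
Proof.
move=> ab xs; have [_ <- _] := xs; have := edge_sum (fun=> 1) ab xs.
by rewrite !mulr1 => <-; apply: eq_bigr => k _; rewrite mulr1.
Qed.

Lemma coord_le_norm x k : `|x 0 k| <= `|x|.
Proof.
rewrite [leRHS]/Num.Def.normr /= mx_normrE.
by apply/bigmax_geP; right => /=; exists (0, k).
Qed.

Lemma height_edge v x y : same_edge e x y -> height v y - height v x <= `|y - x|.
Proof.
move=> [a [b [ab xs ys]]]; have ne := edge_neq ab.
rewrite /height (edge_sum _ ne xs) (edge_sum _ ne ys).
have x1 := edge_coord ne xs; have y1 := edge_coord ne ys.
have -> : y 0 a * trunc_dist v a + y 0 b * trunc_dist v b -
  (x 0 a * trunc_dist v a + x 0 b * trunc_dist v b) =
  (y - x) 0 a * (trunc_dist v a - trunc_dist v b).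
  have -> : y 0 b = 1 - y 0 a by lra.
  have -> : x 0 b = 1 - x 0 a by lra.
  by rewrite !mxE; ring.
apply: le_trans (ler_norm _) _; rewrite normrM.
apply: le_trans (ler_pM _ _ (coord_le_norm _ _) (trunc_dist_edge v ab)) _ => //.
by rewrite mulr1.
Qed.

Lemma height_path v x y l : edge_path e x y l -> height v y - height v x <= l.
Proof.
elim=> [z|z1 z2 z3 k z12 _ IH]; first by rewrite subrr.
by have := height_edge v z12; lra.
Qed.

Lemma height_delta v u : height v (delta_mx 0 u) = trunc_dist v u.
Proof.
rewrite /height (bigD1 u) //= mxE !eqxx mul1r big1 ?addr0 // => k /negbTE ku.
by rewrite mxE ku andbF mul0r.
Qed.

Lemma ball_height v x : graph_closed_ball e (delta_mx 0 v) 1 x -> height v x <= 1.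
Proof.
move=> [_ d1]; rewrite -lee_fin; apply: le_trans d1.
apply: le_ereal_inf_tmp => _ /= [l lp <-]; rewrite lee_fin.
by have := height_path v lp; rewrite height_delta /trunc_dist eqxx; lra.
Qed.

Lemma graph_complex_clique t u k : graph_complex e t -> u \in t -> k \in t ->
  k \in clnbrs e u.
Proof.
move=> [[a ->]|[a [b [ab ->]]]]; rewrite in_clnbrs !inE.
  by move=> /eqP-> /eqP->; rewrite eqxx.
by move=> /orP[] /eqP-> /orP[] /eqP->; rewrite ?eqxx ?ab 1?e_sym ?ab ?orbT.
Qed.

Lemma height_le1_clnbrs t p u v : graph_complex e t -> geom_simplex t p ->
  0 < p 0 u -> height v p <= 1 -> v \in clnbrs e u.
Proof.
move=> tE [p0 p1 pt] pu hv; apply: trunc_dist_le1; rewrite leNgt; apply/negP => far.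
have ut : u \in t by apply: contraTT pu => /pt ->; rewrite ltxx.
have vt k : k \in t -> v != k.
  move=> kt; apply: contraTneq far => ->; rewrite -leNgt.
  have := graph_complex_clique tE kt ut; rewrite in_clnbrs /trunc_dist.
  by case: eqVneq => [_|_ /= ->]; lra.
have excess : 0 < p 0 u * (trunc_dist v u - 1) by rewrite mulr_gt0 ?subr_gt0.
suff : 1 + p 0 u * (trunc_dist v u - 1) <= height v p by lra.
rewrite /height -[X in X + _]p1 (bigD1 u) //= [leRHS](bigD1 u) //=.
suff : \sum_(k | k != u) p 0 k <= \sum_(k | k != u) p 0 k * trunc_dist v k by lra.
apply: ler_sum => k _; have [kt|/pt ->] := boolP (k \in t); last by rewrite mul0r.
by rewrite ler_peMr ?p0 // trunc_dist_ge1 ?vt.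
Qed.

Lemma cech2_sub_nbhd : cech e (2 : R) `<=` nbhd_complex e.
Proof.
move=> s [s0 [p]]; rewrite divff // => ball; split=> //.
have [z zs] := finset.set0Pn _ s0; have [[t tE pt] _] := ball z zs.
have [p0 p1 _] := pt.
have [u pu] := finset.set0Pn _ (supp_neq0 p1).
exists u; apply/fintype.subsetP => v /ball/ball_height; apply: height_le1_clnbrs tE pt _.
by rewrite inE in pu; rewrite lt_neqAle eq_sym pu p0.
Qed.

Lemma graph_closed_ball_vertex c v : v \in clnbrs e c ->
  graph_closed_ball e (delta_mx 0 v) 1 (delta_mx 0 c : 'rV[R]_n).
Proof.
move=> vc; split.
  exists (finset.set1 c); first by left; exists c.
  by apply: geom_simplex_delta; rewrite inE.
have [->|nvc] := eqVneq v c.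
  apply: (@le_trans _ _ 0%:E); last by rewrite lee_fin.
  by apply: ereal_inf_lbound; exists 0 => //; exact: edge_path_nil.
have cv : e c v by rewrite in_clnbrs (negbTE nvc) in vc.
apply: (@le_trans _ _ (`|delta_mx 0 c - delta_mx 0 v : 'rV[R]_n| + 0)%:E).
  apply: ereal_inf_lbound; exists (`|delta_mx 0 c - delta_mx 0 v : 'rV[R]_n| + 0) => //.
  apply: edge_path_cons (edge_path_nil _ _); exists v, c; split.
  - by rewrite e_sym.
  - by apply: geom_simplex_delta; rewrite !inE eqxx.
  - by apply: geom_simplex_delta; rewrite !inE eqxx orbT.
rewrite lee_fin addr0 [leLHS]/Num.Def.normr /= mx_normrE.
apply: bigmax_le => // -[i k] _ /=; rewrite !mxE (ord1 i) eqxx /= ler_norml.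
by case: (k == c); case: (k == v); rewrite /=; apply/andP; split; lra.
Qed.

Lemma cech2E : cech e (2 : R) = nbhd_complex e.
Proof.
apply/seteqP; split=> [|s [s0 [c /fintype.subsetP sc]]]; first exact: cech2_sub_nbhd.
split=> //; exists (delta_mx 0 c) => v /sc vc.
by rewrite divff //; exact: graph_closed_ball_vertex.
Qed.

End CechScaleTwo.

(** * Binary expansions *)

Section Bits.
Implicit Types a b c p q r k : nat.

Lemma bit0 a : bit a 0 = odd a.
Proof. by rewrite /bit expn0 divn1. Qed.

Lemma bitS a q : bit a q.+1 = bit (a %/ 2) q.
Proof. by rewrite /bit expnS divnMA. Qed.

Lemma bit_inj a b : (forall q, bit a q = bit b q) -> a = b.
Proof.
have [n] := ubnP (a + b); elim: n a b => // n IH a b ab_n ab.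
have ab0 : odd a = odd b by rewrite -!bit0.
have [ab_gt0|] := ltnP 0 (a + b); last by lia.
have : (a %/ 2 = b %/ 2)%N by apply: IH => [|q]; [lia|rewrite -!bitS].
by lia.
Qed.

Lemma bit_ge a p : bit a p -> (2 ^ p <= a)%N.
Proof. by apply: contraTT; rewrite -ltnNge /bit => /divn_small ->. Qed.

Lemma bit_ltn a p : bit a p -> (p < a)%N.
Proof. by move=> /bit_ge; apply: leq_trans; exact: ltn_expl. Qed.

Lemma bit_ex a : (0 < a)%N -> exists p, bit a p.
Proof.
elim/ltn_ind: a => a IH a0; case oa: (odd a); first by exists 0%N; rewrite bit0.
have [||p hp] := IH (a %/ 2)%N; [lia|lia|].
by exists p.+1; rewrite bitS.
Qed.

Lemma bit_add a p q : ~~ bit a p -> bit (a + 2 ^ p) q = bit a q (+) (q == p).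
Proof.
elim: p a q => [|p IH] a [|q]; rewrite ?bit0 ?bitS ?expn0 //=.
- by move=> h; rewrite addn1 /= addbT.
- by move=> h; rewrite addbF; congr (bit _ q); lia.
- by move=> _; rewrite oddD oddX /= addbF.
- move=> h; rewrite -IH //; congr (bit _ q); rewrite expnS; lia.
Qed.

Lemma bit_sub a p q : bit a p -> bit (a - 2 ^ p) q = bit a q (+) (q == p).
Proof.
move=> ap; have le := bit_ge ap.
suff np : ~~ bit (a - 2 ^ p) p by rewrite -{2}(subnK le) bit_add // -addbA addbb addbF.
have : bit (a - 2 ^ p + 2 ^ p) p by rewrite subnK.
by rewrite /bit divnDr ?dvdnn // divnn expn_gt0 /= oddD addbT.
Qed.

Lemma bit_sum_exp2 (s : seq nat) q : uniq s -> bit (\sum_(i <- s) 2 ^ i) q = (q \in s).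
Proof.
elim: s q => [|i s IH] q /=; first by rewrite big_nil /bit div0n.
move=> /andP[si us]; rewrite big_cons addnC bit_add ?IH // inE.
by case: eqVneq => [->|_]; rewrite ?addbF // (negbTE si).
Qed.

Definition flip_bit a p b : Prop := forall q, bit b q = bit a q (+) (q == p).

Lemma flip_bit_sym a b p : flip_bit a p b -> flip_bit b p a.
Proof. by move=> ab q; rewrite ab -addbA addbb addbF. Qed.

Lemma flip_bit_fun a b c p : flip_bit a p b -> flip_bit a p c -> b = c.
Proof. by move=> ab ac; apply: bit_inj => q; rewrite ab ac. Qed.

Lemma flip_bit_sub a p : bit a p -> flip_bit a p (a - 2 ^ p).
Proof. by move=> ap q; exact: bit_sub. Qed.

Lemma flip_bit_down a b p : flip_bit a p b -> (b < a)%N -> bit a p.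
Proof.
move=> ab lt; apply: contraLR (lt) => nap.
have bp : bit b p by rewrite ab eqxx (negbTE nap).
have -> : a = (b - 2 ^ p)%N by apply: flip_bit_fun (flip_bit_sym ab) (flip_bit_sub bp).
by rewrite -leqNgt leq_subr.
Qed.

Lemma flip_bit_triangle a b c p q r :
  flip_bit a p b -> flip_bit b q c -> ~ flip_bit a r c.
Proof.
move=> ab bc ac.
have pqr k : (k == p) (+) (k == q) = (k == r).
  by apply: (@addbI (bit a k)); rewrite addbA -ab -bc ac.
have := pqr p; have := pqr q; have := pqr r.
rewrite !eqxx (eq_sym r p) (eq_sym r q) (eq_sym q p).
by case: (p == q); case: (p == r); case: (q == r).
Qed.

Lemma flip_bit_square a b b' x p q r r' : flip_bit a p b -> flip_bit a q b' -> p != q ->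
  flip_bit b r x -> flip_bit b' r' x -> x <> a -> r = q.
Proof.
move=> ab ab' pq bx b'x xa.
have pr : p != r by apply: contra_not_neq xa => pr; apply: flip_bit_fun (flip_bit_sym ab);
  rewrite pr.
have sides k : (k == p) (+) (k == r) = (k == q) (+) (k == r').
  by apply: (@addbI (bit a k)); rewrite !addbA -ab -ab' -bx -b'x.
have := sides p; have := sides q; rewrite !eqxx (negbTE pr) (negbTE pq).
rewrite (eq_sym q p) (negbTE pq) /=.
by case: (eqVneq p r') => // <-; rewrite (eq_sym q p) (negbTE pq); case: eqVneq.
Qed.

End Bits.

(** * The graphs [G_m] *)

Lemma bingraphP m (u v : 'I_m) :
  reflect (exists p, flip_bit u p v) (bingraph m u v).
Proof.
have small (x : 'I_m) q : bit x q -> (q < m)%N.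
  by move=> /bit_ltn xq; exact: ltn_trans xq (ltn_ord x).
apply: (iffP eqP) => [/mem_card1[p pE]|[p uv]].
  exists p => q; have [qm|qm] := ltnP q m.
    have := pE (Ordinal qm); rewrite !inE /= -val_eqE /= => <-.
    by case: (bit u q); case: (bit v q).
  have -> : bit v q = false by apply: contraTF qm => /small; rewrite ltnNge.
  have -> : bit u q = false by apply: contraTF qm => /small; rewrite ltnNge.
  by rewrite gtn_eqF //; exact: leq_trans (ltn_ord p) qm.
have pm : (p < m)%N.
  have := uv p; rewrite eqxx addbT => vp.
  by have [/small//|nu] := boolP (bit u p); apply: (small v); rewrite vp nu.
rewrite (eq_card (B := pred1 (Ordinal pm))) ?card1 // => q.
by rewrite !inE /= -val_eqE /= uv; case: (bit u q); case: (nat_of_ord q == p).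
Qed.

Lemma bingraph_descend m (x : 'I_m) p : bit x p ->
  exists2 y : 'I_m, (y < x)%N & flip_bit x p y.
Proof.
move=> xp; have lt : (x - 2 ^ p < x)%N.
  by rewrite ltn_subrL expn_gt0 /= (leq_trans _ (bit_ge xp)) // expn_gt0.
by exists (Ordinal (ltn_trans lt (ltn_ord x))) => //; exact: flip_bit_sub.
Qed.

Lemma bingraph_connect m (x y : 'I_m) : connect (bingraph m) x y.
Proof.
have m0 : (0 < m)%N by apply: leq_ltn_trans (ltn_ord x).
suff to0 z : connect (bingraph m) z (Ordinal m0).
  apply: connect_trans (to0 x) _.
  by rewrite (sym_connect_sym (@bingraph_sym m)).
have [k] := ubnP (z : nat); elim: k z => // k IH z zk.
have [z0|/bit_ex[p /bingraph_descend[u uz zu]]] := posnP z.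
  by rewrite (_ : z = Ordinal m0) ?connect0 //; exact: val_inj.
apply: (connect_trans (connect1 _) (IH u _)); last exact: leq_trans uz _.
by apply/bingraphP; exists p.
Qed.

Section LastVertex.
Variable v : nat.
Local Notation V := (@ord_max v).
Local Notation e := (bingraph v.+1).
Local Notation W := (nbrs e V).
Implicit Types (c t u w x y : 'I_v.+1) (p q r : nat) (s : {set 'I_v.+1}).

Lemma last_nbrP w : reflect (exists2 p, bit v p & flip_bit v p w) (w \in W).
Proof.
rewrite inE; apply: (iffP (bingraphP _ _)) => [[p Vw]|[p _ Vw]]; last by exists p.
exists p => //; apply: (flip_bit_down Vw); rewrite ltn_neqAle -ltnS ltn_ord andbT.
apply/eqP => wv; have := Vw p; rewrite wv /= eqxx.
by case: bit.
Qed.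

Lemma flip_bit_neq w w' p q : flip_bit v p w -> flip_bit v q w' -> w != w' -> p != q.
Proof.
move=> vw vw'; apply: contra_neq => pq; apply: val_inj; apply: flip_bit_fun vw _.
by rewrite pq.
Qed.

Lemma last_nbrs_independent w w' : w \in W -> w' \in W -> ~~ e w w'.
Proof.
move=> /last_nbrP[p _ vw] /last_nbrP[q _ vw']; apply/negP => /bingraphP[r ww'].
exact: flip_bit_triangle vw ww' vw'.
Qed.

Lemma square_below w w' p q : bit v p -> bit v q -> p != q ->
  flip_bit v p w -> flip_bit v q w' ->
  exists u, [/\ u != V, flip_bit w q u & flip_bit w' p u].
Proof.
move=> vp vq pq vw vw'; have wq : bit w q by rewrite vw vq eq_sym (negbTE pq).
have wv : (w < v)%N.
  by rewrite (flip_bit_fun vw (flip_bit_sub vp)) ltn_subrL expn_gt0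
    (leq_ltn_trans _ (bit_ltn vp)).
have [u uw wu] := bingraph_descend wq; exists u; split=> //.
  by rewrite -val_eqE /= ltn_eqF // (ltn_trans uw).
by move=> k; rewrite wu vw vw' -!addbA [(k == p) (+) _]addbC.
Qed.

Lemma last_square w w' x p q : flip_bit v p w -> flip_bit v q w' -> p != q ->
  x != V -> e w x -> e w' x -> flip_bit w q x.
Proof.
move=> vw vw' pq /eqP xV /bingraphP[r wx] /bingraphP[r' w'x].
rewrite -(flip_bit_square vw vw' pq wx w'x) // => xv; apply: xV; exact: val_inj.
Qed.

Lemma last_nbrs_common w w' : w \in W -> w' \in W -> w != w' ->
  #|nbrs e w :&: nbrs e w'| = 2%N.
Proof.
move=> /last_nbrP[p vp vw] /last_nbrP[q vq vw'] ww'; have pq := flip_bit_neq vw vw' ww'.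
have [u [uV wu w'u]] := square_below vp vq pq vw vw'.
rewrite (_ : _ :&: _ = [set u; V]%SET) ?cards2 ?uV //; apply/setP => x; rewrite !inE.
have [->|xV] := eqVneq x V.
  by rewrite orbT; apply/andP; split; apply/bingraphP;
    [exists p|exists q]; exact: flip_bit_sym.
rewrite orbF; apply/andP/eqP => [[wx w'x]|->].
  exact/val_inj/flip_bit_fun/wu/(last_square vw vw').
by split; apply/bingraphP; [exists q|exists p].
Qed.

Lemma last_nbrs_meet c : c != V -> (#|W :&: nbrs e c| <= 2)%N.
Proof.
move=> cV; rewrite leqNgt; apply/negP => /card_gt2P[a [b [w [[aS bS wS] [ab bw wa]]]]].
have adj x : x \in (W :&: nbrs e c)%SET -> exists2 p, flip_bit v p x & e x c.
  rewrite finset.in_setI => /andP[/last_nbrP[p _ vx]]; rewrite inE (@bingraph_sym v.+1).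
  by exists p.
have [p va ac] := adj a aS; have [q vb bc] := adj b bS; have [r vw wc] := adj w wS.
have pq := flip_bit_neq va vb ab; have qr := flip_bit_neq vb vw bw.
have pr : p != r by rewrite eq_sym (flip_bit_neq vw va wa).
have := last_square va vb pq cV ac bc q.
rewrite (last_square va vw pr cV ac wc) eqxx (negbTE qr).
by case: bit.
Qed.

Lemma cube_below a b w : a \in W -> b \in W -> w \in W -> a != b -> b != w -> a != w ->
  exists t uab ubw uaw, [/\ t != V,
    [/\ uab != V, e uab t, e uab a & e uab b],
    [/\ ubw != V, e ubw t, e ubw b & e ubw w] &
    [/\ uaw != V, e uaw t, e uaw a & e uaw w]].
Proof.
move=> /last_nbrP[p vp va] /last_nbrP[q vq vb] /last_nbrP[r vr vw] ab bw aw.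
have pq := flip_bit_neq va vb ab; have qr := flip_bit_neq vb vw bw.
have pr := flip_bit_neq va vw aw.
have [uab [nab auab buab]] := square_below vp vq pq va vb.
have [ubw [nbw bubw wubw]] := square_below vq vr qr vb vw.
have [uaw [naw auaw wuaw]] := square_below vp vr pr va vw.
have [t tu ut] : exists2 t : 'I_v.+1, (t < uab)%N & flip_bit uab r t.
  apply: bingraph_descend.
  by rewrite auab va vr (eq_sym r) (negbTE pr) (eq_sym r) (negbTE qr).
have edge x y k : flip_bit x k y -> e y x.
  by move=> /flip_bit_sym xy; apply/bingraphP; exists k.
exists t, uab, ubw, uaw; split.
- by rewrite -val_eqE /= ltn_eqF // (leq_trans tu) // -ltnS.
- by split=> //; [rewrite (@bingraph_sym v.+1)|..]; apply: edge; eassumption.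
- split=> //; [|by apply: edge; eassumption..].
  rewrite (@bingraph_sym v.+1); apply: (edge _ _ p) => k.
  rewrite ut auab va bubw vb -!addbA; congr (_ (+) _).
  by rewrite addbC -addbA.
- split=> //; [|by apply: edge; eassumption..].
  rewrite (@bingraph_sym v.+1); apply: (edge _ _ q) => k.
  by rewrite ut auab va auaw va -!addbA; do 2 congr (_ (+) _); rewrite addbC.
Qed.

Lemma last_nbrs_cube s : s \subset W -> #|s| = 3%N ->
  exists2 t, t != V & forall w, w \in s ->
    exists2 u, u != V & (t |: s :\ w)%SET \subset nbrs e u.
Proof.
move=> /fintype.subsetP sW s3.
have /card_gt2P[a [b [c [[as_ bs cs] [ab bc ca]]]]] : (2 < #|s|)%N by rewrite s3.
have sE : s = [set a; b; c]%SET.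
  apply/eqP; rewrite eq_sym eqEcard !finset.subUset !finset.sub1set as_ bs cs s3 /=.
  by rewrite finset.setUC cardsU1 !inE negb_or ca (eq_sym c) bc cards2 ab.
have ac : a != c by rewrite eq_sym.
have [t [uab [ubc [uac [tV [nab abt aba abb] [nbc bct bcb bcc] [nac act aca acc]]]]]] :=
  cube_below (sW a as_) (sW b bs) (sW c cs) ab bc ac.
exists t => // w; rewrite sE !inE -orbA => /or3P[] /eqP->.
- exists ubc => //; apply/fintype.subsetP => x.
  rewrite !inE => /predU1P[->//|/andP[/negbTE->]].
  by move=> /orP[] /eqP->.
- exists uac => //; apply/fintype.subsetP => x.
  rewrite !inE => /predU1P[->//|/andP[/negbTE->]].
  by rewrite orbF => /orP[] /eqP->.
- exists uab => //; apply/fintype.subsetP => x.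
  rewrite !inE => /predU1P[->//|/andP[/negbTE->]].
  by rewrite orbF => /orP[] /eqP->.
Qed.

Lemma last_nbrs_card (s : seq nat) : uniq s -> v = (\sum_(i <- s) 2 ^ i)%N ->
  #|W| = size s.
Proof.
move=> us vE; have vs p : bit v p = (p \in s) by rewrite {1}vE bit_sum_exp2.
pose f p : 'I_v.+1 := inord (v - 2 ^ p).
have fE p : f p = (v - 2 ^ p)%N :> nat by rewrite inordK // ltnS leq_subr.
have vf p : p \in s -> flip_bit v p (f p) by rewrite -vs fE; exact: flip_bit_sub.
have f_inj : {in s &, injective f}.
  move=> p q ps qs pq; have := vf p ps q; rewrite pq (vf q qs) eqxx => /addbI.
  by move=> /esym/eqP.
rewrite -(size_map f) -(card_uniqP _) ?map_inj_in_uniq //.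
apply: eq_card => w; apply/last_nbrP/mapP => [[p vp vw]|[p ps ->]].
  exists p; first by rewrite -vs.
  by apply: val_inj; rewrite /= fE; exact: flip_bit_fun vw (flip_bit_sub vp).
by exists p; [rewrite vs|exact: vf].
Qed.

Lemma widen_ord_inj n m (le_nm : (n <= m)%N) : injective (widen_ord le_nm).
Proof. by move=> i j ij; apply: val_inj; exact: (congr1 val ij). Qed.

Lemma nbhd_complex_del_last (s : {set 'I_v.+1}) : nbhd_complex_del e V s <->
  exists2 s0, nbhd_complex (bingraph v) s0 & s = (widen_ord (leqnSn v) @: s0)%SET.
Proof.
set f := widen_ord _; have f_inj : injective f := @widen_ord_inj _ _ _.
have fV i : f i != V by rewrite -val_eqE /= ltn_eqF.
have f_onto i : i != V -> exists j, i = f j.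
  rewrite -val_eqE /= => iv; have lt : (i < v)%N by rewrite ltn_neqAle iv -ltnS ltn_ord.
  by exists (Ordinal lt); exact: val_inj.
have f_clnbrs (c x : 'I_v) : (f x \in clnbrs e (f c)) = (x \in clnbrs (bingraph v) c).
  rewrite !in_clnbrs (inj_eq f_inj); congr (_ || _).
  by apply/bingraphP/bingraphP.
split=> [[s0 [c cV /fintype.subsetP sc]]|[t [t0 [c /fintype.subsetP tc]] ->]]; last first.
  split.
    by have [x xt] := finset.set0Pn _ t0; apply/finset.set0Pn; exists (f x); exact: imset_f.
  exists (f c) => //; apply/fintype.subsetP => _ /imsetP[x /tc xt ->].
  by rewrite finset.in_setD1 fV f_clnbrs.
have sE : s = (f @: (f @^-1: s))%SET.
  apply/setP => x; apply/idP/imsetP => [xs|[y + ->]]; last by rewrite inE.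
  have /setD1P[/f_onto[y yE] _] := sc x xs.
  by exists y => //; rewrite inE -yE.
exists (f @^-1: s)%SET => //; split.
  by apply: contra_neq s0 => e0; rewrite sE e0 imset0.
have [c' c'E] := f_onto c cV; exists c'; apply/fintype.subsetP => x; rewrite inE => /sc.
by rewrite finset.in_setD1 fV c'E f_clnbrs.
Qed.

End LastVertex.

Lemma cechG2E (R : realType) m : cechG2 R m = space R (nbhd_complex (bingraph m)).
Proof. by rewrite /cechG2 (cech2E (@bingraph_sym m) (@bingraph_irrefl m)). Qed.

Lemma cechG2_step (R : realType) v (x0 : cechG2 R v) : (0 < v)%N ->
  exists x1 : cechG2 R v.+1, pointed_equiv R x1
    (@wedge_base R 2 ((#|nbrs (bingraph v.+1) ord_max| - 1) ^ 2) _ x0 x0).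
Proof.
move: x0; rewrite !cechG2E => x0 v0.
have [[x xD] xx0] :=
  relabel_pointed_equiv (@widen_ord_inj _ _ _) (@nbhd_complex_del_last v) x0.
have [w0 w0W] : exists w0, w0 \in nbrs (bingraph v.+1) ord_max.
  have [p vp] := bit_ex v0; have [w _ vw] := @bingraph_descend v.+1 ord_max p vp.
  by exists w; apply/last_nbrP; exists p.
have xN : x \in @realization R v.+1 (nbhd_complex (bingraph v.+1)).
  by move: (xD); rewrite !inE; exact/realizationS/nbhd_complex_del_sub.
exists (SigSub xN); apply: pointed_equiv_trans
  (wedge_pointed_equiv (@space_hausdorff _ _ _) (@space_hausdorff _ _ _) xx0).
apply: (nbhd_complex_add_vertex _ _ w0W).
- exact: bingraph_sym.
- exact: bingraph_irrefl.
- exact: last_nbrs_independent.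
- exact: last_nbrs_common.
- exact: last_nbrs_meet.
- exact: last_nbrs_cube.
- exact: bingraph_connect.
Qed.

Lemma cechG2_one (R : realType) :
  exists x : cechG2 R 1, pointed_equiv R x (@bouquet_pt R 2 0).
Proof.
rewrite cechG2E; have cK := nbhd_complex_complex (bingraph 1).
have vertexP : (delta_mx 0 0 : 'rV[R]_1) \in realization (nbhd_complex (bingraph 1)).
  rewrite inE; exists (finset.set1 0); last by apply: geom_simplex_delta; rewrite inE.
  split; first by apply/finset.set0Pn; exists 0; rewrite inE.
  by exists 0; rewrite finset.sub1set finset.setU11.
pose pt : space R (nbhd_complex (bingraph 1)) := SigSub vertexP.
exists pt.
apply: (@homeomorphic_pointed_equiv _ _ _ _ _ (fun=> bouquet_pt 0) (fun=> pt)) => //.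
- exact: cts_cst.
- exact: cts_cst.
- move=> y; apply: val_inj; apply/rowP => k; rewrite (ord1 k) mxE !eqxx.
  have [_ + _] := (realizationP _ cK).1 (set_mem (valP y)).
  by rewrite big_ord_recl big_ord0 addr0 => <-.
- by apply: wedge_spheres_ind => [[]|[]].
Qed.

Lemma cechG2_bouquet (R : realType) v :
  exists (x : cechG2 R v.+1) n, pointed_equiv R x (@bouquet_pt R 2 n).
Proof.
elim: v => [|v [x [n xn]]]; first by have [x x0] := cechG2_one R; exists x, 0%N.
have [x1 x1E] := cechG2_step x (ltn0Sn v).
have hausdorff : hausdorff_space (cechG2 R v.+1) by rewrite cechG2E; exact: space_hausdorff.
exists x1; eexists; exact: pointed_equiv_bouquet_wedge hausdorff xn x1E.
Qed.

Local Close Scope ring_scope.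
Local Close Scope classical_set_scope.

Theorem theorem4p2 (R : realType) (m : nat) (s : seq nat)
    (m_ge2 : (2 <= m)%N) (s_incr : sorted ltn s)
    (s_sum : m.-1 = (\sum_(i <- s) 2 ^ i)%N) :
  let alpha := ((size s - 1) ^ 2)%N in
  (exists n : nat, homotopy_equivalent R (cechG2 R m) (bouquet R 2 n)) /\
  (forall x0 : cechG2 R m.-1,
     homotopy_equivalent R (cechG2 R m) (wedge_spheres R 2 alpha x0)).
Proof.
case: m m_ge2 s_sum => [//|v] v_gt0 s_sum alpha; split.
  have [x [n xn]] := cechG2_bouquet R v; exists n.
  exact: pointed_equiv_homotopy_equivalent xn.
move=> x0; have s_uniq : uniq s := sorted_uniq ltn_trans ltnn s_incr.
have [x1] := cechG2_step x0 v_gt0; rewrite (last_nbrs_card s_uniq s_sum) => x1E.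
exact: pointed_equiv_homotopy_equivalent x1E.
Qed.
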